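(* Let $\Sigma$ be a rotational uniformly elliptic Weingarten surface in $\mathbb{S}^2\times\mathbb{R}$; that is, $\Sigma$ is a rotational surface in a class $\mathcal{W}_g$ for some $g$ satisfying $\Lambda_1<g'<\Lambda_2<0$ for some constants $\Lambda_1,\Lambda_2<0$. Then $\Sigma$ has bounded second fundamental form and it cannot have singularities.
   Context: **Elliptic Weingarten surfaces.** A Weingarten surface is an immersed oriented surface in a Riemannian 3-manifold whose principal curvatures satisfy $W(\kappa_1,\kappa_2)=0$ with $W\in C^1(\mathbb{R}^2)$ symmetric, $W(x,y)=W(y,x)$; the equation is elliptic if $\frac{\partial W}{\partial k_1}\frac{\partial W}{\partial k_2}>0$ on $W^{-1}(0)$. Each connected component of $W^{-1}(0)$ is then a properly embedded curve that is the graph of a strictly decreasing $C^1$ function, symmetric with respect to the diagonal, and defines its own theory. With $\kappa_1\ge\kappa_2$, and after possibly changing the orientation of the surface, the equation becomes $$\kappa_2=g(\kappa_1),\qquad g'<0,$$ where $g:I_g\to J_g$ is a $C^1$ bijection, $I_g=[\alpha,\infty)$, $J_g=(b,\alpha]$, $g(\alpha)=\alpha$ for some $\alpha\in\mathbb{R}$ (the umbilical constant), and $b:=g(\infty)=\lim_{x\to\infty}g(x)\in[-\infty,\alpha)$. (The symmetry of $W$ means that the function on $(b,\infty)$ equal to $g$ on $[\alpha,\infty)$ and to $g^{-1}$ on $(b,\alpha]$ is $C^1$.) $\mathcal{W}_g$ denotes the class of all oriented surfaces immersed in $\mathbb{S}^2\times\mathbb{R}$ whose principal curvatures $\kappa_1\ge\kappa_2$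 satisfy $\kappa_2=g(\kappa_1)$ at every point. **Uniform ellipticity.** The class $\mathcal{W}_g$ is uniformly elliptic if there are constants $\Lambda_1,\Lambda_2<0$ with $\Lambda_1<g'<\Lambda_2<0$ on $I_g$ (in particular $b=-\infty$). **Rotational surfaces.** View $\mathbb{S}^2\times\mathbb{R}=\{(x_1,x_2,x_3,t)\in\mathbb{R}^4: x_1^2+x_2^2+x_3^2=1\}$. Up to isometry, a rotational surface is $$\Sigma=\{(\sin x(s)\cos\theta,\ \sin x(s)\sin\theta,\ \cos x(s),\ t(s)) : s\in I,\ \theta\in[0,2\pi]\},$$ where $I\subset\mathbb{R}$ is an interval, $x(s)\in[0,\pi]$, and the profile curve is parameterized by arc length, $x'(s)^2+t'(s)^2=1$. The rotation axes are $\{(0,0,\pm1)\}\times\mathbb{R}$ (where $x=0$ and $x=\pi$). **Singularities.** If $a\in\mathbb{R}$ is an endpoint of $I$, $\Sigma$ has a singularity at $s=a$ if $\Sigma$ cannot be extended to a regular surface on $I\cup\{a\}$. *)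

(* Defs.v *)
From Stdlib Require Import Reals.
From Coquelicot Require Import Coquelicot.

Set Implicit Arguments.
Open Scope R_scope.

(* f is C^k on D, D not necessarily open: as usual, f is then required to be
   C^k near every point of D.  For a nondegenerate interval D the values
   Derive_n f j s with j <= k and s in D, endpoints included, depend only on
   the restriction of f to D. *)
Definition Ck_on (k : nat) (D : R -> Prop) (f : R -> R) : Prop :=
  forall s, D s ->
    locally s (fun u =>
      (forall j, (j <= k)%nat -> ex_derive_n f j u) /\
      continuous (Derive_n f k) u).

Definition interval (J : R -> Prop) : Prop :=
  (forall a b c, J a -> J b -> a <= c <= b -> J c) /\
  (exists a b, J a /\ J b /\ a < b).

Definition endpoint (J : R -> Prop) (a : R) : Prop :=
  is_lub_Rbar J (Finite a) \/ is_glb_Rbar J (Finite a).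

Definition adjoin (J : R -> Prop) (a : R) : R -> Prop :=
  fun s => J s \/ s = a.

Definition R4 : Type := (R * R * R * R)%type.

Definition co1 (p : R4) : R := fst (fst (fst p)).
Definition co2 (p : R4) : R := snd (fst (fst p)).
Definition co3 (p : R4) : R := snd (fst p).
Definition co4 (p : R4) : R := snd p.

Definition dot (p q : R4) : R :=
  co1 p * co1 q + co2 p * co2 q + co3 p * co3 q + co4 p * co4 q.

Definition lincomb (a : R) (p : R4) (b : R) (q : R4) : R4 :=
  (a * co1 p + b * co1 q, a * co2 p + b * co2 q,
   a * co3 p + b * co3 q, a * co4 p + b * co4 q).

(* The normal in R^4 of the hypersurface S^2 x R at its point p. *)
Definition ambient_normal (p : R4) : R4 := (co1 p, co2 p, co3 p, 0).

(** Parametrized surfaces X : R -> R -> R^4 *)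

Definition Derive4 (c : R -> R4) (u : R) : R4 :=
  (Derive (fun z => co1 (c z)) u, Derive (fun z => co2 (c z)) u,
   Derive (fun z => co3 (c z)) u, Derive (fun z => co4 (c z)) u).

Definition du (X : R -> R -> R4) (u v : R) : R4 := Derive4 (fun z => X z v) u.
Definition dv (X : R -> R -> R4) (u v : R) : R4 := Derive4 (fun z => X u z) v.

Definition immersed_at (X : R -> R -> R4) (u v : R) : Prop :=
  forall a b, lincomb a (du X u v) b (dv X u v) = (0, 0, 0, 0) ->
    a = 0 /\ b = 0.

(* Tangent vectors are given by their coordinates in the frame (X_u, X_v). *)
Definition tangent_vector (X : R -> R -> R4) (u v : R) (w : R * R) : R4 :=
  lincomb (fst w) (du X u v) (snd w) (dv X u v).

Definition first_form (X : R -> R -> R4) (u v : R) (w z : R * R) : R :=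
  dot (tangent_vector X u v w) (tangent_vector X u v z).

(* n is one of the two unit normals of X within S^2 x R. *)
Definition unit_normal (X : R -> R -> R4) (u v : R) (n : R4) : Prop :=
  dot n n = 1 /\ dot n (ambient_normal (X u v)) = 0 /\
  dot n (du X u v) = 0 /\ dot n (dv X u v) = 0.

(* The second fundamental form of X in S^2 x R for the unit normal n.  The
   Levi-Civita connection of S^2 x R is the tangential part of the flat one and
   n is tangent to S^2 x R, so the flat second derivatives can be used. *)
Definition second_form (X : R -> R -> R4) (n : R4) (u v : R)
    (w z : R * R) : R :=
  fst w * fst z * dot (du (du X) u v) n
  + (fst w * snd z + snd w * fst z) * dot (du (dv X) u v) n
  + snd w * snd z * dot (dv (dv X) u v) n.

(* k1 and k2 are the eigenvalues, with multiplicity, of the shape operator: it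
   is diagonal with entries k1, k2 in some orthonormal basis. *)
Definition principal_curvatures (X : R -> R -> R4) (n : R4) (u v : R)
    (k1 k2 : R) : Prop :=
  exists e1 e2 : R * R,
    first_form X u v e1 e1 = 1 /\ first_form X u v e2 e2 = 1 /\
    first_form X u v e1 e2 = 0 /\
    (forall w, second_form X n u v e1 w = k1 * first_form X u v e1 w) /\
    (forall w, second_form X n u v e2 w = k2 * first_form X u v e2 w).

Definition C2_map_at (X : R -> R -> R4) (u v : R) : Prop :=
  ex_diff_n (fun y z => co1 (X y z)) 2 u v /\
  ex_diff_n (fun y z => co2 (X y z)) 2 u v /\
  ex_diff_n (fun y z => co3 (X y z)) 2 u v /\
  ex_diff_n (fun y z => co4 (X y z)) 2 u v.

(* S is a regular (embedded, boundaryless, C^2) surface near its point p: some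
   neighbourhood V of p meets S in the homeomorphic image of an open set U of
   the plane under a C^2 immersion X, with inverse Y. *)
Definition regular_surface_at (S : R4 -> Prop) (p : R4) : Prop :=
  S p /\
  exists (V : R4 -> Prop) (U : R * R -> Prop)
         (X : R -> R -> R4) (Y : R4 -> R * R),
    open V /\ V p /\ open U /\
    (forall u v, U (u, v) -> C2_map_at X u v /\ immersed_at X u v) /\
    (forall u v, U (u, v) ->
       S (X u v) /\ V (X u v) /\ Y (X u v) = (u, v)) /\
    (forall q, S q -> V q -> U (Y q) /\ X (fst (Y q)) (snd (Y q)) = q) /\
    (forall q, S q -> V q ->
       filterlim Y (within (fun r => S r /\ V r) (locally q)) (locally (Y q))).

(** Rotational surfaces *)

Definition rot (x t : R -> R) (s th : R) : R4 :=
  (sin (x s) * cos th, sin (x s) * sin th, cos (x s), t s).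

Definition off_axis (x : R -> R) (s : R) : Prop := 0 < x s < PI.

Definition rot_patch (J : R -> Prop) (x t : R -> R) (s d : R) : R4 -> Prop :=
  fun p => exists r th, J r /\ Rabs (r - s) < d /\ p = rot x t r th.

(* The rotational surface with profile curve (x, t) on J is regular.  The
   second alternative of the last clause is for points of the rotation axes,
   where (s, th) |-> rot x t s th degenerates; as the surface is only
   immersed, just the part of it with parameter near s is considered there. *)
Definition regular_rotational (J : R -> Prop) (x t : R -> R) : Prop :=
  Ck_on 2 J x /\ Ck_on 2 J t /\
  (forall s, J s -> 0 <= x s <= PI) /\
  (forall s, J s -> (Derive x s) ^ 2 + (Derive t s) ^ 2 = 1) /\
  (forall s, J s ->
     (forall th, immersed_at (rot x t) s th) \/
     (exists d, 0 < d /\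
        regular_surface_at (rot_patch J x t s d) (rot x t s 0))).

(* A continuous choice N of the unit normal.  The parameters (s, th) do not
   give coordinates on the axes, so this and the conditions on the curvatures
   below are expressed off the axes.  A regular C^2 surface meets the axes at
   endpoints of J only, and there they follow by continuity. *)
Definition orientation (J : R -> Prop) (x t : R -> R)
    (N : R -> R -> R4) : Prop :=
  forall s th, J s -> off_axis x s ->
    unit_normal (rot x t) s th (N s th) /\
    filterlim (fun q : R * R => N (fst q) (snd q))
      (within (fun q : R * R => J (fst q) /\ off_axis x (fst q))
              (locally (s, th)))
      (locally (N s th)).

(** Elliptic Weingarten classes *)

(* The function g (only its values on [al, oo) matter) defines an elliptic
   Weingarten equation with umbilical constant al, where b = g(oo).  The
   function G is g on [al, oo) and the inverse of g on (b, al]. *)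
Definition elliptic_datum (g : R -> R) (al : R) (b : Rbar) : Prop :=
  Rbar_lt b al /\
  Ck_on 1 (fun k => al <= k) g /\
  (forall k, al <= k -> Derive g k < 0) /\
  g al = al /\
  is_lim g p_infty b /\
  (forall k, al <= k -> Rbar_lt b (g k) /\ g k <= al) /\
  (forall y : R, Rbar_lt b y -> y <= al -> exists! k, al <= k /\ g k = y) /\
  (exists G : R -> R,
     Ck_on 1 (fun k => Rbar_lt b k) G /\
     (forall k, al <= k -> G k = g k /\ G (g k) = k)).

Definition uniformly_elliptic (g : R -> R) (al : R) : Prop :=
  exists L1 L2, L1 < 0 /\ L2 < 0 /\
    forall k, al <= k -> L1 < Derive g k < L2.

Definition weingarten (g : R -> R) (al : R) (J : R -> Prop) (x t : R -> R)
    (N : R -> R -> R4) : Prop :=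
  forall s th k1 k2, J s -> off_axis x s ->
    principal_curvatures (rot x t) (N s th) s th k1 k2 -> k2 <= k1 ->
    al <= k1 /\ k2 = g k1.

Definition bounded_second_form (J : R -> Prop) (x t : R -> R)
    (N : R -> R -> R4) : Prop :=
  exists C, forall s th w z, J s -> off_axis x s ->
    Rabs (second_form (rot x t) (N s th) s th w z)
    <= C * sqrt (first_form (rot x t) s th w w)
         * sqrt (first_form (rot x t) s th z z).

Definition has_singularity_at (J : R -> Prop) (x t : R -> R) (a : R) : Prop :=
  endpoint J a /\
  ~ (exists x' t' : R -> R,
       (forall s, J s -> x' s = x s /\ t' s = t s) /\
       regular_rotational (adjoin J a) x' t').

(* Main.v *)
Require Import Defs.
From Stdlib Require Import Reals Lra Psatz Classical.
From Stdlib Require Import FunctionalExtensionality PropExtensionality.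
From Coquelicot Require Import Coquelicot.
Open Scope R_scope.

(** Write x' = cos phi, t' = sin phi along the profile curve.  The principal
    curvatures are, up to a common sign, k_p = phi' = x' t'' - x'' t' for the
    profile and k_r = t' cot x for the parallels, and uniform ellipticity turns
    the Weingarten equation into k_p = H (k_r), where H is a decreasing function
    on the whole line whose slopes lie between two negative constants
    ([weingarten_function], [weingarten_curvatures]); it has a fixed point u.

    Seen as a function of x, y = t' satisfies dy/dx = phi' = H (y cot x).  The
    right-hand side is Lipschitz in y, so a solution F of this equation with
    prescribed initial value exists on all of (0, pi)
    ([profile_equation_exists]), whether or not |F| stays below 1, and t' = F (x)
    is a first integral of the profile curve ([first_integral]): the curve turns
    back where |F| = 1 and retraces the same graph.  This confines an arbitrarily
    long profile to a single function F.

    Everything then depends on F near x = 0 and, by reflection, near x = pi.  If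
    F differs from u tan x by more than a term of order x^3, the negative slope of
    H makes the difference grow to infinity as x decreases to 0 ([blow_up]), so
    |F| > 1 near the axis and the profile, where |t'| <= 1, stays away from it.
    Otherwise F = u tan x + O (x^3), hence k_r tends to u ([axis_alternative]).
    In both cases k_r = F cot x is bounded on {|F| <= 1} ([curvature_bounded]),
    and so is k_p = H (k_r): this is the bound on the second fundamental form.

    A profile that reaches an axis has F -> 0, so t' = 0 and |x'| = 1 there.  As
    x stays in [0, pi], this is impossible at an interior parameter; all interior
    parameters are therefore off the axes and the first integral holds on the
    whole of J ([profile_structure]).  At a finite endpoint, x has a limit, hence
    so do F (x), k_r, k_p and the second derivatives of the profile, which
    extends as a C^2 curve ([Ck_on_2_extension], [profile_extends]).  The
    extended surface is immersed if the limit point is off the axes.  On an axis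
    it is the graph of a function k of z = x_1^2 + x_2^2 over a disc, where
    dk/dz is explicit in terms of F and the expansion of F makes the graph C^2
    at its centre ([cap_profile], [axis_cap], [solves_profile_regular]). *)

(** * Calculus on an interval *)

Lemma sqr_eq_1 (a : R) : a ^ 2 = 1 -> a = 1 \/ a = -1.
Proof.
  intros h; destruct (Rmult_integral (a - 1) (a + 1)); [nra|left; lra|right; lra].
Qed.

Lemma derive_nonneg_incr (f df : R -> R) (a b : R) :
  a <= b ->
  (forall r, a <= r <= b -> is_derive f r (df r)) ->
  (forall r, a < r < b -> 0 <= df r) ->
  f a <= f b.
Proof.
  intros [hab|<-] hd hp; [|lra].
  destruct (MVT_cor2 f df a b hab) as (c & e & hc).
  - intros r hr; apply is_derive_Reals, hd, hr.
  - specialize (hp c hc); nra.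
Qed.

(** The supremum of the points up to which f is positive is a zero of f by
    continuity on both sides. *)
Lemma first_zero (f : R -> R) (a b : R) :
  a <= b -> (forall r, a <= r <= b -> continuous f r) ->
  0 < f a -> f b <= 0 ->
  exists z, a < z <= b /\ f z = 0 /\ forall r, a <= r < z -> 0 < f r.
Proof.
  intros hab hc ha hb.
  assert (pos : forall r, a <= r <= b -> forall y, f r <> y ->
            exists d, 0 < d /\ forall q, Rabs (q - r) < d -> (f q - y) * (f r - y) > 0).
  { intros r hr y hy.
    assert (he : 0 < Rabs (f r - y)) by (apply Rabs_pos_lt; lra).
    destruct (proj1 (filterlim_locally f (f r)) (hc r hr) (mkposreal _ he)) as [d hd].
    exists d; split; [apply cond_pos|]; intros q hq.
    specialize (hd q hq).
    change (Rabs (f q - f r) < Rabs (f r - y)) in hd.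
    revert hd; unfold Rabs; destruct (Rcase_abs (f q - f r)), (Rcase_abs (f r - y)); nra. }
  pose (E := fun r => a <= r <= b /\ forall q, a <= q <= r -> 0 < f q).
  destruct (completeness E) as [z [zub zlub]].
  - exists b; intros r [hr _]; lra.
  - exists a; split; [lra|]; intros q hq; replace q with a by lra; exact ha.
  - assert (az : a <= z).
    { apply zub; split; [lra|]; intros q hq; replace q with a by lra; exact ha. }
    assert (zb : z <= b) by (apply zlub; intros r [hr _]; lra).
    assert (left : forall r, a <= r < z -> 0 < f r).
    { intros r hr; apply Rnot_le_lt; intros hn.
      enough (z <= r) by lra.
      apply zlub; intros q [_ hq]; apply Rnot_lt_le; intros hrq.
      specialize (hq r ltac:(lra)); lra. }
    assert (fz : f z = 0).
    { destruct (Req_dec (f z) 0) as [|hne]; [assumption|exfalso].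
      destruct (pos z ltac:(lra) 0 hne) as (d & hd & hq).
      destruct (Rle_dec (f z) 0) as [hneg|hpos].
      - assert (a < z).
        { destruct az as [|e0]; [assumption|rewrite <- e0 in hneg; lra]. }
        pose (r := Rmax a (z - d / 2)).
        assert (a <= r < z /\ z - d < r) as [hr1 hr2].
        { unfold r; split; [split|]; [apply Rmax_l|apply Rmax_lub_lt; lra|].
          eapply Rlt_le_trans; [|apply Rmax_r]; lra. }
        specialize (left r hr1).
        specialize (hq r ltac:(rewrite Rabs_left; lra)); nra.
      - assert (z < b) by (destruct zb as [|e0]; [assumption|rewrite e0 in hpos; lra]).
        pose (r := Rmin b (z + d / 2)).
        assert (z < r <= b /\ r < z + d) as [hr1 hr2].
        { unfold r; split; [split|]; [apply Rmin_glb_lt; lra|apply Rmin_l|].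
          eapply Rle_lt_trans; [apply Rmin_r|]; lra. }
        enough (r <= z) by lra.
        apply zub; split; [lra|]; intros q hq'.
        destruct (Rlt_dec q z) as [hqz|hqz]; [apply left; lra|].
        specialize (hq q ltac:(rewrite Rabs_pos_eq; lra)); nra. }
    exists z; repeat split; [|exact zb|exact fz|exact left].
    destruct az as [|e0]; [assumption|rewrite <- e0 in fz; lra].
Qed.

Lemma last_zero (f : R -> R) (a b : R) :
  a <= b -> (forall r, a <= r <= b -> continuous f r) ->
  f a <= 0 -> 0 < f b ->
  exists z, a <= z < b /\ f z = 0 /\ forall r, z < r <= b -> 0 < f r.
Proof.
  intros hab hc ha hb.
  destruct (first_zero (fun r => f (- r)) (- b) (- a)) as (z & hz & fz & hr).
  - lra.
  - intros r hr; apply (continuous_comp (fun r => - r) f).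
    + apply (continuous_opp (fun r : R => r)), continuous_id.
    + apply hc; lra.
  - rewrite Ropp_involutive; exact hb.
  - rewrite Ropp_involutive; exact ha.
  - exists (- z); repeat split; [lra|lra|exact fz|].
    intros r h; rewrite <- (Ropp_involutive r); apply hr; lra.
Qed.

(** Uniqueness for a linear differential inequality, in both directions of time:
    D^2 exp (-2 K r) is nonincreasing and D^2 exp (2 K r) is nondecreasing. *)
Lemma gronwall_zero (D D' : R -> R) (K p q : R) :
  (forall r, Rmin p q <= r <= Rmax p q ->
     is_derive D r (D' r) /\ Rabs (D' r) <= K * Rabs (D r)) ->
  D p = 0 -> D q = 0.
Proof.
  intros h h0.
  assert (key : forall r, Rmin p q <= r <= Rmax p q ->
            Rabs (D r * D' r) <= K * (D r) ^ 2).
  { intros r hr; destruct (h r hr) as [_ hb].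
    rewrite Rabs_mult; pose proof (Rabs_pos (D r)).
    replace (D r ^ 2) with (Rabs (D r) * Rabs (D r))
      by (rewrite <- Rabs_mult, Rabs_pos_eq; nra).
    nra. }
  assert (hE : forall k r, Rmin p q <= r <= Rmax p q ->
            is_derive (fun r => (D r) ^ 2 * exp (k * r)) r
              ((2 * (D r * D' r) + k * (D r) ^ 2) * exp (k * r))).
  { intros k r hr; destruct (h r hr) as [hd _].
    auto_derive; [eexists; exact hd|].
    replace (Derive (fun x => D x) r) with (D' r)
      by (symmetry; apply is_derive_unique, hd).
    ring. }
  destruct (Rle_dec p q) as [hpq|hpq].
  - rewrite Rmin_left, Rmax_right in key, hE by lra.
    assert (m : - (D p ^ 2 * exp (- (2 * K) * p)) <= - (D q ^ 2 * exp (- (2 * K) * q))).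
    { apply (derive_nonneg_incr (fun r => - (D r ^ 2 * exp (- (2 * K) * r)))
        (fun r => - ((2 * (D r * D' r) + - (2 * K) * (D r) ^ 2) * exp (- (2 * K) * r))) p q hpq).
      - intros r hr; apply (is_derive_opp (fun r => D r ^ 2 * exp (- (2 * K) * r))), hE, hr.
      - intros r hr; specialize (key r ltac:(lra)); apply Rabs_le_between in key.
        pose proof (exp_pos (- (2 * K) * r)); nra. }
    rewrite h0 in m; pose proof (exp_pos (- (2 * K) * q)); pose proof (pow2_ge_0 (D q)).
    assert (D q ^ 2 <= 0) by nra. nra.
  - rewrite Rmin_right, Rmax_left in key, hE by lra.
    assert (m : D q ^ 2 * exp (2 * K * q) <= D p ^ 2 * exp (2 * K * p)).
    { apply (derive_nonneg_incr (fun r => D r ^ 2 * exp (2 * K * r))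
        (fun r => (2 * (D r * D' r) + 2 * K * (D r) ^ 2) * exp (2 * K * r)) q p); [lra| |].
      - intros r hr; apply hE, hr.
      - intros r hr; specialize (key r ltac:(lra)); apply Rabs_le_between in key.
        pose proof (exp_pos (2 * K * r)); nra. }
    rewrite h0 in m; pose proof (exp_pos (2 * K * q)); pose proof (pow2_ge_0 (D q)).
    assert (D q ^ 2 <= 0) by nra. nra.
Qed.

(** * Picard's theorem *)

(** The exponential is its own primitive up to the factor l, which is what makes
    the Picard operator a contraction for an exponentially weighted norm. *)
Lemma RInt_exp_bound (h : R -> R) (C l u0 u : R) :
  0 < l -> (forall v, continuous h v) ->
  (forall v, Rabs (h v) <= C * exp (l * Rabs (v - u0))) ->
  Rabs (RInt h u0 u) <= C / l * exp (l * Rabs (u - u0)).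
Proof.
  intros hl hc hb.
  assert (hI : forall v, is_derive (RInt h u0) v (h v)).
  { intros v; apply (is_derive_RInt h (RInt h u0) u0 v); [|apply hc].
    apply filter_forall; intros w; apply (RInt_correct h u0 w).
    apply ex_RInt_continuous; intros; apply hc. }
  assert (C0 : 0 <= C).
  { specialize (hb u0); rewrite Rminus_diag, Rabs_R0, Rmult_0_r, exp_0 in hb.
    pose proof (Rabs_pos (h u0)); lra. }
  assert (hl' : 0 < / l) by (apply Rinv_0_lt_compat; lra).
  assert (z : RInt h u0 u0 = 0) by (rewrite RInt_point; reflexivity).
  set (I := RInt h u0) in *; clearbody I.
  assert (one : forall s : R, s ^ 2 = 1 -> 
     (0 <= u - u0 -> s * I u <= C / l * exp (l * (u - u0))) /\
     (u - u0 <= 0 -> s * I u <= C / l * exp (l * - (u - u0)))).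
  { intros s hs.
    assert (hs' : forall v, - (C * exp (l * Rabs (v - u0))) <= s * h v <= C * exp (l * Rabs (v - u0))).
    { intros v; apply Rabs_le_between; rewrite Rabs_mult.
      replace (Rabs s) with 1; [rewrite Rmult_1_l; apply hb|].
      symmetry; unfold Rabs; destruct (Rcase_abs s); nra. }
    split; intros hu.
    - assert (m := derive_nonneg_incr
        (fun v => C / l * exp (l * (v - u0)) - s * I v)
        (fun v => C * exp (l * (v - u0)) - s * h v) u0 u).
      cbv beta in m; rewrite z in m; replace (l * (u0 - u0)) with 0 in m by ring; rewrite exp_0 in m.
      assert (0 <= C / l) by (unfold Rdiv; nra).
      enough (C / l * 1 - s * 0 <= C / l * exp (l * (u - u0)) - s * I u) by nra.
      apply m; [lra| |].
      + intros r hr; auto_derive; [eexists; apply hI|].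
        replace (Derive (fun x => I x) r) with (h r)
          by (symmetry; apply is_derive_unique, hI); unfold Rminus; field; lra.
      + intros r hr; specialize (hs' r); rewrite Rabs_pos_eq in hs' by lra; lra.
    - assert (m := derive_nonneg_incr
        (fun v => s * I v - C / l * exp (l * - (v - u0)))
        (fun v => s * h v + C * exp (l * - (v - u0))) u u0).
      cbv beta in m; rewrite z in m; replace (l * - (u0 - u0)) with 0 in m by ring; rewrite exp_0 in m.
      assert (0 <= C / l) by (unfold Rdiv; nra).
      enough (s * I u - C / l * exp (l * - (u - u0)) <= s * 0 - C / l * 1) by nra.
      apply m; [lra| |].
      + intros r hr; auto_derive; [eexists; apply hI|].
        replace (Derive (fun x => I x) r) with (h r)
          by (symmetry; apply is_derive_unique, hI); unfold Rminus; field; lra.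
      + intros r hr; specialize (hs' r); rewrite Rabs_left1 in hs' by lra; lra. }
  destruct (one 1 ltac:(ring)) as [p1 p2], (one (-1) ltac:(ring)) as [n1 n2].
  apply Rabs_le_between.
  destruct (Rle_dec 0 (u - u0)) as [hu|hu].
  - rewrite (Rabs_pos_eq (u - u0)) by lra; specialize (p1 hu); specialize (n1 hu); lra.
  - rewrite (Rabs_left1 (u - u0)) by lra.
    specialize (p2 ltac:(lra)); specialize (n2 ltac:(lra)); lra.
Qed.

(** Global existence on the line: for the norm sup |y| / exp (2 L |u - u0|) the
    Picard operator contracts by 1/2.  The bound B on f along the constant y0
    ensures that the first iterate is at finite distance from y0. *)
Lemma picard (f : R -> R -> R) (L B u0 y0 : R) :
  0 < L ->
  (forall u y, continuity_2d_pt f u y) ->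
  (forall u y z, Rabs (f u y - f u z) <= L * Rabs (y - z)) ->
  (forall u, Rabs (f u y0) <= B) ->
  exists Y : R -> R, Y u0 = y0 /\ forall u, is_derive Y u (f u (Y u)).
Proof.
  intros hL hc hlip hB.
  assert (B0 : 0 <= B) by (pose proof (hB 0); pose proof (Rabs_pos (f 0 y0)); lra).
  assert (comp : forall y : R -> R, (forall u, continuous y u) ->
            forall u, continuous (fun v => f v (y v)) u).
  { intros y hy u.
    apply (continuous_comp_2 (fun v => v) y f u).
    - apply continuous_id.
    - apply hy.
    - apply continuity_2d_pt_filterlim, hc. }
  pose (W := fun u => exp (2 * L * Rabs (u - u0))).
  assert (W1 : forall u, 1 <= W u).
  { intros u; unfold W; rewrite <- exp_0 at 1. 
    pose proof (Rabs_pos (u - u0)).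
    destruct (Req_dec (2 * L * Rabs (u - u0)) 0) as [->|]; [lra|].
    apply Rlt_le, exp_increasing; nra. }
  pose (step := fun (y : R -> R) u => y0 + RInt (fun v => f v (y v)) u0 u).
  pose (Yn := nat_rect (fun _ => R -> R) (fun _ => y0) (fun _ y => step y)).
  assert (stepD : forall y, (forall u, continuous y u) ->
            forall u, is_derive (step y) u (f u (y u))).
  { intros y hy u; unfold step.
    replace (f u (y u)) with (0 + f u (y u)) by ring.
    apply (is_derive_plus (fun _ => y0) (fun u => RInt (fun v => f v (y v)) u0 u));
      [apply (is_derive_const y0 u)|].
    apply (is_derive_RInt (fun v => f v (y v)) (RInt (fun v => f v (y v)) u0) u0 u);
      [|apply (comp y hy)].
    apply filter_forall; intros w; apply (RInt_correct (fun v => f v (y v)) u0 w).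
    apply ex_RInt_continuous; intros; apply (comp y hy). }
  assert (Ync : forall n u, continuous (Yn n) u).
  { induction n as [|n IH]; intros u.
    - apply continuous_const.
    - apply (ex_derive_continuous (Yn (S n))); eexists; apply (stepD (Yn n) IH). }
  (* Contraction for the norm sup |y| / W: the weight makes the Picard operator
     contract by 1/2 on the whole line. *)
  assert (contr : forall y z C, (forall u, continuous y u) -> (forall u, continuous z u) ->
            (forall u, Rabs (y u - z u) <= C * W u) ->
            forall u, Rabs (step y u - step z u) <= C / 2 * W u).
  { intros y z C hy hz hyz u; unfold step.
    replace (y0 + _ - _) with (RInt (fun v => f v (y v) - f v (z v)) u0 u).
    2:{ rewrite (RInt_minus (fun v => f v (y v)) (fun v => f v (z v)));
        [unfold minus, plus, opp; simpl; ring| |];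
        apply ex_RInt_continuous; intros; apply comp; assumption. }
    replace (C / 2) with (L * C / (2 * L)) by (field; lra).
    apply RInt_exp_bound; [lra| |].
    - intros v; apply (continuous_minus (fun v => f v (y v)) (fun v => f v (z v)));
        apply comp; assumption.
    - intros v; eapply Rle_trans; [apply hlip|].
      specialize (hyz v); fold (W v); nra. }
  pose (C0 := B / (2 * L)).
  assert (C00 : 0 <= C0) by (apply Rdiv_le_0_compat; lra).
  assert (succ : forall n u, Rabs (Yn (S n) u - Yn n u) <= C0 * (/ 2) ^ n * W u).
  { induction n as [|n IH]; intros u.
    - simpl; unfold step.
      replace (y0 + _ - y0) with (RInt (fun v => f v y0) u0 u : R) by (symmetry; apply Rplus_minus_l).
      rewrite Rmult_1_r; apply RInt_exp_bound; [lra| |].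
      + intros v; apply (comp (fun _ => y0)); intros; apply continuous_const.
      + intros v; eapply Rle_trans; [apply hB|]; fold (W v); specialize (W1 v); nra.
    - eapply Rle_trans; [apply (contr (Yn (S n)) (Yn n) (C0 * (/ 2) ^ n)); auto|].
      right; simpl; field. }
  assert (far : forall n k u, Rabs (Yn (n + k)%nat u - Yn n u)
                 <= 2 * C0 * ((/ 2) ^ n - (/ 2) ^ (n + k)) * W u).
  { intros n k u; induction k as [|k IH].
    - rewrite Nat.add_0_r, !Rminus_diag, Rabs_R0; lra.
    - rewrite Nat.add_succ_r.
      replace (Yn (S (n + k)) u - Yn n u)
        with ((Yn (S (n + k)) u - Yn (n + k)%nat u) + (Yn (n + k)%nat u - Yn n u)) by ring.
      eapply Rle_trans; [apply Rabs_triang|].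
      specialize (succ (n + k)%nat u); simpl pow in *; nra. }
  assert (small : forall A, 0 <= A -> forall e, 0 < e -> exists n, forall m, (n <= m)%nat -> A * (/ 2) ^ m < e).
  { intros A hA e he.
    destruct (pow_lt_1_zero (/ 2) ltac:(rewrite Rabs_pos_eq; lra) (e / (A + 1))) as [n hn].
    { apply Rdiv_lt_0_compat; lra. }
    exists n; intros m hm; specialize (hn m hm).
    rewrite Rabs_pos_eq in hn by (apply pow_le; lra).
    apply (Rmult_lt_compat_l (A + 1)) in hn; [|lra].
    replace ((A + 1) * (e / (A + 1))) with e in hn by (field; lra).
    assert (0 <= (/ 2) ^ m) by (apply pow_le; lra); nra. }
  assert (far' : forall n m u, (n <= m)%nat -> Rabs (Yn m u - Yn n u) <= 2 * C0 * (/ 2) ^ n * W u).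
  { intros n m u hnm; replace m with (n + (m - n))%nat by lia.
    eapply Rle_trans; [apply far|].
    assert (0 <= (/ 2) ^ (n + (m - n))) by (apply pow_le; lra).
    specialize (W1 u); assert (0 <= 2 * C0 * (/ 2) ^ (n + (m - n)) * W u); [|nra].
    apply Rmult_le_pos; nra. }
  assert (lim : forall u, { l | Un_cv (fun n => Yn n u) l }).
  { intros u; apply Rcomplete.R_complete; intros e he.
    destruct (small (2 * (2 * C0 * W u))) with (e := e) as [n hn]; [specialize (W1 u); nra|lra|].
    exists n; intros p q hp hq; unfold Rdist.
    assert (hp' := far' n p u hp); assert (hq' := far' n q u hq).
    specialize (hn n (le_n n)).
    replace (Yn p u - Yn q u) with ((Yn p u - Yn n u) - (Yn q u - Yn n u)) by ring.
    eapply Rle_lt_trans; [apply Rabs_triang|]; rewrite Rabs_Ropp; lra. }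
  pose (Y := fun u => proj1_sig (lim u)).
  assert (YY : forall n u, Rabs (Y u - Yn n u) <= 2 * C0 * (/ 2) ^ n * W u).
  { intros n u; apply le_epsilon; intros e he.
    destruct (proj2_sig (lim u) e he) as [N hN]; fold (Y u) in hN.
    specialize (hN (max n N) ltac:(lia)); unfold Rdist in hN.
    assert (h := far' n (max n N) u ltac:(lia)).
    replace (Y u - Yn n u) with (- (Yn (max n N) u - Y u) + (Yn (max n N) u - Yn n u)) by ring.
    eapply Rle_trans; [apply Rabs_triang|]; rewrite Rabs_Ropp; lra. }
  assert (Yc : forall u, continuous Y u).
  { intros u; apply continuity_pt_filterlim.
    assert (h : CVU Yn Y u (mkposreal 1 Rlt_0_1)).
    { intros e he.
      pose (A := exp (2 * L * (Rabs (u - u0) + 1))).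
      assert (0 < A) by apply exp_pos.
      destruct (small (2 * C0 * A)) with (e := e) as [n hn]; [nra|lra|].
      exists n; intros m v hm hv.
      eapply Rle_lt_trans; [apply YY|].
      eapply Rle_lt_trans; [|apply (hn m hm)].
      assert (0 <= (/ 2) ^ m) by (apply pow_le; lra).
      assert (W v <= A).
      { unfold W, A; unfold Boule in hv; simpl in hv.
        assert (Rabs (v - u0) <= Rabs (u - u0) + 1).
        { replace (v - u0) with ((u - u0) + (v - u)) by ring.
          eapply Rle_trans; [apply Rabs_triang|]; lra. }
        destruct (Req_dec (2 * L * Rabs (v - u0)) (2 * L * (Rabs (u - u0) + 1))) as [->|]; [lra|].
        apply Rlt_le, exp_increasing; nra. }
      specialize (W1 v); assert (0 <= 2 * C0 * (/ 2) ^ m) by nra; nra. }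
    apply (CVU_continuity Yn Y u _ h).
    - intros n v _; apply continuity_pt_filterlim, Ync.
    - unfold Boule; simpl; rewrite Rminus_diag, Rabs_R0; lra. }
  assert (Yfix : forall u, Y u = step Y u).
  { intros u; apply Rminus_diag_uniq, Rabs_eq_0.
    apply Rle_antisym; [|apply Rabs_pos].
    apply le_epsilon; intros e he.
    destruct (small (2 * C0 * W u)) with (e := e) as [n hn]; [specialize (W1 u); nra|lra|].
    assert (h1 := YY (S n) u).
    assert (h2 := contr (Yn n) Y (2 * C0 * (/ 2) ^ n) (Ync n) Yc).
    assert (h3 : forall u, Rabs (Yn n u - Y u) <= 2 * C0 * (/ 2) ^ n * W u)
      by (intros v; rewrite Rabs_minus_sym; apply YY).
    specialize (h2 h3 u); specialize (hn n (le_n n)).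
    replace (Y u - step Y u) with ((Y u - Yn (S n) u) + (step (Yn n) u - step Y u))
      by (simpl; ring).
    eapply Rle_trans; [apply Rabs_triang|]; simpl pow in *; lra. }
  exists Y; split.
  - rewrite Yfix; unfold step; rewrite RInt_point; unfold zero; simpl; ring.
  - intros u; apply (is_derive_ext (step Y)); [intros; symmetry; apply Yfix|].
    apply stepD, Yc.
Qed.

(** * The profile equation *)

Definition cot (r : R) : R := cos r / sin r.

(** The function of the Weingarten relation is g on one half-line and g^-1 on the
    other; unlike bounds on derivatives, bounds on differences simply add up
    across the junction. *)
Definition decreasing_between (c L : R) (H : R -> R) : Prop :=
  forall p q, p <= q -> c * (q - p) <= H p - H q <= L * (q - p).

(** The equation dy/dx = H (y cot x) satisfied by y = t' as a function of x. *)
Definition profile_equation (H F : R -> R) : Prop :=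
  forall r, 0 < r < PI -> is_derive F r (H (F r * cot r)).

(** The reversed relation: it replaces H when the normal is reversed, when F is
    replaced by its opposite, and when the strip 0 < x < pi is reflected. *)
Definition opp_conj (H : R -> R) : R -> R := fun k => - H (- k).

Lemma opp_conj_decreasing (c L : R) (H : R -> R) :
  decreasing_between c L H -> decreasing_between c L (opp_conj H).
Proof. intros h p q hpq; specialize (h (- q) (- p)); unfold opp_conj; lra. Qed.

Lemma decreasing_lipschitz (c L : R) (H : R -> R) :
  0 < c -> decreasing_between c L H ->
  0 < L /\ forall p q, Rabs (H p - H q) <= L * Rabs (p - q).
Proof.
  intros hc h; split; [specialize (h 0 1 ltac:(lra)); lra|].
  intros p q; destruct (Rle_dec p q) as [hpq|hpq].
  - specialize (h p q hpq); rewrite (Rabs_left1 (p - q)) by lra.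
    rewrite Rabs_pos_eq; nra.
  - specialize (h q p ltac:(lra)); rewrite (Rabs_pos_eq (p - q)) by lra.
    rewrite Rabs_left1; nra.
Qed.

Lemma decreasing_continuous (c L : R) (H : R -> R) :
  0 < c -> decreasing_between c L H -> forall k, continuous H k.
Proof.
  intros hc h k; destruct (decreasing_lipschitz c L H hc h) as [hL hl].
  apply (proj2 (filterlim_locally H (H k))); intros e.
  assert (he : 0 < e / L) by (apply Rdiv_lt_0_compat; [apply cond_pos|lra]).
  exists (mkposreal _ he); intros q hq.
  change (Rabs (q - k) < e / L) in hq; change (Rabs (H q - H k) < e).
  eapply Rle_lt_trans; [apply hl|].
  apply (Rmult_lt_compat_l L) in hq; [|lra].
  replace (L * (e / L)) with (pos e) in hq by (field; lra); exact hq.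
Qed.

Lemma profile_equation_opp (H F : R -> R) :
  profile_equation H F -> profile_equation (opp_conj H) (fun r => - F r).
Proof.
  intros h r hr; unfold opp_conj.
  replace (- (- F r * cot r)) with (F r * cot r) by ring.
  apply (is_derive_opp F), h, hr.
Qed.

Lemma profile_equation_mirror (H F : R -> R) :
  profile_equation H F -> profile_equation (opp_conj H) (fun r => F (PI - r)).
Proof.
  intros h r hr; unfold opp_conj.
  replace (- (F (PI - r) * cot r)) with (F (PI - r) * cot (PI - r)).
  2:{ unfold cot; rewrite sin_PI_x.
      replace (cos (PI - r)) with (- cos r); [field; apply Rgt_not_eq, sin_gt_0; lra|].
      rewrite Rtrigo_facts.cos_pi_minus; reflexivity. }
  assert (hd := h (PI - r) ltac:(lra)).
  set (l := H _) in *; clearbody l.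
  auto_derive; [eexists; exact hd|].
  replace (Derive (fun x => F x) (PI + - r)) with l
    by (symmetry; apply is_derive_unique, hd); ring.
Qed.

(** In the variable u = ln ((1 - cos r) / sin r) one has sinh u = - cot r,
    cosh u = 1 / sin r and du/dr = 1 / sin r, so the equation becomes
    dy/du = H (- y sinh u) / cosh u on the whole line.  As |sinh| <= cosh, its
    right-hand side is globally Lipschitz in y with the constant of H. *)
Lemma profile_equation_exists (c L : R) (H : R -> R) (r0 y0 : R) :
  0 < c -> decreasing_between c L H -> 0 < r0 < PI ->
  exists F, F r0 = y0 /\ profile_equation H F.
Proof.
  intros hc hH hr0.
  destruct (decreasing_lipschitz c L H hc hH) as [hL hl].
  pose (U := fun r => ln ((1 - cos r) / sin r)).
  assert (trig : forall r, 0 < r < PI -> 0 < sin r /\ -1 < cos r < 1 /\ sin r ^ 2 + cos r ^ 2 = 1).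
  { intros r hr; assert (s := sin_gt_0 r ltac:(lra) ltac:(lra)).
    assert (e := sin2_cos2 r); unfold Rsqr in e; repeat split; [exact s|nra|nra|lra]. }
  assert (expU : forall r, 0 < r < PI ->
            exp (U r) = (1 - cos r) / sin r /\ exp (- U r) = (1 + cos r) / sin r).
  { intros r hr; destruct (trig r hr) as (s & cb & e).
    assert (0 < (1 - cos r) / sin r) by (apply Rdiv_lt_0_compat; lra).
    unfold U; rewrite exp_Ropp, exp_ln by assumption; split; [reflexivity|].
    apply Rmult_eq_reg_l with ((1 - cos r) / sin r); [|lra].
    rewrite Rinv_r by lra.
    replace ((1 - cos r) / sin r * ((1 + cos r) / sin r))
      with ((1 - cos r ^ 2) / sin r ^ 2) by (field; lra).
    replace (1 - cos r ^ 2) with (sin r ^ 2) by lra.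
    field; lra. }
  assert (sinhU : forall r, 0 < r < PI -> sinh (U r) = - cot r).
  { intros r hr; destruct (trig r hr) as (s & cb & e).
    unfold sinh, cot; destruct (expU r hr) as [-> ->]; field; lra. }
  assert (coshU : forall r, 0 < r < PI -> cosh (U r) = / sin r).
  { intros r hr; destruct (trig r hr) as (s & cb & e).
    unfold cosh; destruct (expU r hr) as [-> ->]; field; lra. }
  assert (dU : forall r, 0 < r < PI -> is_derive U r (/ sin r)).
  { intros r hr; destruct (trig r hr) as (s & cb & e); unfold U.
    auto_derive; [split; [lra|split; [apply Rdiv_lt_0_compat; lra|exact I]]|].
    replace (/ sin r) with (1 / sin r * 1) by (field; lra).
    replace 1 with (sin r ^ 2 + cos r ^ 2) at 4 by exact e.
    field_simplify_eq; [|split; lra]. nra. }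
  assert (cosh1 : forall u, 0 < cosh u /\ Rabs (sinh u) <= cosh u).
  { intros u; assert (p1 := exp_pos u); assert (p2 := exp_pos (- u)).
    unfold sinh, cosh; split; [lra|apply Rabs_le_between; lra]. }
  destruct (picard (fun u y => H (y * - sinh u) / cosh u) L (Rabs (H 0) + L * Rabs y0) (U r0) y0)
    as (Y & hY0 & hY).
  - exact hL.
  - intros u y; unfold Rdiv.
    assert (ch : continuity_pt cosh u /\ continuity_pt sinh u).
    { split; apply continuity_pt_filterlim.
      - apply (ex_derive_continuous cosh); eexists; apply is_derive_Reals, derivable_pt_lim_cosh.
      - apply (ex_derive_continuous sinh); eexists; apply is_derive_Reals, derivable_pt_lim_sinh. }
    apply continuity_2d_pt_mult.
    + apply (continuity_1d_2d_pt_comp H (fun u y => y * - sinh u)).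
      * apply continuity_pt_filterlim, (decreasing_continuous c L H hc hH).
      * apply continuity_2d_pt_mult; [apply continuity_2d_pt_id2|].
        apply continuity_2d_pt_opp, (continuity_1d_2d_pt_comp sinh (fun u _ => u));
          [apply ch|apply continuity_2d_pt_id1].
    + apply continuity_2d_pt_inv; [|destruct (cosh1 u); lra].
      apply (continuity_1d_2d_pt_comp cosh (fun u _ => u));
          [apply ch|apply continuity_2d_pt_id1].
  - intros u y z; destruct (cosh1 u) as [h1 h2].
    replace (_ / _ - _ / _) with ((H (y * - sinh u) - H (z * - sinh u)) / cosh u) by (field; lra).
    rewrite Rabs_div, (Rabs_pos_eq (cosh u)) by lra.
    apply Rle_div_l; [lra|].
    eapply Rle_trans; [apply hl|].
    replace (y * - sinh u - z * - sinh u) with ((y - z) * - sinh u) by ring.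
    rewrite Rabs_mult, Rabs_Ropp, Rmult_assoc.
    apply Rmult_le_compat_l; [lra|]. apply Rmult_le_compat_l; [apply Rabs_pos|lra].
  - intros u; destruct (cosh1 u) as [h1 h2].
    rewrite Rabs_div, (Rabs_pos_eq (cosh u)) by lra.
    apply Rle_div_l; [lra|].
    replace (H (y0 * - sinh u)) with (H 0 + (H (y0 * - sinh u) - H 0)) by ring.
    eapply Rle_trans; [apply Rabs_triang|].
    assert (hl1 := hl (y0 * - sinh u) 0).
    rewrite Rminus_0_r, Rabs_mult, Rabs_Ropp in hl1.
    assert (1 <= cosh u).
    { assert (p1 := exp_ineq1_le u); assert (p2 := exp_ineq1_le (- u)).
      unfold cosh; lra. }
    assert (p3 := Rabs_pos (H 0)); assert (p4 := Rabs_pos y0).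
    assert (Rabs y0 * Rabs (sinh u) <= Rabs y0 * cosh u) by (apply Rmult_le_compat_l; lra).
    nra.
  - exists (fun r => Y (U r)); split; [exact hY0|].
    intros r hr; destruct (trig r hr) as (s & cb & e).
    assert (hd := is_derive_comp Y U r _ _ (hY (U r)) (dU r hr)).
    cbv beta in hd.
    rewrite sinhU, coshU in hd by assumption.
    rewrite Ropp_involutive in hd.
    replace (H _) with (scal (/ sin r) (H (Y (U r) * cot r) / / sin r)); [exact hd|].
    unfold scal; simpl; unfold mult; simpl; field; lra.
Qed.

(** * Behaviour at the rotation axes *)

(** Going towards r = 0, P - A r increases, so P stays above eta = P r1 - A r1 > 0;
    then P' <= A - c eta cot r, and integrating the cotangent gives
    P >= c eta (ln (sin r1) - ln (sin r)), which is unbounded. *)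
Lemma blow_up (c A r1 : R) (P dP : R -> R) :
  0 < c -> 0 <= A -> 0 < r1 < PI / 2 ->
  (forall r, 0 < r <= r1 -> is_derive P r (dP r)) ->
  (forall r, 0 < r <= r1 -> 0 < P r -> dP r <= A - c * cot r * P r) ->
  A * r1 < P r1 ->
  forall M, exists d, 0 < d /\ forall r, 0 < r < d -> M < P r.
Proof.
  intros hc hA hr1 hd hi h1 M.
  assert (trig : forall r, 0 < r <= r1 -> 0 < sin r /\ 0 < cos r).
  { intros r hr; split; [apply sin_gt_0|apply cos_gt_0]; lra. }
  assert (cotp : forall r, 0 < r <= r1 -> 0 < cot r).
  { intros r hr; destruct (trig r hr); apply Rdiv_lt_0_compat; assumption. }
  assert (cont : forall r, 0 < r <= r1 -> continuous P r).
  { intros r hr; apply (ex_derive_continuous P); eexists; apply hd, hr. }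
  assert (low : forall z, 0 < z <= r1 -> (forall r, z < r <= r1 -> 0 < P r) ->
            P r1 - A * r1 <= P z - A * z).
  { intros z hz hp.
    enough (A * z - P z <= A * r1 - P r1) by lra.
    apply (derive_nonneg_incr (fun r => A * r - P r) (fun r => A - dP r)); [lra| |].
    - intros r hr; assert (hdr := hd r ltac:(lra)).
      auto_derive; [eexists; exact hdr|].
      replace (Derive (fun x => P x) r) with (dP r)
        by (symmetry; apply is_derive_unique, hdr); ring.
    - intros r hr; assert (p := hp r ltac:(lra)).
      assert (q := cotp r ltac:(lra)); assert (w := hi r ltac:(lra) p).
      assert (0 < c * cot r * P r) by (apply Rmult_lt_0_compat; [apply Rmult_lt_0_compat|]; assumption); lra. }
  assert (Ppos : forall r, 0 < r <= r1 -> 0 < P r).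
  { intros r hr; apply Rnot_le_lt; intros hn.
    destruct (last_zero P r r1) as (z & hz & Pz & hp);
      [lra|intros; apply cont; lra|exact hn|nra|].
    assert (w := low z ltac:(lra) hp); rewrite Pz in w; nra. }
  pose (eta := P r1 - A * r1).
  assert (he : 0 < c * eta) by (unfold eta; apply Rmult_lt_0_compat; lra).
  assert (Peta : forall r, 0 < r <= r1 -> eta + A * r <= P r).
  { intros r hr; assert (w := low r hr); unfold eta.
    specialize (w (fun q hq => Ppos q ltac:(lra))); lra. }
  assert (log : forall r, 0 < r <= r1 -> c * eta * (ln (sin r1) - ln (sin r)) <= P r).
  { intros z hz.
    assert (w : A * z - P z - c * eta * ln (sin z) <= A * r1 - P r1 - c * eta * ln (sin r1)).
    { apply (derive_nonneg_incr (fun r => A * r - P r - c * eta * ln (sin r))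
                                (fun r => A - dP r - c * eta * cot r)); [lra| |].
      - intros r hr; assert (hdr := hd r ltac:(lra)).
        destruct (trig r ltac:(lra)).
        auto_derive; [split; [eexists; exact hdr|split; [assumption|exact I]]|].
        replace (Derive (fun x => P x) r) with (dP r)
          by (symmetry; apply is_derive_unique, hdr); unfold cot; field; lra.
      - intros r hr; assert (p := Ppos r ltac:(lra)).
        assert (q := cotp r ltac:(lra)); assert (w := hi r ltac:(lra) p).
        assert (v := Peta r ltac:(lra)).
        assert (0 <= c * cot r * (P r - eta)); [|lra].
        apply Rmult_le_pos; [|nra]; apply Rmult_le_pos; lra. }
    assert (v := Peta z hz); fold eta in w.
    assert (A * z - A * r1 <= 0) by nra. unfold eta in *; nra. }
  exists (Rmin r1 (exp (ln (sin r1) - M / (c * eta)))); split.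
  { apply Rmin_pos; [lra|apply exp_pos]. }
  intros r [r0 hr].
  assert (r < r1) by (eapply Rlt_le_trans; [exact hr|apply Rmin_l]).
  assert (hr' : r < exp (ln (sin r1) - M / (c * eta)))
    by (eapply Rlt_le_trans; [exact hr|apply Rmin_r]).
  eapply Rlt_le_trans; [|apply log; lra].
  destruct (trig r ltac:(lra)) as [sr _].
  assert (hln : ln (sin r) < ln (sin r1) - M / (c * eta)).
  { rewrite <- (ln_exp (ln (sin r1) - M / (c * eta))).
    apply ln_increasing; [exact sr|].
    assert (w := sin_lt_x r r0); lra. }
  replace M with (c * eta * (M / (c * eta))) at 1 by (field; split; nra).
  apply Rmult_lt_compat_l; lra.
Qed.

Lemma near_axis_trig (r : R) : 0 < r <= PI / 4 ->
  0 < sin r < r /\ / 2 <= cos r <= 1 /\ 0 < tan r <= 1 /\ tan r <= 2 * r.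
Proof.
  intros hr; assert (pi := PI_RGT_0).
  assert (s := sin_gt_0 r ltac:(lra) ltac:(lra)); assert (s' := sin_lt_x r ltac:(lra)).
  assert (hc : / 2 <= cos r).
  { replace (/ 2) with (cos (PI / 3)) by (rewrite cos_PI3; lra).
    apply cos_decr_1; lra. }
  assert (hc1 := COS_bound r).
  assert (ht : tan r <= 1).
  { rewrite <- tan_PI4; destruct (proj2 hr) as [h| ->]; [|lra].
    apply Rlt_le, tan_increasing; lra. }
  assert (ht0 : tan r * cos r = sin r) by (unfold tan; field; lra).
  repeat split; try lra; nra.
Qed.

(** The difference P = F - u tan r satisfies the inequality of [blow_up] with
    A = |u| tan^2 r1 on (0, r1], because F cot r - u = P cot r and H lies below
    its value u at u by at least c times that amount.  For the same reason
    u tan r is the right comparison function: u is the common value of both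
    curvatures at a point of the axis. *)
Lemma axis_upper (c L : R) (H F : R -> R) (u : R) :
  0 < c -> decreasing_between c L H -> H u = u -> profile_equation H F ->
  (forall r, 0 < r <= PI / 4 -> F r - u * tan r <= Rabs u * tan r ^ 2 * r) \/
  (exists d, 0 < d /\ forall r, 0 < r < d -> 1 < F r).
Proof.
  intros hc hH hu hF; assert (pi := PI_RGT_0).
  destruct (Classical_Prop.classic
    (forall r, 0 < r <= PI / 4 -> F r - u * tan r <= Rabs u * tan r ^ 2 * r)) as [h|h];
    [left; exact h|right].
  apply Classical_Pred_Type.not_all_ex_not in h as [r1 h].
  apply Classical_Prop.imply_to_and in h as [hr1 h]; apply Rnot_le_lt in h.
  assert (u0 := Rabs_pos u).
  destruct (blow_up c (Rabs u * tan r1 ^ 2) r1 (fun r => F r - u * tan r)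
     (fun r => H (F r * cot r) - u * (1 + tan r ^ 2))) with (M := 1 + Rabs u)
     as (d & hd & hd').
  - exact hc.
  - pose proof (pow2_ge_0 (tan r1)); nra.
  - lra.
  - intros r hr; assert (hdr := hF r ltac:(lra)).
    destruct (near_axis_trig r ltac:(lra)) as (s & co & t & _).
    unfold tan; auto_derive; [split; [eexists; exact hdr|split; [lra|exact I]]|].
    replace (Derive (fun x => F x) r) with (H (F r * cot r))
      by (symmetry; apply is_derive_unique, hdr); field; lra.
  - intros r hr hp.
    destruct (near_axis_trig r ltac:(lra)) as (s & co & t & _).
    assert (ct : cot r * tan r = 1) by (unfold cot, tan; field; lra).
    assert (0 < cot r) by (apply Rdiv_lt_0_compat; lra).
    assert (e : F r * cot r - u = cot r * (F r - u * tan r)).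
    { replace u with (u * (cot r * tan r)) at 1 by (rewrite ct; ring); ring. }
    assert (0 < cot r * (F r - u * tan r)) by (apply Rmult_lt_0_compat; lra).
    assert (w := hH u (F r * cot r) ltac:(lra)).
    rewrite hu, e in w.
    assert (mono : tan r <= tan r1).
    { destruct (proj2 hr) as [h'| ->]; [|lra].
      apply Rlt_le, tan_increasing; lra. }
    assert (u * (- tan r ^ 2) <= Rabs u * tan r1 ^ 2).
    { assert (tan r ^ 2 <= tan r1 ^ 2) by nra.
      assert (- u <= Rabs u) by (pose proof (Rle_abs (- u)); rewrite Rabs_Ropp in *; lra).
      pose proof (pow2_ge_0 (tan r)); nra. }
    nra.
  - exact h.
  - exists (Rmin d (PI / 4)); split; [apply Rmin_pos; lra|].
    intros r [hr hr'].
    assert (r < d) by (eapply Rlt_le_trans; [exact hr'|apply Rmin_l]).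
    assert (r < PI / 4) by (eapply Rlt_le_trans; [exact hr'|apply Rmin_r]).
    destruct (near_axis_trig r ltac:(lra)) as (s & co & t & _).
    specialize (hd' r ltac:(lra)).
    assert (- u <= Rabs u) by (pose proof (Rle_abs (- u)); rewrite Rabs_Ropp in *; lra).
    nra.
Qed.

Lemma axis_alternative (c L : R) (H F : R -> R) (u : R) :
  0 < c -> decreasing_between c L H -> H u = u -> profile_equation H F ->
  (forall r, 0 < r <= PI / 4 -> Rabs (F r - u * tan r) <= Rabs u * tan r ^ 2 * r) \/
  (exists d, 0 < d /\ forall r, 0 < r < d -> 1 < Rabs (F r)).
Proof.
  intros hc hH hu hF.
  destruct (axis_upper c L H F u hc hH hu hF) as [h1|(d & hd & h1)].
  2:{ right; exists d; split; [exact hd|]; intros r hr.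
      specialize (h1 r hr); pose proof (Rle_abs (F r)); lra. }
  destruct (axis_upper c L (opp_conj H) (fun r => - F r) (- u)) as [h2|(d & hd & h2)].
  - exact hc.
  - apply opp_conj_decreasing, hH.
  - unfold opp_conj; rewrite Ropp_involutive, hu; reflexivity.
  - apply profile_equation_opp, hF.
  - left; intros r hr; specialize (h1 r hr); specialize (h2 r hr).
    rewrite Rabs_Ropp in h2; apply Rabs_le_between; lra.
  - right; exists d; split; [exact hd|]; intros r hr.
    specialize (h2 r hr); pose proof (Rle_abs (- F r)); rewrite Rabs_Ropp in *; lra.
Qed.

Lemma cot_mirror (r : R) : cot (PI - r) = - cot r.
Proof.
  unfold cot; rewrite sin_PI_x, Rtrigo_facts.cos_pi_minus; unfold Rdiv; ring.
Qed.

(** An error of order r^3 in F is one of order r^2 in F cot r. *)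
Lemma axis_curvature (F : R -> R) (u : R) :
  (forall r, 0 < r <= PI / 4 -> Rabs (F r - u * tan r) <= Rabs u * tan r ^ 2 * r) ->
  forall r, 0 < r <= PI / 4 ->
    Rabs (F r) <= 6 * Rabs u * r /\ Rabs (F r * cot r - u) <= Rabs u * r.
Proof.
  intros h r hr; specialize (h r hr).
  destruct (near_axis_trig r hr) as (s & co & t & t2).
  assert (r1 : r <= 1) by (pose proof PI_4; lra).
  assert (u0 := Rabs_pos u).
  assert (ct : cot r * tan r = 1) by (unfold cot, tan; field; lra).
  assert (c0 : 0 < cot r) by (apply Rdiv_lt_0_compat; lra).
  split.
  - replace (F r) with ((F r - u * tan r) + u * tan r) by ring.
    eapply Rle_trans; [apply Rabs_triang|].
    rewrite (Rabs_mult u), (Rabs_pos_eq (tan r)) by lra.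
    assert (tan r * r <= 1) by nra.
    assert (tan r ^ 2 * r <= tan r) by nra.
    assert (Rabs u * (tan r ^ 2 * r) <= Rabs u * (2 * r)) by (apply Rmult_le_compat_l; lra).
    assert (Rabs u * tan r <= Rabs u * (2 * r)) by (apply Rmult_le_compat_l; lra).
    nra.
  - replace (F r * cot r - u) with (cot r * (F r - u * tan r)).
    2:{ replace u with (u * (cot r * tan r)) at 2 by (rewrite ct; ring); ring. }
    rewrite Rabs_mult, (Rabs_pos_eq (cot r)) by lra.
    eapply Rle_trans; [apply Rmult_le_compat_l; [lra|exact h]|].
    replace (cot r * (Rabs u * tan r ^ 2 * r)) with (Rabs u * r * tan r * (cot r * tan r)) by ring.
    rewrite ct; assert (0 <= Rabs u * r) by nra; nra.
Qed.

Lemma profile_curvature_continuous (H F : R -> R) (p : R) :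
  profile_equation H F -> 0 < p < PI ->
  continuous F p /\ continuous (fun r => F r * cot r) p.
Proof.
  intros hF hp.
  assert (c : continuous F p) by (apply (ex_derive_continuous F); eexists; apply hF, hp).
  split; [exact c|].
  apply (continuous_mult F cot); [exact c|].
  apply (ex_derive_continuous cot); unfold cot; auto_derive.
  apply Rgt_not_eq, sin_gt_0; lra.
Qed.

(** If |F| > 1 near an axis there is nothing to bound there; otherwise
    [axis_curvature] applies.  The rest of (0, pi) is compact. *)
Lemma curvature_bounded (c L : R) (H F : R -> R) (u : R) :
  0 < c -> decreasing_between c L H -> H u = u -> profile_equation H F ->
  exists C, forall r, 0 < r < PI -> Rabs (F r) <= 1 -> Rabs (F r * cot r) <= C.
Proof.
  intros hc hH hu hF; assert (pi := PI_RGT_0).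
  assert (one : forall H F u, decreasing_between c L H -> H u = u -> profile_equation H F ->
     exists d C, 0 < d < PI / 2 /\ forall r, 0 < r < d -> Rabs (F r) <= 1 -> Rabs (F r * cot r) <= C).
  { clear H F u hH hu hF; intros H F u hH hu hF.
    destruct (axis_alternative c L H F u hc hH hu hF) as [h|(d & hd & h)].
    - exists (PI / 4), (2 * Rabs u); split; [lra|]; intros r hr _.
      destruct (axis_curvature F u h r ltac:(lra)) as [_ hk].
      assert (r <= 1) by (pose proof PI_4; lra).
      replace (F r * cot r) with ((F r * cot r - u) + u) by ring.
      eapply Rle_trans; [apply Rabs_triang|]; pose proof (Rabs_pos u); nra.
    - exists (Rmin d (PI / 4)), 0; split.
      + split; [apply Rmin_pos; lra|eapply Rle_lt_trans; [apply Rmin_r|lra]].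
      + intros r [hr hr'] hF1.
        assert (r < d) by (eapply Rlt_le_trans; [exact hr'|apply Rmin_l]).
        specialize (h r ltac:(lra)); lra. }
  destruct (one H F u hH hu hF) as (d1 & C1 & hd1 & h1).
  destruct (one (opp_conj H) (fun r => F (PI - r)) (- u)) as (d2 & C2 & hd2 & h2).
  - apply opp_conj_decreasing, hH.
  - unfold opp_conj; rewrite Ropp_involutive, hu; reflexivity.
  - apply profile_equation_mirror, hF.
  - destruct (bounded_continuity (fun r => F r * cot r) d1 (PI - d2)) as [M hM].
    { intros r hr; apply (profile_curvature_continuous H F r hF); lra. }
    exists (Rmax M (Rmax C1 C2)); intros r hr hF1.
    destruct (Rlt_dec r d1) as [l1|l1].
    { eapply Rle_trans; [apply h1; [lra|exact hF1]|].
      eapply Rle_trans; [apply Rmax_l|apply Rmax_r]. }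
    destruct (Rlt_dec (PI - d2) r) as [l2|l2].
    { specialize (h2 (PI - r)); cbv beta in h2.
      replace (PI - (PI - r)) with r in h2 by ring.
      rewrite cot_mirror in h2.
      replace (F r * - cot r) with (- (F r * cot r)) in h2 by ring.
      rewrite Rabs_Ropp in h2.
      eapply Rle_trans; [apply h2; [lra|exact hF1]|].
      eapply Rle_trans; [apply Rmax_r|apply Rmax_r]. }
    eapply Rle_trans; [|apply Rmax_l].
    apply Rlt_le; exact (hM r ltac:(lra)).
Qed.

Definition on_strip (r : R) : Prop := 0 < r < PI.

(** A solution F that is at most 1 in absolute value at points accumulating at
    the axis cannot blow up there, so it has the limit 0 and F cot has the
    umbilical limit. *)
Lemma profile_limits (c L : R) (H F : R -> R) (u p : R) :
  0 < c -> decreasing_between c L H -> H u = u -> profile_equation H F ->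
  0 <= p <= PI ->
  (forall d, 0 < d -> exists r, on_strip r /\ Rabs (r - p) < d /\ Rabs (F r) <= 1) ->
  exists lF lk,
    filterlim F (within on_strip (locally p)) (locally lF) /\
    filterlim (fun r => F r * cot r) (within on_strip (locally p)) (locally lk) /\
    (sin p = 0 -> lF = 0).
Proof.
  intros hc hH hu hF hp hacc; assert (pi := PI_RGT_0).
  assert (zero : forall H F u, decreasing_between c L H -> H u = u -> profile_equation H F ->
     (forall d, 0 < d -> exists r, on_strip r /\ r < d /\ Rabs (F r) <= 1) ->
     forall e : posreal, exists d : posreal, forall r, 0 < r < d ->
       Rabs (F r) < e /\ Rabs (F r * cot r - u) < e).
  { clear H F u hH hu hF hacc; intros H F u hH hu hF hacc e.
    destruct (axis_alternative c L H F u hc hH hu hF) as [h|(d & hd & h)].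
    2:{ exfalso; destruct (hacc d hd) as (r & [hr _] & hrd & hr1).
        specialize (h r (conj hr hrd)); lra. }
    assert (u0 := Rabs_pos u).
    assert (hd : 0 < Rmin (PI / 4) (e / (6 * (Rabs u + 1)))).
    { apply Rmin_pos; [lra|apply Rdiv_lt_0_compat; [apply cond_pos|lra]]. }
    exists (mkposreal _ hd); intros r [r0 hr]; simpl in hr.
    assert (r < PI / 4) by (eapply Rlt_le_trans; [exact hr|apply Rmin_l]).
    assert (hr2 : r < e / (6 * (Rabs u + 1))) by (eapply Rlt_le_trans; [exact hr|apply Rmin_r]).
    apply Rlt_div_r in hr2; [|lra].
    destruct (axis_curvature F u h r ltac:(lra)) as [hk1 hk2].
    split; nra. }
  destruct (Req_dec p 0) as [->|p0]; [|destruct (Req_dec p PI) as [->|ppi]].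
  - assert (z := zero H F u hH hu hF).
    assert (hacc' : forall d, 0 < d -> exists r, on_strip r /\ r < d /\ Rabs (F r) <= 1).
    { intros d hd; destruct (hacc d hd) as (r & hr & hrd & hr1); exists r.
      rewrite Rminus_0_r in hrd; pose proof (Rle_abs r); repeat split; try apply hr; lra. }
    specialize (z hacc').
    exists 0, u; split; [|split; [|reflexivity]].
    + apply filterlim_locally; intros e; destruct (z e) as [d hd]; exists d.
      intros r hr [hr1 hr2]; change (Rabs (r - 0) < d) in hr; change (Rabs (F r - 0) < e).
      rewrite Rminus_0_r in *; rewrite Rabs_pos_eq in hr by lra; apply hd; lra.
    + apply filterlim_locally; intros e; destruct (z e) as [d hd]; exists d.
      intros r hr [hr1 hr2]; change (Rabs (r - 0) < d) in hr; change (Rabs (F r * cot r - u) < e).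
      rewrite Rminus_0_r in *; rewrite Rabs_pos_eq in hr by lra; apply hd; lra.
  - assert (z := zero (opp_conj H) (fun r => F (PI - r)) (- u)).
    specialize (z (opp_conj_decreasing _ _ _ hH)).
    specialize (z ltac:(unfold opp_conj; rewrite Ropp_involutive, hu; reflexivity)).
    specialize (z (profile_equation_mirror _ _ hF)).
    assert (hacc' : forall d, 0 < d -> exists r, on_strip r /\ r < d /\ Rabs (F (PI - r)) <= 1).
    { intros d hd; destruct (hacc d hd) as (r & [hr hr'] & hrd & hr1); exists (PI - r).
      replace (PI - (PI - r)) with r by ring.
      rewrite Rabs_minus_sym, Rabs_pos_eq in hrd by lra; unfold on_strip; repeat split; lra. }
    specialize (z hacc').
    assert (z' : forall e : posreal, exists d : posreal, forall r, 0 < PI - r < d ->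
       Rabs (F r) < e /\ Rabs (F r * cot r - u) < e).
    { intros e; destruct (z e) as [d hd]; exists d; intros r hr.
      specialize (hd (PI - r) hr); rewrite cot_mirror in hd.
      replace (PI - (PI - r)) with r in hd by ring.
      replace (F r * - cot r - - u) with (- (F r * cot r - u)) in hd by ring.
      rewrite (Rabs_Ropp (F r * cot r - u)) in hd; exact hd. }
    exists 0, u; split; [|split; [|reflexivity]].
    + apply filterlim_locally; intros e; destruct (z' e) as [d hd]; exists d.
      intros r hr [hr1 hr2]; change (Rabs (r - PI) < d) in hr; change (Rabs (F r - 0) < e).
      rewrite Rminus_0_r in *; rewrite Rabs_minus_sym, Rabs_pos_eq in hr by lra; apply hd; lra.
    + apply filterlim_locally; intros e; destruct (z' e) as [d hd]; exists d.
      intros r hr [hr1 hr2]; change (Rabs (r - PI) < d) in hr; change (Rabs (F r * cot r - u) < e).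
      rewrite Rabs_minus_sym, Rabs_pos_eq in hr by lra; apply hd; lra.
  - destruct (profile_curvature_continuous H F p hF ltac:(lra)) as [c1 c2].
    exists (F p), (F p * cot p); split; [|split].
    + eapply filterlim_filter_le_1; [|exact c1].
      intros P hP; unfold within; revert hP; apply filter_imp; auto.
    + eapply filterlim_filter_le_1; [|exact c2].
      intros P hP; unfold within; revert hP; apply filter_imp; auto.
    + intros s0; exfalso; pose proof (sin_gt_0 p ltac:(lra) ltac:(lra)); lra.
Qed.

(** * The Weingarten relation as a function on the line *)

Lemma uniformly_elliptic_slope (g : R -> R) (al : R) :
  Ck_on 1 (fun k => al <= k) g -> uniformly_elliptic g al ->
  exists m M, 0 < m /\ m <= M /\
    forall p q, al <= p -> p <= q -> m * (q - p) <= g p - g q <= M * (q - p).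
Proof.
  intros hC (L1 & L2 & hL1 & hL2 & hL).
  exists (- L2), (- L1); split; [lra|split; [specialize (hL al ltac:(lra)); lra|]].
  intros p q hp [hpq|<-]; [|lra].
  destruct (MVT_cor2 g (Derive g) p q hpq) as (r & e & hr).
  - intros r hr; apply is_derive_Reals, Derive_correct.
    destruct (locally_singleton _ _ (hC r ltac:(lra))) as [hd _].
    apply (hd 1%nat); lia.
  - specialize (hL r ltac:(lra)); nra.
Qed.

(** Since g' < L2 < 0, g is unbounded below, so b is minus infinity and g together
    with its inverse covers the whole line.  The slopes of g^-1 are the inverses
    of those of g; the two halves are joined at the umbilical constant. *)
Lemma weingarten_function (g : R -> R) (al : R) (b : Rbar) :
  elliptic_datum g al b -> uniformly_elliptic g al ->
  exists (G : R -> R) (c L : R), 0 < c /\ decreasing_between c L G /\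
    G al = al /\ forall k, al <= k -> G k = g k /\ G (g k) = k.
Proof.
  intros (hb & hC & _ & hal & _ & hrange & hsurj & (G & _ & hG)) hunif.
  destruct (uniformly_elliptic_slope g al hC hunif) as (m & M & hm & hmM & hslope).
  assert (hM : 0 < M) by lra.
  assert (im : 0 < / m) by (apply Rinv_0_lt_compat; lra).
  assert (iM : 0 < / M) by (apply Rinv_0_lt_compat; lra).
  assert (hbinf : forall y : R, Rbar_lt b y).
  { destruct b as [b| |]; [exfalso|contradiction hb|exact (fun _ => I)].
    simpl in hb.
    pose (k := al + (al - b) / m).
    assert (hk : al <= k) by (unfold k; assert (0 < (al - b) / m) by (apply Rdiv_lt_0_compat; lra); lra).
    destruct (hrange k hk) as [hgk _]; simpl in hgk.
    specialize (hslope al k ltac:(lra) hk); rewrite hal in hslope.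
    replace (m * (k - al)) with (al - b) in hslope by (unfold k; field; lra); lra. }
  assert (above : forall p q, al <= p -> p <= q -> m * (q - p) <= G p - G q <= M * (q - p)).
  { intros p q hp hpq; destruct (hG p hp) as [-> _], (hG q ltac:(lra)) as [-> _].
    apply hslope; assumption. }
  assert (below : forall p q, p <= q -> q <= al -> / M * (q - p) <= G p - G q <= / m * (q - p)).
  { intros p q hpq hq.
    destruct (hsurj p (hbinf p) ltac:(lra)) as (k & [hk <-] & _).
    destruct (hsurj q (hbinf q) hq) as (l & [hl <-] & _).
    destruct (hG k hk) as [_ ->], (hG l hl) as [_ ->].
    assert (hlk : l <= k).
    { apply Rnot_lt_le; intros h; specialize (hslope k l hk ltac:(lra)); nra. }
    specialize (hslope l k hl hlk); split.
    - apply Rmult_le_reg_l with M; [lra|].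
      rewrite <- Rmult_assoc, Rinv_r, Rmult_1_l by lra; lra.
    - apply Rmult_le_reg_l with m; [lra|].
      rewrite <- Rmult_assoc, Rinv_r, Rmult_1_l by lra; lra. }
  exists G, (Rmin m (/ M)), (Rmax M (/ m)).
  split; [apply Rmin_pos; lra|split; [|split; [|exact hG]]].
  - intros p q hpq.
    assert (w1 := Rmin_l m (/ M)); assert (w2 := Rmin_r m (/ M)).
    assert (w3 := Rmax_l M (/ m)); assert (w4 := Rmax_r M (/ m)).
    assert (chain : forall r s, r <= s -> (al <= r \/ s <= al) ->
       Rmin m (/ M) * (s - r) <= G r - G s <= Rmax M (/ m) * (s - r)).
    { intros r s hrs [h|h]; [specialize (above r s h hrs)|specialize (below r s hrs h)]; nra. }
    destruct (Rle_dec al p) as [h1|h1]; [apply chain; [exact hpq|left; exact h1]|].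
    destruct (Rle_dec q al) as [h2|h2]; [apply chain; [exact hpq|right; exact h2]|].
    assert (c1 := chain p al ltac:(lra) ltac:(right; lra)).
    assert (c2 := chain al q ltac:(lra) ltac:(left; lra)); lra.
  - destruct (hG al ltac:(lra)) as [-> _]; exact hal.
Qed.

(** * Fundamental forms of a rotational surface *)

Lemma Ck_on_2 (D : R -> Prop) (f : R -> R) :
  Ck_on 2 D f <->
  forall s, D s -> locally s (fun u => ex_derive f u /\ ex_derive (Derive f) u /\
                                       continuous (Derive (Derive f)) u).
Proof.
  split; intros h s hs; specialize (h s hs); revert h; apply filter_imp; intros u h.
  - destruct h as [h1 h2]; repeat split; [apply (h1 1%nat)|apply (h1 2%nat)|exact h2]; lia.
  - destruct h as (h1 & h2 & h3); split; [|exact h3].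
    intros [|[|[|j]]] hj; [exact I|exact h1|exact h2|lia].
Qed.

(** Being C^2 near a point can be read off from any candidate derivatives that
    are valid in a neighbourhood. *)
Lemma C2_near (f f1 f2 : R -> R) (s : R) :
  locally s (fun r => is_derive f r (f1 r) /\ is_derive f1 r (f2 r) /\ continuous f2 r) ->
  locally s (fun u => ex_derive f u /\ ex_derive (Derive f) u /\
                      continuous (Derive (Derive f)) u).
Proof.
  intros h.
  assert (d1 : locally s (fun r => Derive f r = f1 r)).
  { revert h; apply filter_imp; intros r (h1 & _); apply is_derive_unique, h1. }
  assert (d2 : locally s (fun r => Derive (Derive f) r = f2 r)).
  { apply locally_locally in d1.
    generalize (filter_and _ _ h d1); apply filter_imp; intros r ((_ & h2 & _) & e).
    rewrite (Derive_ext_loc _ _ r e); apply is_derive_unique, h2. }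
  apply locally_locally in d1; apply locally_locally in d2.
  generalize (filter_and _ _ h (filter_and _ _ d1 d2)); apply filter_imp.
  intros r ((h1 & h2 & h3) & e1 & e2); split; [eexists; exact h1|split].
  - apply (ex_derive_ext_loc f1); [|eexists; exact h2].
    revert e1; apply filter_imp; auto.
  - apply (continuous_ext_loc _ f2); [|exact h3].
    revert e2; apply filter_imp; auto.
Qed.

Lemma R4_eq (a b c d a' b' c' d' : R) :
  a = a' -> b = b' -> c = c' -> d = d' -> (a, b, c, d) = (a', b', c', d').
Proof. intros -> -> -> ->; reflexivity. Qed.

Lemma du_rot (x t : R -> R) (s th : R) : ex_derive x s ->
  du (rot x t) s th =
  (Derive x s * cos (x s) * cos th, Derive x s * cos (x s) * sin th,
   - (Derive x s * sin (x s)), Derive t s).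
Proof.
  intros hx; unfold du, Derive4, rot, co1, co2, co3, co4; simpl.
  apply R4_eq; [| | |reflexivity]; apply is_derive_unique;
    auto_derive; try exact hx;
    change (fun x0 => x x0) with x; ring.
Qed.

Lemma dv_rot (x t : R -> R) (s th : R) :
  dv (rot x t) s th = (- (sin (x s) * sin th), sin (x s) * cos th, 0, 0).
Proof.
  unfold dv, Derive4, rot, co1, co2, co3, co4; simpl.
  apply R4_eq; apply is_derive_unique; auto_derive; try exact I; ring.
Qed.

Lemma du_du_rot (x t : R -> R) (s th : R) :
  locally s (fun u => ex_derive x u) -> ex_derive (Derive x) s ->
  du (du (rot x t)) s th =
  ((Derive (Derive x) s * cos (x s) - Derive x s ^ 2 * sin (x s)) * cos th,
   (Derive (Derive x) s * cos (x s) - Derive x s ^ 2 * sin (x s)) * sin th,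
   - (Derive (Derive x) s * sin (x s) + Derive x s ^ 2 * cos (x s)),
   Derive (Derive t) s).
Proof.
  intros hx hx2; assert (hs := locally_singleton _ _ hx).
  unfold du at 1, Derive4.
  assert (ext : forall (f : R4 -> R) (h : R -> R),
     (forall u, ex_derive x u -> f (du (rot x t) u th) = h u) ->
     Derive (fun z => f (du (rot x t) z th)) s = Derive h s).
  { intros f h e; apply Derive_ext_loc; revert hx; apply filter_imp; exact e. }
  rewrite (ext co1 (fun u => Derive x u * cos (x u) * cos th))
    by (intros; rewrite du_rot by assumption; reflexivity).
  rewrite (ext co2 (fun u => Derive x u * cos (x u) * sin th))
    by (intros; rewrite du_rot by assumption; reflexivity).
  rewrite (ext co3 (fun u => - (Derive x u * sin (x u))))
    by (intros; rewrite du_rot by assumption; reflexivity).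
  rewrite (ext co4 (Derive t))
    by (intros; rewrite du_rot by assumption; reflexivity).
  apply R4_eq; [| | |reflexivity]; apply is_derive_unique;
    auto_derive; try (repeat split; assumption);
    change (fun x0 => x x0) with x;
    change (fun x0 => Derive (fun x1 => x x1) x0) with (Derive x); 
    change (fun x0 => Derive x x0) with (Derive x); ring.
Qed.

Lemma du_dv_rot (x t : R -> R) (s th : R) : ex_derive x s ->
  du (dv (rot x t)) s th =
  (- (Derive x s * cos (x s) * sin th), Derive x s * cos (x s) * cos th, 0, 0).
Proof.
  intros hx; unfold du at 1, Derive4.
  rewrite (Derive_ext _ (fun u => - (sin (x u) * sin th))) by (intros; rewrite dv_rot; reflexivity).
  rewrite (Derive_ext (fun z => co2 _) (fun u => sin (x u) * cos th))
    by (intros; rewrite dv_rot; reflexivity).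
  rewrite (Derive_ext (fun z => co3 _) (fun u => 0)) by (intros; rewrite dv_rot; reflexivity).
  rewrite (Derive_ext (fun z => co4 _) (fun u => 0)) by (intros; rewrite dv_rot; reflexivity).
  apply R4_eq; apply is_derive_unique;
    auto_derive; try exact hx; try exact I;
    change (fun x0 => x x0) with x; ring.
Qed.

Lemma dv_dv_rot (x t : R -> R) (s th : R) :
  dv (dv (rot x t)) s th = (- (sin (x s) * cos th), - (sin (x s) * sin th), 0, 0).
Proof.
  unfold dv at 1, Derive4.
  rewrite (Derive_ext _ (fun u => - (sin (x s) * sin u))) by (intros; rewrite dv_rot; reflexivity).
  rewrite (Derive_ext (fun z => co2 _) (fun u => sin (x s) * cos u))
    by (intros; rewrite dv_rot; reflexivity).
  rewrite (Derive_ext (fun z => co3 _) (fun u => 0)) by (intros; rewrite dv_rot; reflexivity).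
  rewrite (Derive_ext (fun z => co4 _) (fun u => 0)) by (intros; rewrite dv_rot; reflexivity).
  apply R4_eq; apply is_derive_unique;
    auto_derive; try exact I; ring.
Qed.

(** The unit normal - t' d_x + x' d_t, where d_x is the unit tangent vector of the
    meridians of the sphere. *)
Definition rot_normal (x t : R -> R) (s th : R) : R4 :=
  (- (Derive t s * cos (x s) * cos th), - (Derive t s * cos (x s) * sin th),
   Derive t s * sin (x s), Derive x s).

Definition scale4 (l : R) (p : R4) : R4 := (l * co1 p, l * co2 p, l * co3 p, l * co4 p).

Definition profile_curvature (x t : R -> R) (s : R) : R :=
  Derive x s * Derive (Derive t) s - Derive (Derive x) s * Derive t s.

Lemma sin2_cos2_pow (r : R) : sin r ^ 2 = 1 - cos r ^ 2.
Proof. pose proof (sin2_cos2 r) as e; unfold Rsqr in e; lra. Qed.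

Lemma unit_normal_rot (x t : R -> R) (s th : R) (n : R4) :
  ex_derive x s -> Derive x s ^ 2 + Derive t s ^ 2 = 1 -> sin (x s) <> 0 ->
  unit_normal (rot x t) s th n ->
  n = scale4 (dot n (rot_normal x t s th)) (rot_normal x t s th) /\
  dot n (rot_normal x t s th) ^ 2 = 1.
Proof.
  intros hx hu hsin (n1 & n2 & n3 & n4).
  rewrite du_rot in n3 by exact hx; rewrite dv_rot in n4.
  destruct n as [[[a b] c] d].
  unfold scale4, rot_normal, ambient_normal, rot, dot, co1, co2, co3, co4 in *; simpl in *.
  set (X := Derive x s) in *; set (T := Derive t s) in *.
  assert (e1 := sin2_cos2_pow th); assert (e2 := sin2_cos2_pow (x s)).
  set (st := sin th) in *; set (ct := cos th) in *;
  set (sx := sin (x s)) in *; set (cx := cos (x s)) in *.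
  clearbody X T st ct sx cx.
  assert (n4' : b * ct - a * st = 0).
  { apply Rmult_eq_reg_l with sx; [|exact hsin]; lra. }
  (* the components of the normal along the orthonormal frame formed by the
     ambient normal, the circle of latitude, the meridian and the vertical line *)
  pose (q := a * ct + b * st).
  assert (mul : forall k u v : R, u = v -> k * u = k * v) by (intros; subst; reflexivity).
  assert (ea : a = q * ct).
  { pose proof (mul a _ _ e1); pose proof (mul st _ _ n4'); unfold q; lra. }
  assert (eb : b = q * st).
  { pose proof (mul b _ _ e1); pose proof (mul ct _ _ n4'); unfold q; lra. }
  pose (p := cx * q - sx * c).
  assert (z : sx * q + cx * c = 0) by (unfold q; lra).
  assert (eq_ : q = cx * p).
  { pose proof (mul q _ _ e2); pose proof (mul sx _ _ z); unfold p; lra. }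
  assert (ec : c = - (sx * p)).
  { pose proof (mul c _ _ e2); pose proof (mul cx _ _ z); unfold p; lra. }
  assert (n3' : p * X + d * T = 0) by (unfold p, q; lra).
  assert (n1' : p ^ 2 + d ^ 2 = 1).
  { rewrite <- n1, ea, eb, ec, eq_.
    transitivity (p ^ 2 * (cx ^ 2 + sx ^ 2) + d ^ 2); [rewrite e2; ring|].
    transitivity (p ^ 2 * (cx ^ 2 * (ct ^ 2 + st ^ 2) + sx ^ 2) + d ^ 2); [rewrite e1; ring|ring]. }
  pose (l := d * X - p * T).
  assert (ep : p = - (l * T)).
  { pose proof (mul p _ _ hu); pose proof (mul X _ _ n3'); unfold l; lra. }
  assert (ed : d = l * X).
  { pose proof (mul d _ _ hu); pose proof (mul T _ _ n3'); unfold l; lra. }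
  assert (el : a * - (T * cx * ct) + b * - (T * cx * st) + c * (T * sx) + d * X = l).
  { rewrite ea, eb, ec, eq_; unfold l.
    transitivity (- T * p * (cx ^ 2 * (ct ^ 2 + st ^ 2) + sx ^ 2) + d * X); [ring|].
    rewrite e1, e2; ring. }
  rewrite el; split.
  - apply R4_eq.
    + rewrite ea, eq_, ep; ring.
    + rewrite eb, eq_, ep; ring.
    + rewrite ec, ep; ring.
    + exact ed.
  - transitivity (p ^ 2 + d ^ 2); [|exact n1'].
    transitivity (l ^ 2 * (X * (X * 1) + T * (T * 1))); [rewrite hu; ring|].
    rewrite ep, ed at 1; ring.
Qed.

Lemma rot_first_form (x t : R -> R) (s th : R) (w z : R * R) :
  ex_derive x s -> Derive x s ^ 2 + Derive t s ^ 2 = 1 ->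
  first_form (rot x t) s th w z = fst w * fst z + snd w * snd z * sin (x s) ^ 2.
Proof.
  intros hx hu; unfold first_form, tangent_vector; rewrite du_rot, dv_rot by exact hx.
  unfold lincomb, dot, co1, co2, co3, co4; simpl fst; simpl snd.
  transitivity (fst w * fst z * (Derive x s ^ 2 * (cos (x s) ^ 2 * (sin th ^ 2 + cos th ^ 2) + sin (x s) ^ 2)
      + Derive t s ^ 2) + snd w * snd z * (sin (x s) ^ 2 * (sin th ^ 2 + cos th ^ 2))); [ring|].
  rewrite (sin2_cos2_pow th).
  replace (1 - cos th ^ 2 + cos th ^ 2) with 1 by ring.
  replace (Derive x s ^ 2 * (cos (x s) ^ 2 * 1 + sin (x s) ^ 2) + Derive t s ^ 2)
    with (Derive x s ^ 2 + Derive t s ^ 2) by (rewrite (sin2_cos2_pow (x s)); ring).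
  rewrite hu; ring.
Qed.

Lemma rot_second_form (x t : R -> R) (s th l : R) (w z : R * R) :
  locally s (fun u => ex_derive x u) -> ex_derive (Derive x) s ->
  second_form (rot x t) (scale4 l (rot_normal x t s th)) s th w z =
  l * (fst w * fst z * profile_curvature x t s
       + snd w * snd z * (sin (x s) * cos (x s) * Derive t s)).
Proof.
  intros hx hx2; assert (hs := locally_singleton _ _ hx).
  unfold second_form; rewrite du_du_rot, du_dv_rot, dv_dv_rot by assumption.
  unfold scale4, rot_normal, profile_curvature, dot, co1, co2, co3, co4; simpl fst; simpl snd.
  set (X := Derive x s); set (X2 := Derive (Derive x) s);
  set (T := Derive t s); set (T2 := Derive (Derive t) s).
  assert (e1 := sin2_cos2_pow th); assert (e2 := sin2_cos2_pow (x s)).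
  set (st := sin th) in *; set (ct := cos th) in *;
  set (sx := sin (x s)) in *; set (cx := cos (x s)) in *.
  clearbody X X2 T T2 st ct sx cx.
  transitivity (l * (fst w * fst z * (- T * ((X2 * cx - X ^ 2 * sx) * cx * (st ^ 2 + ct ^ 2)
       + (X2 * sx + X ^ 2 * cx) * sx) + X * T2)
     + snd w * snd z * (sx * cx * T * (st ^ 2 + ct ^ 2)))); [ring|].
  rewrite e1; replace (1 - ct ^ 2 + ct ^ 2) with 1 by ring.
  transitivity (l * (fst w * fst z * (- T * X2 * (cx ^ 2 + sx ^ 2) + X * T2)
     + snd w * snd z * (sx * cx * T))); [ring|].
  rewrite e2; ring.
Qed.

Lemma off_axis_sin (x : R -> R) (s : R) : off_axis x s -> 0 < sin (x s).
Proof. intros [h1 h2]; apply sin_gt_0; assumption. Qed.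

Definition normal_sign (x t : R -> R) (N : R -> R -> R4) (s : R) : R :=
  dot (N s 0) (rot_normal x t s 0).

(** The coordinate directions are principal, with curvatures k_p and
    k_r = t' cot x multiplied by the sign of the chosen normal.  The relation
    k_2 = g (k_1) concerns the ordered pair; in either order it says that G maps
    k_r to k_p, because G extends both g and its inverse. *)
Lemma weingarten_curvatures (g G : R -> R) (al : R) (J : R -> Prop) (x t : R -> R)
    (N : R -> R -> R4) (s : R) :
  (forall k, al <= k -> G k = g k /\ G (g k) = k) ->
  regular_rotational J x t -> orientation J x t N -> weingarten g al J x t N ->
  J s -> off_axis x s ->
  normal_sign x t N s ^ 2 = 1 /\
  normal_sign x t N s * profile_curvature x t s
  = G (normal_sign x t N s * (Derive t s * cot (x s))).
Proof.
  intros hG (hx & _ & _ & hu & _) hN hW hs ho.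
  assert (hx2 := proj1 (Ck_on_2 J x) hx s hs).
  assert (hx1 : locally s (fun u => ex_derive x u)) by (revert hx2; apply filter_imp; tauto).
  apply locally_singleton in hx2; destruct hx2 as (d1 & d2 & _).
  assert (p := off_axis_sin x s ho).
  destruct (unit_normal_rot x t s 0 (N s 0)) as [eN hl]; [exact d1|apply hu, hs|lra|apply hN; assumption|].
  fold (normal_sign x t N s) in eN, hl; set (l := normal_sign x t N s) in *.
  split; [exact hl|].
  assert (esc : sin (x s) * cos (x s) * Derive t s = sin (x s) ^ 2 * (Derive t s * cot (x s)))
    by (unfold cot; field; lra).
  assert (pc : forall k1 k2, 
     (k1 = l * profile_curvature x t s /\ k2 = l * (Derive t s * cot (x s))) \/
     (k2 = l * profile_curvature x t s /\ k1 = l * (Derive t s * cot (x s))) ->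
     principal_curvatures (rot x t) (N s 0) s 0 k1 k2).
  { assert (a1 : forall w, second_form (rot x t) (N s 0) s 0 (1, 0) w =
        l * profile_curvature x t s * first_form (rot x t) s 0 (1, 0) w).
    { intros w; rewrite eN, rot_second_form, rot_first_form by auto; simpl; ring. }
    assert (a2 : forall w, second_form (rot x t) (N s 0) s 0 (0, / sin (x s)) w =
        l * (Derive t s * cot (x s)) * first_form (rot x t) s 0 (0, / sin (x s)) w).
    { intros w; rewrite eN, rot_second_form, rot_first_form, esc by auto; simpl; ring. }
    intros k1 k2 [[-> ->]|[-> ->]]; [exists (1, 0), (0, / sin (x s))|exists (0, / sin (x s)), (1, 0)];
    rewrite !rot_first_form by auto; simpl;
    (repeat split; [field; lra|field; lra|ring|assumption|assumption]). }
  destruct (Rle_dec (l * (Derive t s * cot (x s))) (l * profile_curvature x t s)) as [h|h].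
  - destruct (hW s 0 _ _ hs ho (pc _ _ (or_introl (conj eq_refl eq_refl))) h) as [h1 h2].
    rewrite h2; symmetry; apply hG, h1.
  - destruct (hW s 0 _ _ hs ho (pc _ _ (or_intror (conj eq_refl eq_refl))) ltac:(lra)) as [h1 h2].
    rewrite h2; symmetry; apply hG, h1.
Qed.

Lemma second_form_bound (J : R -> Prop) (x t : R -> R) (N : R -> R -> R4) (C : R) :
  regular_rotational J x t -> orientation J x t N ->
  (forall s, J s -> off_axis x s ->
     Rabs (profile_curvature x t s) <= C /\ Rabs (Derive t s * cot (x s)) <= C) ->
  bounded_second_form J x t N.
Proof.
  intros (hx & _ & _ & hu & _) hN hC; exists (2 * C).
  intros s th w z hs ho; destruct (hC s hs ho) as [h1 h2].
  assert (hx2 := proj1 (Ck_on_2 J x) hx s hs).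
  assert (hx1 : locally s (fun u => ex_derive x u)) by (revert hx2; apply filter_imp; tauto).
  apply locally_singleton in hx2; destruct hx2 as (d1 & d2 & _).
  assert (p := off_axis_sin x s ho).
  destruct (unit_normal_rot x t s th (N s th)) as [eN hl];
    [exact d1|apply hu, hs|lra|apply hN; assumption|].
  rewrite eN, rot_second_form, !rot_first_form by auto.
  set (l := dot _ _) in *; clearbody l.
  replace (sin (x s) * cos (x s) * Derive t s) with (sin (x s) ^ 2 * (Derive t s * cot (x s)))
    by (unfold cot; field; lra).
  set (kp := profile_curvature x t s) in *; set (kr := Derive t s * cot (x s)) in *.
  set (q := sin (x s)) in *; clearbody kp kr q.
  destruct w as [w1 w2], z as [z1 z2]; simpl fst; simpl snd.
  assert (C0 : 0 <= C) by (pose proof (Rabs_pos kp); lra).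
  assert (part : forall a b : R, Rabs a <= sqrt (a * a + b * b) /\ Rabs b <= sqrt (a * a + b * b)).
  { intros a b; split; rewrite <- sqrt_Rsqr_abs; apply sqrt_le_1_alt; unfold Rsqr; nra. }
  replace (w1 * w1 + w2 * w2 * q ^ 2) with (w1 * w1 + (w2 * q) * (w2 * q)) by ring.
  replace (z1 * z1 + z2 * z2 * q ^ 2) with (z1 * z1 + (z2 * q) * (z2 * q)) by ring.
  destruct (part w1 (w2 * q)) as [pw1 pw2], (part z1 (z2 * q)) as [pz1 pz2].
  set (W := sqrt _) in *; set (Z := sqrt (z1 * _ + _)) in *; clearbody W Z.
  assert (al : Rabs l = 1) by (unfold Rabs; destruct (Rcase_abs l); nra).
  rewrite Rabs_mult, al, Rmult_1_l.
  replace (w2 * z2 * (q ^ 2 * kr)) with ((w2 * q) * (z2 * q) * kr) by ring.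
  eapply Rle_trans; [apply Rabs_triang|]; rewrite !(Rabs_mult (_ * _)).
  rewrite (Rabs_mult w1).
  assert (prod : forall a b k : R, 0 <= a <= W -> 0 <= b <= Z -> 0 <= k <= C -> a * b * k <= C * W * Z).
  { intros a b k ha hb hk.
    assert (a * b <= W * Z) by (apply Rmult_le_compat; lra).
    assert (a * b * k <= W * Z * C) by (apply Rmult_le_compat; nra). lra. }
  assert (q1 := prod (Rabs w1) (Rabs z1) (Rabs kp) (conj (Rabs_pos _) pw1) (conj (Rabs_pos _) pz1) (conj (Rabs_pos _) h1)).
  assert (q2 := prod _ _ (Rabs kr) (conj (Rabs_pos _) pw2) (conj (Rabs_pos _) pz2) (conj (Rabs_pos _) h2)).
  lra.
Qed.

(** * The first integral of a profile curve *)

Lemma interval_dense_in_itself (J : R -> Prop) (s : R) :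
  interval J -> J s -> forall d, 0 < d -> exists q, J q /\ q <> s /\ Rabs (q - s) < d.
Proof.
  intros [hc (a & b & ha & hb & hab)] hs d hd.
  destruct (Rlt_dec s b) as [h|h].
  - assert (m1 := Rmin_l b (s + d / 2)); assert (m2 := Rmin_r b (s + d / 2)).
    assert (m3 : s < Rmin b (s + d / 2)) by (apply Rmin_glb_lt; lra).
    exists (Rmin b (s + d / 2)); split; [apply (hc s b); [assumption|assumption|lra]|].
    split; [lra|rewrite Rabs_pos_eq; lra].
  - assert (m1 := Rmax_l a (s - d / 2)); assert (m2 := Rmax_r a (s - d / 2)).
    assert (m3 : Rmax a (s - d / 2) < s) by (apply Rmax_lub_lt; lra).
    exists (Rmax a (s - d / 2)); split; [apply (hc a s); [assumption|assumption|lra]|].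
    split; [lra|rewrite Rabs_left; lra].
Qed.

(** At an endpoint of J the two-sided derivative is already determined by the
    points of J, which is all that is known about the unit speed condition. *)
Lemma derive_const_on (D : R -> Prop) (f : R -> R) (s l k : R) :
  (forall d, 0 < d -> exists q, D q /\ q <> s /\ Rabs (q - s) < d) ->
  (forall q, D q -> f q = k) -> f s = k -> is_derive f s l -> l = 0.
Proof.
  intros hD hf hfs hd; apply is_derive_Reals in hd.
  apply Rabs_eq_0, Rle_antisym; [|apply Rabs_pos].
  apply le_epsilon; intros e he.
  destruct (hd e he) as [d hd'].
  destruct (hD d (cond_pos d)) as (q & hq & hqs & hqd).
  specialize (hd' (q - s) ltac:(lra) hqd).
  replace (s + (q - s)) with q in hd' by ring.
  rewrite (hf q hq), hfs, Rminus_diag in hd'.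
  replace (0 / (q - s) - l) with (- l) in hd' by (field; lra).
  rewrite Rabs_Ropp in hd'; lra.
Qed.

(** Differentiating x'^2 + t'^2 = 1 shows that the acceleration is normal to the
    curve, hence k_p times the unit normal (- t', x'). *)
Lemma unit_speed_derivatives (J : R -> Prop) (x t : R -> R) (s : R) :
  interval J -> Ck_on 2 J x -> Ck_on 2 J t ->
  (forall s, J s -> Derive x s ^ 2 + Derive t s ^ 2 = 1) -> J s ->
  Derive (Derive x) s = - (Derive t s * profile_curvature x t s) /\
  Derive (Derive t) s = Derive x s * profile_curvature x t s.
Proof.
  intros hJ hx ht hu hs.
  destruct (locally_singleton _ _ (proj1 (Ck_on_2 J x) hx s hs)) as (_ & dx & _).
  destruct (locally_singleton _ _ (proj1 (Ck_on_2 J t) ht s hs)) as (_ & dt & _).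
  assert (e : 2 * (Derive x s * Derive (Derive x) s + Derive t s * Derive (Derive t) s) = 0).
  { apply (derive_const_on J (fun r => Derive x r ^ 2 + Derive t r ^ 2) s _ 1).
    - apply interval_dense_in_itself; assumption.
    - exact hu.
    - apply hu, hs.
    - auto_derive; [split; [exact dx|split; [exact dt|exact I]]|].
      change (fun x0 => Derive (fun x1 => x x1) x0) with (Derive x);
      change (fun x0 => Derive (fun x1 => t x1) x0) with (Derive t);
      change (fun x0 => Derive x x0) with (Derive x);
      change (fun x0 => Derive t x0) with (Derive t); ring. }
  specialize (hu s hs); unfold profile_curvature; split.
  - transitivity (Derive (Derive x) s * (Derive x s ^ 2 + Derive t s ^ 2)
      - Derive x s * (2 * (Derive x s * Derive (Derive x) s + Derive t s * Derive (Derive t) s)) / 2);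
      [rewrite hu, e; field|field].
  - transitivity (Derive (Derive t) s * (Derive x s ^ 2 + Derive t s ^ 2)
      - Derive t s * (2 * (Derive x s * Derive (Derive x) s + Derive t s * Derive (Derive t) s)) / 2);
      [rewrite hu, e; field|field].
Qed.

(** Precomposed with the retraction of the line onto [a, b], the function has zero
    derivative everywhere. *)
Lemma locally_constant_eq (f : R -> R) (a b : R) :
  a <= b ->
  (forall r, a <= r <= b -> exists d, 0 < d /\
     forall q, a <= q <= b -> Rabs (q - r) < d -> f q = f r) ->
  f b = f a.
Proof.
  intros hab h.
  pose (k := fun r => Rmax a (Rmin b r)).
  assert (kr : forall r, a <= k r <= b).
  { intros r; unfold k; split; [apply Rmax_l|apply Rmax_lub; [exact hab|apply Rmin_l]]. }
  assert (kid : forall r, a <= r <= b -> k r = r).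
  { intros r hr; unfold k; rewrite Rmin_right, Rmax_right; lra. }
  assert (klip : forall q r, Rabs (k q - k r) <= Rabs (q - r)).
  { intros q r; unfold k, Rmax, Rmin; destruct (Rle_dec b q), (Rle_dec b r);
    repeat match goal with |- context [Rle_dec ?u ?v] => destruct (Rle_dec u v) end;
    unfold Rabs; repeat match goal with |- context [Rcase_abs ?u] => destruct (Rcase_abs u) end; lra. }
  assert (hd : forall r, is_derive (fun q => f (k q)) r 0).
  { intros r; destruct (h (k r) (kr r)) as (d & hd & hq).
    apply (is_derive_ext_loc (fun _ => f (k r))); [|apply (is_derive_const (f (k r)) r)].
    exists (mkposreal d hd); intros q hqr; symmetry; apply hq; [apply kr|].
    eapply Rle_lt_trans; [apply klip|exact hqr]. }
  rewrite <- (kid a), <- (kid b) by lra.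
  apply Rle_antisym.
  - apply Ropp_le_cancel.
    apply (derive_nonneg_incr (fun q => - f (k q)) (fun _ => 0) a b hab); [|intros; lra].
    intros r _; rewrite <- Ropp_0; apply (is_derive_opp (fun q => f (k q))), hd.
  - apply (derive_nonneg_incr (fun q => f (k q)) (fun _ => 0) a b hab); [|intros; lra].
    intros r _; apply hd.
Qed.

Lemma lim_plus {T : Type} (F : (T -> Prop) -> Prop) {FF : Filter F} (f g : T -> R) (a b : R) :
  filterlim f F (locally a) -> filterlim g F (locally b) ->
  filterlim (fun z => f z + g z) F (locally (a + b)).
Proof. intros hf hg; eapply filterlim_comp_2; [exact hf|exact hg|apply (filterlim_plus a b)]. Qed.

Lemma lim_mult {T : Type} (F : (T -> Prop) -> Prop) {FF : Filter F} (f g : T -> R) (a b : R) :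
  filterlim f F (locally a) -> filterlim g F (locally b) ->
  filterlim (fun z => f z * g z) F (locally (a * b)).
Proof. intros hf hg; eapply filterlim_comp_2; [exact hf|exact hg|apply (filterlim_mult a b)]. Qed.

Lemma continuous_within (D : R -> Prop) (f : R -> R) (s : R) :
  continuous f s -> filterlim f (within D (locally s)) (locally (f s)).
Proof.
  intros h; eapply filterlim_filter_le_1; [|exact h].
  intros P hP; unfold within; revert hP; apply filter_imp; auto.
Qed.

(** A continuous function with values 1 and -1 is locally constant. *)
Lemma normal_sign_locally_constant (J : R -> Prop) (x t : R -> R) (N : R -> R -> R4) (s : R) :
  regular_rotational J x t -> orientation J x t N ->
  (forall r, J r -> off_axis x r -> normal_sign x t N r ^ 2 = 1) ->
  J s -> off_axis x s ->
  exists d, 0 < d /\ forall q, J q -> off_axis x q -> Rabs (q - s) < d ->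
    normal_sign x t N q = normal_sign x t N s.
Proof.
  intros (hx & ht & _) hN h1 hs ho.
  pose (D := fun r => J r /\ off_axis x r).
  destruct (locally_singleton _ _ (proj1 (Ck_on_2 J x) hx s hs)) as (dx & dx2 & _).
  destruct (locally_singleton _ _ (proj1 (Ck_on_2 J t) ht s hs)) as (dt & dt2 & _).
  assert (cN : filterlim (fun r => N r 0) (within D (locally s)) (locally (N s 0))).
  { destruct (hN s 0 hs ho) as [_ hc].
    intros P hP; destruct (hc P hP) as [e he].
    exists e; intros q hq hD; apply (he (q, 0)); [|exact hD].
    split; [exact hq|apply ball_center]. }
  assert (pr : forall (f : R4 -> R), (forall e p q, ball p e q -> ball (f p) e (f q)) ->
     filterlim (fun r => f (N r 0)) (within D (locally s)) (locally (f (N s 0)))).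
  { intros f hf; eapply filterlim_comp; [exact cN|].
    apply filterlim_locally; intros e; exists e; intros q hq; apply hf, hq. }
  assert (cont : forall f : R -> R, ex_derive f s -> filterlim f (within D (locally s)) (locally (f s))).
  { intros f hf; apply continuous_within, (ex_derive_continuous f), hf. }
  assert (ms : filterlim (normal_sign x t N) (within D (locally s)) (locally (normal_sign x t N s))).
  { unfold normal_sign, dot, rot_normal, co1 at 2 4, co2 at 2 4, co3 at 2 4, co4 at 2 4.
    simpl fst; simpl snd.
    assert (FF : Filter (within D (locally s))) by (apply within_filter, locally_filter).
    repeat (apply lim_plus; [exact FF| |]); (apply lim_mult; [exact FF| |]).
    - apply (pr co1); intros e [[[]]] [[[]]] [[[]]]; assumption.
    - apply cont; auto_derive; repeat split; assumption.
    - apply (pr co2); intros e [[[]]] [[[]]] [[[]]]; assumption.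
    - apply cont; auto_derive; repeat split; assumption.
    - apply (pr co3); intros e [[[]]] [[[]]] [[[]]]; assumption.
    - apply cont; auto_derive; repeat split; assumption.
    - apply (pr co4); intros e [[[]]] [[[]]] [[[]]]; assumption.
    - apply cont; assumption. }
  destruct (proj1 (filterlim_locally _ _) ms (mkposreal 1 Rlt_0_1)) as [d hd].
  exists d; split; [apply cond_pos|]; intros q hq hqo hqd.
  specialize (hd q hqd (conj hq hqo)).
  change (Rabs (normal_sign x t N q - normal_sign x t N s) < 1) in hd.
  assert (e1 := h1 q hq hqo); assert (e2 := h1 s hs ho); apply Rabs_lt_between in hd.
  set (A := normal_sign x t N q) in *; set (B := normal_sign x t N s) in *.
  destruct (Rmult_integral (A - B) (A + B)) as [z|z]; [nra|lra|nra].
Qed.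

(** The difference D = t' - F (x) satisfies |D'| <= L |cot x| |D|, because
    t'' = x' H (t' cot x) and F' = H (F cot x), and cot x is bounded on a compact
    segment off the axes. *)
Lemma first_integral (c L : R) (H F x t : R -> R) (s0 s : R) :
  0 < c -> decreasing_between c L H -> profile_equation H F ->
  (forall r, Rmin s0 s <= r <= Rmax s0 s ->
     off_axis x r /\ ex_derive x r /\ ex_derive (Derive t) r /\ Rabs (Derive x r) <= 1 /\
     Derive (Derive t) r = Derive x r * H (Derive t r * cot (x r))) ->
  Derive t s0 = F (x s0) -> Derive t s = F (x s).
Proof.
  intros hc hH hF h h0.
  destruct (decreasing_lipschitz c L H hc hH) as [hL hl].
  destruct (bounded_continuity (fun r => cot (x r)) (Rmin s0 s) (Rmax s0 s)) as [M hM].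
  { intros r hr; destruct (h r hr) as (ho & dx & _).
    apply (ex_derive_continuous (fun r => cot (x r))); unfold cot; auto_derive.
    pose proof (off_axis_sin x r ho); repeat split; try exact dx; apply Rgt_not_eq; assumption. }
  apply Rminus_diag_uniq.
  apply (gronwall_zero (fun r => Derive t r - F (x r))
     (fun r => Derive x r * H (Derive t r * cot (x r)) - Derive x r * H (F (x r) * cot (x r)))
     (L * M) s0 s); [|lra].
  intros r hr; destruct (h r hr) as (ho & dx & dt2 & hx1 & e); split.
  - rewrite <- e.
    apply (is_derive_minus (Derive t) (fun r => F (x r))); [apply Derive_correct, dt2|].
    apply (is_derive_comp F x r); [apply hF, ho|apply Derive_correct, dx].
  - specialize (hM r hr); change (Rabs (cot (x r)) < M) in hM.
    rewrite <- Rmult_minus_distr_l, Rabs_mult.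
    assert (w := hl (Derive t r * cot (x r)) (F (x r) * cot (x r))).
    rewrite <- Rmult_minus_distr_r, Rabs_mult in w.
    assert (0 <= Rabs (Derive t r - F (x r))) by apply Rabs_pos.
    assert (0 <= Rabs (H (Derive t r * cot (x r)) - H (F (x r) * cot (x r)))) by apply Rabs_pos.
    assert (Rabs (Derive t r - F (x r)) * Rabs (cot (x r)) <= Rabs (Derive t r - F (x r)) * M)
      by (apply Rmult_le_compat_l; lra).
    pose proof (Rabs_pos (Derive x r)). nra.
Qed.

(** The points off the axis with t' = F (x) and |t'| <= 1 rule out blow-up of F, so
    F (x) tends to 0. *)
Lemma axis_horizontal (c L : R) (H F : R -> R) (u : R) (x t : R -> R) (e : R) :
  0 < c -> decreasing_between c L H -> H u = u -> profile_equation H F ->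
  continuous x e -> continuous (Derive t) e -> 0 <= x e <= PI -> sin (x e) = 0 ->
  (forall d, 0 < d -> exists r, Rabs (r - e) < d /\ off_axis x r /\
     Derive t r = F (x r) /\ Rabs (Derive t r) <= 1) ->
  Derive t e = 0.
Proof.
  intros hc hH hu hF cx ct hxe hsin hacc.
  assert (near : forall f (d : posreal), continuous f e ->
     exists d', 0 < d' /\ forall r, Rabs (r - e) < d' -> Rabs (f r - f e) < d).
  { intros f d cf; destruct (proj1 (filterlim_locally f (f e)) cf d) as [d' hd'].
    exists d'; split; [apply cond_pos|]; intros r hr; apply (hd' r hr). }
  destruct (profile_limits c L H F u (x e) hc hH hu hF hxe) as (lF & lk & hlF & _ & z).
  { intros d hd; destruct (near x (mkposreal d hd) cx) as (d' & hd' & hr).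
    destruct (hacc d' hd') as (r & hre & ho & ht & h1).
    exists (x r); split; [exact ho|split; [apply hr, hre|rewrite <- ht; exact h1]]. }
  rewrite (z hsin) in hlF.
  apply Rabs_eq_0, Rle_antisym; [|apply Rabs_pos].
  apply le_epsilon; intros eps heps.
  assert (h2 : 0 < eps / 2) by lra.
  destruct (proj1 (filterlim_locally F 0) hlF (mkposreal _ h2)) as [d hd].
  destruct (near x d cx) as (d1 & hd1 & hr1).
  destruct (near (Derive t) (mkposreal _ h2) ct) as (d2 & hd2 & hr2).
  destruct (hacc (Rmin d1 d2) (Rmin_pos _ _ hd1 hd2)) as (r & hre & ho & ht & _).
  specialize (hr1 r ltac:(eapply Rlt_le_trans; [exact hre|apply Rmin_l])).
  specialize (hr2 r ltac:(eapply Rlt_le_trans; [exact hre|apply Rmin_r])).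
  specialize (hd (x r) hr1 ho).
  change (Rabs (F (x r) - 0) < eps / 2) in hd; rewrite Rminus_0_r in hd.
  simpl in hr2.
  replace (Derive t e) with (Derive t r - (Derive t r - Derive t e)) by ring.
  eapply Rle_trans; [apply Rabs_triang|]; rewrite Rabs_Ropp, ht in *; lra.
Qed.

Definition inside (J : R -> Prop) (s : R) : Prop :=
  exists a b, J a /\ J b /\ a < s < b.

Lemma inside_locally (J : R -> Prop) (s : R) :
  interval J -> inside J s -> J s /\ locally s J.
Proof.
  intros [hc _] (a & b & ha & hb & hs); split; [apply (hc a b); [assumption|assumption|lra]|].
  assert (hd : 0 < Rmin (s - a) (b - s)) by (apply Rmin_pos; lra).
  exists (mkposreal _ hd); intros q hq; change (Rabs (q - s) < Rmin (s - a) (b - s)) in hq.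
  assert (w1 := Rmin_l (s - a) (b - s)); assert (w2 := Rmin_r (s - a) (b - s)).
  apply Rabs_lt_between in hq; apply (hc a b); [assumption|assumption|lra].
Qed.

Lemma not_off_axis (x : R -> R) (s : R) : 0 <= x s <= PI -> ~ off_axis x s -> sin (x s) = 0.
Proof.
  intros h hn; destruct (Req_dec (x s) 0) as [->|]; [apply sin_0|].
  destruct (Req_dec (x s) PI) as [->|]; [apply sin_PI|].
  exfalso; apply hn; split; lra.
Qed.

(** A surface contained in the axes would be a piece of a line: the coordinates
    x_1, x_2, x_3 are locally constant on it, so both partial derivatives of a
    chart are vertical and the chart is not an immersion. *)
Lemma regular_not_on_axis (J : R -> Prop) (x t : R -> R) :
  interval J -> regular_rotational J x t -> exists s, J s /\ off_axis x s.
Proof.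
  intros hJ (_ & _ & hx & _ & hreg); apply NNPP; intros hn.
  assert (z : forall s, J s -> sin (x s) = 0).
  { intros s hs; apply not_off_axis; [apply hx, hs|]; intros ho; apply hn; exists s; auto. }
  destruct hJ as [_ (s & _ & hs & _)].
  destruct (hreg s hs) as [him|(d & hd & hp & V & U & X & Y & hV & Vp & hU & hX & hS & hY & _)].
  - destruct (him 0 0 1) as [_ h]; [|lra].
    rewrite dv_rot, (z s hs); unfold lincomb, co1, co2, co3, co4; simpl.
    apply R4_eq; ring.
  - destruct (hY _ hp Vp) as [hU0 _].
    destruct (Y (rot x t s 0)) as [u0 v0]; simpl in *; clear hY.
    (* the first two coordinates vanish on the whole chart and the third one is
       a sign, so that both partial derivatives are vertical *)
    assert (co : forall u v, U (u, v) ->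
              co1 (X u v) = 0 /\ co2 (X u v) = 0 /\ co3 (X u v) ^ 2 = 1).
    { intros u v h; destruct (hS u v h) as ((r & th & hr & _ & ->) & _ & _).
      unfold rot, co1, co2, co3; simpl fst; simpl snd; rewrite (z r hr).
      split; [ring|split; [ring|]].
      rewrite <- (Rplus_0_l (cos (x r) ^ 2)); pose proof (sin2_cos2 (x r)) as e.
      unfold Rsqr in e; rewrite (z r hr) in e; lra. }
    assert (hl := hU (u0, v0) hU0).
    assert (l1 : locally u0 (fun w => U (w, v0))).
    { destruct hl as [e he]; exists e; intros w hw; apply he; split; [exact hw|apply ball_center]. }
    assert (l2 : locally v0 (fun w => U (u0, w))).
    { destruct hl as [e he]; exists e; intros w hw; apply he; split; [apply ball_center|exact hw]. }
    destruct (hX u0 v0 hU0) as [(_ & _ & h3 & _) him].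
    destruct h3 as (_ & e1 & e2 & _).
    assert (D0 : forall (f : R -> R) (a : R), locally a (fun w => f w = 0) -> Derive f a = 0).
    { intros f a h; rewrite (Derive_ext_loc f (fun _ => 0) a h); apply Derive_const. }
    assert (D1 : forall (f : R -> R) (a : R), ex_derive f a ->
              locally a (fun w => f w ^ 2 = 1) -> Derive f a = 0).
    { intros f a hf h; assert (h' := locally_singleton _ _ h).
      assert (e : 2 * (f a * Derive f a) = 0).
      { transitivity (Derive (fun w => f w ^ 2) a).
        - symmetry; apply is_derive_unique; auto_derive; [exact hf|].
          change (fun x0 => f x0) with f; ring.
        - eapply eq_trans; [apply (Derive_ext_loc _ (fun _ => 1) a h)|apply Derive_const]. }
      assert (f a <> 0) by (simpl in h'; intros h0; rewrite h0 in h'; lra).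
      apply (Rmult_eq_reg_l (f a)); [lra|assumption]. }
    assert (du0 : du X u0 v0 = (0, 0, 0, Derive (fun w => co4 (X w v0)) u0)).
    { unfold du, Derive4; apply R4_eq; [apply D0|apply D0|apply D1; [exact e1|]|reflexivity];
      revert l1; apply filter_imp; intros w hw; apply (co w v0 hw). }
    assert (dv0 : dv X u0 v0 = (0, 0, 0, Derive (fun w => co4 (X u0 w)) v0)).
    { unfold dv, Derive4; apply R4_eq; [apply D0|apply D0|apply D1; [exact e2|]|reflexivity];
      revert l2; apply filter_imp; intros w hw; apply (co u0 w hw). }
    unfold immersed_at in him; rewrite du0, dv0 in him.
    set (p := Derive _ u0) in *; set (q := Derive _ v0) in *.
    unfold lincomb, co1, co2, co3, co4 in him; simpl in him.
    destruct (him q (- p)) as [q0 p0]; [apply R4_eq; ring|].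
    destruct (him 1 0) as [h _]; [|lra].
    apply R4_eq; try ring; lra.
Qed.

(** The outcome of the analysis of a profile curve.  It no longer mentions the
    normal nor the curvatures, so that it can be checked on an extension of the
    curve. *)
Definition solves_profile (c L u : R) (H F : R -> R) (J : R -> Prop) (x t : R -> R) : Prop :=
  0 < c /\ decreasing_between c L H /\ H u = u /\ profile_equation H F /\
  (forall s, J s -> off_axis x s -> Derive t s = F (x s)).

Lemma interval_between (J : R -> Prop) (a b r : R) :
  interval J -> J a -> J b -> Rmin a b <= r <= Rmax a b -> J r.
Proof.
  intros [hc _] ha hb; unfold Rmin, Rmax; destruct (Rle_dec a b); intros hr;
  [apply (hc a b)|apply (hc b a)]; assumption.
Qed.

Lemma unit_speed_bound (a b : R) : a ^ 2 + b ^ 2 = 1 -> Rabs a <= 1 /\ Rabs b <= 1.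
Proof. intros h; split; apply Rabs_le_between; nra. Qed.

(** Fix a parameter s0 off the axes, choose H according to the sign of the normal
    there, and let F be the solution with F (x s0) = t' s0.  Both the sign and the
    first integral propagate along any segment off the axes.  If an interior
    parameter of J were on an axis, take the one nearest to s0 on its side:
    [axis_horizontal] gives t' = 0 there, while x has an extremum, so that x' = 0
    as well, against unit speed. *)
Lemma profile_structure (g : R -> R) (al : R) (b : Rbar) (J : R -> Prop) (x t : R -> R)
    (N : R -> R -> R4) :
  elliptic_datum g al b -> uniformly_elliptic g al -> interval J ->
  regular_rotational J x t -> orientation J x t N -> weingarten g al J x t N ->
  exists c L u H F,
    solves_profile c L u H F J x t /\
    (forall s, inside J s -> off_axis x s) /\
    (forall s, J s -> off_axis x s -> profile_curvature x t s = H (F (x s) * cot (x s))).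
Proof.
  intros hg hunif hJ hreg hN hW.
  destruct (weingarten_function g al b hg hunif) as (G & c & L & hc & hG & hal & hGg).
  destruct (regular_not_on_axis J x t hJ hreg) as (s0 & hs0 & ho0).
  assert (hcurv := fun s => weingarten_curvatures g G al J x t N s hGg hreg hN hW).
  assert (hcopy := hreg); destruct hcopy as (hx & ht & hrange & hu & _).
  pose (l := normal_sign x t N s0).
  destruct (hcurv s0 hs0 ho0) as [hl _]; fold l in hl.
  pose (H := fun k => l * G (l * k)).
  assert (l1 := sqr_eq_1 l hl).
  assert (hH : decreasing_between c L H).
  { intros p q hpq; unfold H; destruct l1 as [-> | ->].
    - rewrite !Rmult_1_l; apply hG, hpq.
    - assert (w := opp_conj_decreasing c L G hG p q hpq); unfold opp_conj in w.
      replace (-1 * p) with (- p) by ring; replace (-1 * q) with (- q) by ring; lra. }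
  assert (hHu : H (l * al) = l * al).
  { unfold H; replace (l * (l * al)) with (l ^ 2 * al) by ring; rewrite hl, Rmult_1_l, hal; ring. }
  destruct (profile_equation_exists c L H (x s0) (Derive t s0) hc hH ho0) as (F & hF0 & hF).
  assert (C2 : forall s, J s -> ex_derive x s /\ ex_derive (Derive x) s /\
                 ex_derive t s /\ ex_derive (Derive t) s).
  { intros s hs.
    destruct (locally_singleton _ _ (proj1 (Ck_on_2 J x) hx s hs)) as (d1 & d2 & _).
    destruct (locally_singleton _ _ (proj1 (Ck_on_2 J t) ht s hs)) as (d3 & d4 & _); auto. }
  assert (sign : forall s, J s -> (forall r, Rmin s0 s <= r <= Rmax s0 s -> off_axis x r) ->
            normal_sign x t N s = l).
  { intros s hs ho.
    assert (hJr : forall r, Rmin s0 s <= r <= Rmax s0 s -> J r)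
      by (intros r hr; apply (interval_between J s0 s r hJ hs0 hs hr)).
    assert (loc : forall r, Rmin s0 s <= r <= Rmax s0 s -> exists d, 0 < d /\
       forall q, Rmin s0 s <= q <= Rmax s0 s -> Rabs (q - r) < d ->
         normal_sign x t N q = normal_sign x t N r).
    { intros r hr.
      destruct (normal_sign_locally_constant J x t N r hreg hN) as (d & hd & hq);
        [intros; apply hcurv; assumption|apply hJr, hr|apply ho, hr|].
      exists d; split; [exact hd|]; intros q hqr; apply hq; [apply hJr, hqr|apply ho, hqr]. }
    assert (e := locally_constant_eq (normal_sign x t N) _ _ (Rminmax s0 s) loc).
    revert e; unfold l, Rmin, Rmax; destruct (Rle_dec s0 s); intros ->; reflexivity. }
  assert (kp : forall s, J s -> (forall r, Rmin s0 s <= r <= Rmax s0 s -> off_axis x r) ->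
            profile_curvature x t s = H (Derive t s * cot (x s))).
  { intros s hs ho.
    assert (hos : off_axis x s) by (apply ho; split; [apply Rmin_r|apply Rmax_r]).
    destruct (hcurv s hs hos) as [_ e]; rewrite (sign s hs ho) in e.
    unfold H; rewrite <- e.
    transitivity (l ^ 2 * profile_curvature x t s); [rewrite hl|]; ring. }
  assert (tF : forall s, J s -> (forall r, Rmin s0 s <= r <= Rmax s0 s -> off_axis x r) ->
            Derive t s = F (x s)).
  { intros s hs ho; apply (first_integral c L H F x t s0 s hc hH hF); [|symmetry; exact hF0].
    intros r hr; assert (hr' := interval_between J s0 s r hJ hs0 hs hr).
    destruct (C2 r hr') as (d1 & d2 & d3 & d4).
    split; [apply ho, hr|split; [exact d1|split; [exact d4|split]]].
    - apply (unit_speed_bound _ (Derive t r)), hu, hr'.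
    - destruct (unit_speed_derivatives J x t r hJ hx ht hu hr') as [_ ->].
      rewrite kp; [reflexivity|exact hr'|].
      intros q hq; apply ho; revert hq hr; unfold Rmin, Rmax.
      destruct (Rle_dec s0 r), (Rle_dec s0 s); lra. }
  assert (barrier : forall e, inside J e -> sin (x e) = 0 -> e <> s0 ->
            (forall r, Rmin s0 e <= r <= Rmax s0 e -> r <> e -> off_axis x r) -> False).
  { intros e hin hsin hne ho.
    destruct (inside_locally J e hJ hin) as [he hloc].
    destruct (C2 e he) as (d1 & d2 & d3 & d4).
    assert (t0 : Derive t e = 0).
    { apply (axis_horizontal c L H F (l * al) x t e hc hH hHu hF).
      - apply (ex_derive_continuous x), d1.
      - apply (ex_derive_continuous (Derive t)), d4.
      - apply hrange, he.
      - exact hsin.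
      - intros d hd.
        assert (exists r, Rabs (r - e) < d /\ Rmin s0 e <= r <= Rmax s0 e /\ r <> e) as (r & hrd & hr & hre).
        { unfold Rmin, Rmax; destruct (Rle_dec s0 e) as [h|h].
          - assert (m1 := Rmax_l s0 (e - d / 2)); assert (m2 := Rmax_r s0 (e - d / 2)).
            assert (m3 : Rmax s0 (e - d / 2) < e) by (apply Rmax_lub_lt; lra).
            exists (Rmax s0 (e - d / 2)); rewrite Rabs_left by lra; repeat split; lra.
          - assert (m1 := Rmin_l s0 (e + d / 2)); assert (m2 := Rmin_r s0 (e + d / 2)).
            assert (m3 : e < Rmin s0 (e + d / 2)) by (apply Rmin_glb_lt; lra).
            exists (Rmin s0 (e + d / 2)); rewrite Rabs_pos_eq by lra; repeat split; lra. }
        assert (hr' := interval_between J s0 e r hJ hs0 he hr).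
        exists r; split; [exact hrd|split; [apply ho; assumption|split]].
        + apply tF; [exact hr'|]; intros q hq; apply ho.
          * revert hq hr; unfold Rmin, Rmax; destruct (Rle_dec s0 r), (Rle_dec s0 e); lra.
          * intros ->; apply hre; revert hq hr; unfold Rmin, Rmax;
            destruct (Rle_dec s0 r), (Rle_dec s0 e); lra.
        + apply (unit_speed_bound (Derive x r)), hu, hr'. }
    assert (x0 : Derive x e = 0).
    { assert (hd := proj1 (is_derive_Reals x e _) (Derive_correct x e d1)).
      destruct hloc as [d hd'].
      assert (in_J : forall q, e - d < q < e + d -> J q).
      { intros q hq; apply hd'; change (Rabs (q - e) < d); apply Rabs_lt_between; lra. }
      assert (d0 := cond_pos d).
      destruct (Req_dec (x e) 0) as [z|z].
      - apply (deriv_minimum x (e - d) (e + d) e (exist _ _ hd)); [lra|lra|].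
        intros q h1 h2; rewrite z; apply hrange, in_J; lra.
      - assert (xpi : x e = PI).
        { destruct (Req_dec (x e) PI) as [|z']; [assumption|exfalso].
          assert (h := hrange e he).
          pose proof (sin_gt_0 (x e) ltac:(lra) ltac:(lra)); lra. }
        apply (deriv_maximum x (e - d) (e + d) e (exist _ _ hd)); [lra|lra|].
        intros q h1 h2; rewrite xpi; apply hrange, in_J; lra. }
    specialize (hu e he); rewrite t0, x0 in hu; simpl in hu; lra. }
  assert (cs : forall r, J r -> continuous (fun r => sin (x r)) r).
  { intros r hr; apply (ex_derive_continuous (fun r => sin (x r))); auto_derive; apply C2, hr. }
  assert (off_pos : forall r, J r -> 0 < sin (x r) -> off_axis x r).
  { intros r hr h; apply NNPP; intros hn.
    rewrite (not_off_axis x r (hrange r hr) hn) in h; lra. }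
  assert (hin : forall s, inside J s -> off_axis x s).
  { intros s hin; destruct (inside_locally J s hJ hin) as [hs _].
    apply NNPP; intros hn; assert (z := not_off_axis x s (hrange s hs) hn).
    assert (p0 := off_axis_sin x s0 ho0).
    destruct hin as (a & b' & ha & hb & hab).
    destruct (Rle_dec s0 s) as [h|h].
    - destruct (first_zero (fun r => sin (x r)) s0 s h) as (e & he & ez & epos);
        [intros r hr; apply cs, (interval_between J s0 s r hJ hs0 hs);
          rewrite Rmin_left, Rmax_right; lra|exact p0|lra|].
      apply (barrier e); [exists s0, b'; repeat split; [exact hs0|exact hb|lra|lra]|exact ez|lra|].
      intros r hr hre; rewrite Rmin_left, Rmax_right in hr by lra.
      apply off_pos; [|apply epos; lra].
      apply (interval_between J s0 s r hJ hs0 hs); rewrite Rmin_left, Rmax_right; lra.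
    - destruct (last_zero (fun r => sin (x r)) s s0) as (e & he & ez & epos);
        [lra|intros r hr; apply cs, (interval_between J s s0 r hJ hs hs0);
          rewrite Rmin_left, Rmax_right; lra|lra|exact p0|].
      apply (barrier e); [exists a, s0; repeat split; [exact ha|exact hs0|lra|lra]|exact ez|lra|].
      intros r hr hre; rewrite Rmin_right, Rmax_left in hr by lra.
      apply off_pos; [|apply epos; lra].
      apply (interval_between J s s0 r hJ hs hs0); rewrite Rmin_left, Rmax_right; lra. }
  assert (seg : forall s, J s -> off_axis x s ->
            forall r, Rmin s0 s <= r <= Rmax s0 s -> off_axis x r).
  { intros s hs ho r hr.
    destruct (Req_dec r s0) as [->|n1]; [exact ho0|].
    destruct (Req_dec r s) as [->|n2]; [exact ho|].
    apply hin; revert hr; unfold Rmin, Rmax; destruct (Rle_dec s0 s) as [h|h]; intros hr;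
    [exists s0, s|exists s, s0]; repeat split; try assumption; lra. }
  exists c, L, (l * al), H, F; split; [|split; [exact hin|]].
  - split; [exact hc|split; [exact hH|split; [exact hHu|split; [exact hF|]]]].
    intros s hs ho; apply tF; [exact hs|apply seg; assumption].
  - intros s hs ho; rewrite <- (tF s hs (seg s hs ho)); apply kp; [exact hs|apply seg; assumption].
Qed.

(** * Rotationally symmetric graphs *)

Lemma sum_sqr_2d (u v : R) : continuity_2d_pt (fun u v => u ^ 2 + v ^ 2) u v.
Proof.
  assert (sq : forall r, continuity_pt (fun z => z ^ 2) r).
  { intros r; apply continuity_pt_filterlim, (ex_derive_continuous (fun z => z ^ 2)).
    auto_derive; exact I. }
  apply continuity_2d_pt_plus.
  - apply (continuity_1d_2d_pt_comp (fun z => z ^ 2) (fun u _ => u)); [apply sq|].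
    apply continuity_2d_pt_id1.
  - apply (continuity_1d_2d_pt_comp (fun z => z ^ 2) (fun _ v => v)); [apply sq|].
    apply continuity_2d_pt_id2.
Qed.

Lemma disc_locally (c u v : R) :
  u ^ 2 + v ^ 2 < c -> locally_2d (fun u v => u ^ 2 + v ^ 2 < c) u v.
Proof.
  intros h; assert (he : 0 < c - (u ^ 2 + v ^ 2)) by lra.
  destruct (sum_sqr_2d u v (mkposreal _ he)) as [d hd]; exists d; intros a b ha hb.
  specialize (hd a b ha hb); simpl in hd; apply Rabs_lt_between in hd; lra.
Qed.

Definition is_C2_2d (f fu fv fuu fuv fvv : R -> R -> R) (u v : R) : Prop :=
  (is_derive (fun z => f z v) u (fu u v) /\ is_derive (fun z => f u z) v (fv u v)) /\
  (is_derive (fun z => fu z v) u (fuu u v) /\ is_derive (fun z => fu u z) v (fuv u v)) /\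
  (is_derive (fun z => fv z v) u (fuv u v) /\ is_derive (fun z => fv u z) v (fvv u v)) /\
  continuity_2d_pt f u v /\ continuity_2d_pt fu u v /\ continuity_2d_pt fv u v /\
  continuity_2d_pt fuu u v /\ continuity_2d_pt fuv u v /\ continuity_2d_pt fvv u v.

Lemma is_C2_2d_ex_diff (f fu fv fuu fuv fvv : R -> R -> R) (u v : R) :
  locally_2d (is_C2_2d f fu fv fuu fuv fvv) u v -> ex_diff_n f 2 u v.
Proof.
  intros h; destruct (locally_2d_singleton _ _ _ h)
    as ((d1 & d2) & (d3 & d4) & (d5 & d6) & c1 & c2 & c3 & c4 & c5 & c6).
  assert (one : forall f fu fv, 
     locally_2d (fun u v => is_derive (fun z => f z v) u (fu u v) /\ is_derive (fun z => f u z) v (fv u v)) u v ->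
     continuity_2d_pt f u v -> continuity_2d_pt fu u v -> continuity_2d_pt fv u v -> ex_diff_n f 1 u v).
  { clear; intros f fu fv h c c1 c2; simpl.
    destruct (locally_2d_singleton _ _ _ h) as [d1 d2].
    split; [exact c|split; [eexists; exact d1|split; [eexists; exact d2|]]].
    split; (split; [|exact I]).
    - apply (continuity_2d_pt_ext_loc fu); [|exact c1].
      revert h; apply locally_2d_impl, locally_2d_forall; intros a b [h1 _].
      symmetry; apply is_derive_unique, h1.
    - apply (continuity_2d_pt_ext_loc fv); [|exact c2].
      revert h; apply locally_2d_impl, locally_2d_forall; intros a b [_ h2].
      symmetry; apply is_derive_unique, h2. }
  split; [exact c1|split; [eexists; exact d1|split; [eexists; exact d2|split]]].
  - apply (ex_diff_n_ext_loc fu).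
    + revert h; apply locally_2d_impl, locally_2d_forall; intros a b [[h1 _] _].
      symmetry; apply is_derive_unique, h1.
    + apply (one fu fuu fuv); try assumption.
      revert h; apply locally_2d_impl, locally_2d_forall; intros a b (_ & h1 & _); exact h1.
  - apply (ex_diff_n_ext_loc fv).
    + revert h; apply locally_2d_impl, locally_2d_forall; intros a b [[_ h1] _].
      symmetry; apply is_derive_unique, h1.
    + apply (one fv fuv fvv); try assumption.
      revert h; apply locally_2d_impl, locally_2d_forall; intros a b (_ & _ & h1 & _); exact h1.
Qed.

(** The conditions on k, with k' = m and k'' = m2 for z > 0, under which
    k (u^2 + v^2) is C^2 on the disc of squared radius c.  Since its second
    derivatives are combinations of m and of z m2 with bounded coefficients, k
    itself need not be C^2 at z = 0: it suffices that z m2 tends to 0. *)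
Definition radial_C2 (c : R) (k m m2 : R -> R) : Prop :=
  (forall z, z < c -> is_derive k z (m z)) /\
  (forall z, z < c -> continuous m z) /\
  (forall z, 0 < z < c -> is_derive m z (m2 z)) /\
  (forall z, 0 < z < c -> continuous m2 z) /\
  filterlim (fun z => z * m2 z) (at_right 0) (locally 0).

Lemma radial_C2_ex_diff (c : R) (k m m2 : R -> R) (u v : R) :
  radial_C2 c k m m2 -> u ^ 2 + v ^ 2 < c ->
  ex_diff_n (fun u v => k (u ^ 2 + v ^ 2)) 2 u v.
Proof.
  intros (hk & hm & hm2 & cm2 & hlim) huv.
  pose (w := fun z => if Rlt_dec 0 z then m2 z else 0).
  pose (q := fun u v : R => u ^ 2 + v ^ 2).
  assert (q0 : forall u v, 0 <= q u v) by (intros; unfold q; nra).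
  assert (cw : forall P : R -> R -> R, (forall u v, continuity_2d_pt P u v) ->
     (forall u v, Rabs (P u v) <= q u v) ->
     forall u v, q u v < c -> continuity_2d_pt (fun u v => P u v * w (q u v)) u v).
  { clear u v huv; intros P cP hP u v huv.
    destruct (Rle_lt_or_eq_dec 0 (q u v) (q0 u v)) as [h|h].
    - apply continuity_2d_pt_mult; [apply cP|].
      apply (continuity_1d_2d_pt_comp w q); [|apply sum_sqr_2d].
      apply continuity_pt_filterlim.
      apply (continuous_ext_loc w m2); [|apply cm2; lra].
      exists (mkposreal _ h); intros z hz; change (Rabs (z - q u v) < q u v) in hz.
      apply Rabs_lt_between in hz; unfold w; destruct (Rlt_dec 0 z); [reflexivity|lra].
    - assert (P0 : P u v = 0).
      { specialize (hP u v); rewrite <- h in hP; apply Rabs_eq_0; pose proof (Rabs_pos (P u v)); lra. }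
      intros e.
      destruct (proj1 (filterlim_locally _ _) hlim e) as [d hd].
      destruct (sum_sqr_2d u v d) as [d' hd'].
      exists d'; intros a b ha hb; rewrite P0, Rmult_0_l, Rminus_0_r.
      specialize (hd' a b ha hb); fold (q a b) in hd'; fold (q u v) in hd'.
      rewrite <- h, Rminus_0_r in hd'.
      unfold w; destruct (Rlt_dec 0 (q a b)) as [p|p].
      + assert (hd1 := hd (q a b)).
        assert (hb1 : Rabs (q a b * m2 (q a b) - 0) < e).
        { apply hd1; [|exact p]; change (Rabs (q a b - 0) < d); rewrite Rminus_0_r; exact hd'. }
        rewrite Rminus_0_r, Rabs_mult, (Rabs_pos_eq (q a b)) in hb1 by lra.
        rewrite Rabs_mult; specialize (hP a b); pose proof (Rabs_pos (m2 (q a b))); nra.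
      + rewrite Rmult_0_r, Rabs_R0; apply cond_pos. }
  assert (dk : forall u v, q u v < c -> is_derive (fun z => k (q z v)) u (2 * u * m (q u v))).
  { clear u v huv; intros u v huv.
    change (2 * u * m (q u v)) with (scal (2 * u) (m (q u v))).
    apply (is_derive_comp k (fun z => q z v)); [apply hk, huv|].
    unfold q; auto_derive; [exact I|ring]. }
  assert (duu : forall u v, q u v < c ->
     is_derive (fun z => 2 * z * m (q z v)) u (2 * m (q u v) + 4 * (u ^ 2 * w (q u v)))).
  { clear u v huv; intros u v huv.
    destruct (Rle_lt_or_eq_dec 0 (q u v) (q0 u v)) as [h|h].
    - assert (hd := hm2 (q u v) (conj h huv)).
      unfold w; destruct (Rlt_dec 0 (q u v)); [|lra].
      unfold q in *; auto_derive; [eexists; exact hd|].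
      change (u * (u * 1) + v * (v * 1)) with (u ^ 2 + v ^ 2).
      replace (Derive (fun x => m x) (u ^ 2 + v ^ 2)) with (m2 (u ^ 2 + v ^ 2))
        by (symmetry; apply is_derive_unique, hd); ring.
    (* at the centre the difference quotient is 2 m (z^2), without any term in m2 *)
    - assert (u = 0 /\ v = 0) as [-> ->] by (unfold q in h; split; nra).
      replace (2 * m (q 0 0) + 4 * (0 ^ 2 * w (q 0 0))) with (2 * m (q 0 0)) by ring.
      apply is_derive_Reals; intros e he.
      assert (cm : continuity_2d_pt (fun u v => m (q u v)) 0 0).
      { apply (continuity_1d_2d_pt_comp m q); [|apply sum_sqr_2d].
        apply continuity_pt_filterlim, hm, huv. }
      assert (he2 : 0 < e / 2) by lra.
      destruct (cm (mkposreal _ he2)) as [d hd]; exists d; intros z hz hzd.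
      specialize (hd (0 + z) 0); simpl in hd.
      replace (0 + z - 0) with z in hd by ring; rewrite Rminus_0_r, Rabs_R0 in hd.
      specialize (hd hzd (cond_pos d)).
      replace ((2 * (0 + z) * m (q (0 + z) 0) - 2 * 0 * m (q 0 0)) / z - 2 * m (q 0 0))
        with (2 * (m (q (0 + z) 0) - m (q 0 0))) by (field; exact hz).
      rewrite Rabs_mult, (Rabs_pos_eq 2) by lra; lra. }
  assert (duv : forall u v, q u v < c ->
     is_derive (fun z => 2 * u * m (q u z)) v (4 * (u * v * w (q u v)))).
  { clear u v huv; intros u v huv.
    destruct (Rle_lt_or_eq_dec 0 (q u v) (q0 u v)) as [h|h].
    - assert (hd := hm2 (q u v) (conj h huv)).
      unfold w; destruct (Rlt_dec 0 (q u v)); [|lra].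
      unfold q in *; auto_derive; [eexists; exact hd|].
      change (u * (u * 1) + v * (v * 1)) with (u ^ 2 + v ^ 2).
      replace (Derive (fun x => m x) (u ^ 2 + v ^ 2)) with (m2 (u ^ 2 + v ^ 2))
        by (symmetry; apply is_derive_unique, hd); ring.
    - assert (u = 0) as -> by (unfold q in h; nra).
      apply (is_derive_ext (fun _ => 0)); [intros; rewrite Rmult_0_r, Rmult_0_l; reflexivity|].
      replace (4 * (0 * v * w (q 0 v))) with 0 by ring; apply (is_derive_const 0 v). }
  assert (qC : forall a b, q a b = q b a) by (intros; unfold q; ring).
  apply (is_C2_2d_ex_diff (fun u v => k (q u v))
     (fun u v => 2 * u * m (q u v)) (fun u v => 2 * v * m (q u v))
     (fun u v => 2 * m (q u v) + 4 * (u ^ 2 * w (q u v)))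
     (fun u v => 4 * (u * v * w (q u v)))
     (fun u v => 2 * m (q u v) + 4 * (v ^ 2 * w (q u v)))).
  assert (hdisc := disc_locally c u v huv); revert hdisc.
  apply locally_2d_impl, locally_2d_forall; clear u v huv; intros u v huv.
  assert (huv' : q v u < c) by (rewrite qC; exact huv).
  change (q u v < c) in huv.
  assert (cq : forall f : R -> R, (forall z, z < c -> continuous f z) ->
            continuity_2d_pt (fun u v => f (q u v)) u v).
  { intros f hf; apply (continuity_1d_2d_pt_comp f q); [|apply sum_sqr_2d].
    apply continuity_pt_filterlim, hf, huv. }
  assert (cm := cq m hm).
  assert (id1 := fun a b => continuity_2d_pt_id1 a b).
  assert (id2 := fun a b => continuity_2d_pt_id2 a b).
  assert (cst := fun a b r => continuity_2d_pt_const a b r).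
  assert (cu2 : continuity_2d_pt (fun u v => u ^ 2 * w (q u v)) u v).
  { apply (cw (fun u _ => u ^ 2)); [| |exact huv].
    - intros a b; apply (continuity_2d_pt_ext (fun u _ => u * u)); [intros; ring|].
      apply continuity_2d_pt_mult; apply id1.
    - intros a b; rewrite Rabs_pos_eq; unfold q; nra. }
  assert (cv2 : continuity_2d_pt (fun u v => v ^ 2 * w (q u v)) u v).
  { apply (cw (fun _ v => v ^ 2)); [| |exact huv].
    - intros a b; apply (continuity_2d_pt_ext (fun _ v => v * v)); [intros; ring|].
      apply continuity_2d_pt_mult; apply id2.
    - intros a b; rewrite Rabs_pos_eq; unfold q; nra. }
  assert (cuv : continuity_2d_pt (fun u v => u * v * w (q u v)) u v).
  { apply (cw (fun u v => u * v)); [| |exact huv].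
    - intros a b; apply continuity_2d_pt_mult; [apply id1|apply id2].
    - intros a b; apply Rabs_le_between; unfold q; nra. }
  split; [split|split; [split|split; [split|split; [|split; [|split; [|split; [|split]]]]]]].
  - apply dk, huv.
  - apply (is_derive_ext (fun z => k (q z u))); [intros; rewrite qC; reflexivity|].
    rewrite (qC u v); apply dk, huv'.
  - apply duu, huv.
  - apply duv, huv.
  - apply (is_derive_ext (fun z => 2 * v * m (q v z))); [intros; rewrite qC; reflexivity|].
    rewrite (qC u v), (Rmult_comm u v); apply duv, huv'.
  - apply (is_derive_ext (fun z => 2 * z * m (q z u))); [intros; rewrite qC; reflexivity|].
    rewrite (qC u v); apply duu, huv'.
  - apply cq; intros z hz; apply (ex_derive_continuous k); eexists; apply hk, hz.
  - apply continuity_2d_pt_mult; [apply continuity_2d_pt_mult; [apply cst|apply id1]|exact cm].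
  - apply continuity_2d_pt_mult; [apply continuity_2d_pt_mult; [apply cst|apply id2]|exact cm].
  - apply continuity_2d_pt_plus; apply continuity_2d_pt_mult; try apply cst; assumption.
  - apply continuity_2d_pt_mult; [apply cst|exact cuv].
  - apply continuity_2d_pt_plus; apply continuity_2d_pt_mult; try apply cst; assumption.
Qed.

Lemma hemisphere_radial_C2 (c sg : R) : c <= 1 ->
  radial_C2 c (fun z => sg * sqrt (1 - z)) (fun z => - sg / (2 * sqrt (1 - z)))
    (fun z => - sg / (4 * (1 - z) * sqrt (1 - z))).
Proof.
  intros hc.
  assert (p : forall z, z < c -> 0 < sqrt (1 - z) /\ sqrt (1 - z) * sqrt (1 - z) = 1 - z).
  { intros z hz; split; [apply sqrt_lt_R0; lra|apply sqrt_sqrt; lra]. }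
  assert (d2 : forall z, z < c -> is_derive (fun z => - sg / (2 * sqrt (1 - z))) z
            (- sg / (4 * (1 - z) * sqrt (1 - z)))).
  { intros z hz; destruct (p z hz) as [p1 p2].
    auto_derive; [replace (1 + - z) with (1 - z) by ring; repeat split; lra|].
    replace (1 + - z) with (1 - z) by ring; set (q := sqrt (1 - z)) in *.
    rewrite <- p2; field; lra. }
  assert (c2 : forall z, z < c -> continuous (fun z => - sg / (4 * (1 - z) * sqrt (1 - z))) z).
  { intros z hz; destruct (p z hz) as [p1 p2].
    apply (ex_derive_continuous (fun z => - sg / (4 * (1 - z) * sqrt (1 - z)))); auto_derive.
    replace (1 + - z) with (1 - z) by ring; repeat split; [lra|].
    apply Rgt_not_eq; repeat apply Rmult_lt_0_compat; lra. }
  split; [|split; [|split; [|split]]].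
  - intros z hz; destruct (p z hz) as [p1 p2].
    auto_derive; [lra|]; replace (1 + - z) with (1 - z) by ring; field; lra.
  - intros z hz; apply (ex_derive_continuous (fun z => - sg / (2 * sqrt (1 - z)))); eexists; apply d2, hz.
  - intros z hz; apply d2; lra.
  - intros z hz; apply c2; lra.
  - assert (h0 : filterlim (fun z => z * (- sg / (4 * (1 - z) * sqrt (1 - z)))) (locally 0)
        (locally (0 * (- sg / (4 * (1 - 0) * sqrt (1 - 0)))))).
    { apply (continuous_mult (fun z => z) (fun z => - sg / (4 * (1 - z) * sqrt (1 - z)))).
      - apply continuous_id.
      - apply (ex_derive_continuous (fun z => - sg / (4 * (1 - z) * sqrt (1 - z)))); auto_derive.
        replace (1 + - 0) with 1 by ring; rewrite sqrt_1; repeat split; lra. }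
    rewrite Rmult_0_l in h0.
    eapply filterlim_filter_le_1; [|exact h0]; apply filter_le_within.
Qed.

Lemma ex_diff_n_id1 (u v : R) : ex_diff_n (fun u _ => u) 2 u v.
Proof.
  apply (is_C2_2d_ex_diff _ (fun _ _ => 1) (fun _ _ => 0) (fun _ _ => 0) (fun _ _ => 0) (fun _ _ => 0)).
  apply locally_2d_forall; intros a b;
  split; [split|split; [split|split; [split|split; [|split; [|split; [|split; [|split]]]]]]];
  try apply continuity_2d_pt_const; try apply continuity_2d_pt_id1;
  auto_derive; auto.
Qed.

Lemma ex_diff_n_id2 (u v : R) : ex_diff_n (fun _ v => v) 2 u v.
Proof.
  apply (is_C2_2d_ex_diff _ (fun _ _ => 0) (fun _ _ => 1) (fun _ _ => 0) (fun _ _ => 0) (fun _ _ => 0)).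
  apply locally_2d_forall; intros a b;
  split; [split|split; [split|split; [split|split; [|split; [|split; [|split; [|split]]]]]]];
  try apply continuity_2d_pt_const; try apply continuity_2d_pt_id2;
  auto_derive; auto.
Qed.

(** A graph over a disc of the plane of x_1, x_2: the chart is the graph map, and
    its inverse is the projection. *)
Lemma cap_regular (c sg : R) (k m m2 : R -> R) (S : R4 -> Prop) :
  0 < c <= 1 -> radial_C2 c k m m2 ->
  (forall p, S p <-> exists u v, u ^ 2 + v ^ 2 < c /\
     p = (u, v, sg * sqrt (1 - (u ^ 2 + v ^ 2)), k (u ^ 2 + v ^ 2))) ->
  regular_surface_at S (0, 0, sg, k 0).
Proof.
  intros hc hk hS.
  pose (X := fun u v : R => (u, v, sg * sqrt (1 - (u ^ 2 + v ^ 2)), k (u ^ 2 + v ^ 2)) : R4).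
  split.
  { apply hS; exists 0, 0; split; [lra|].
    replace (0 ^ 2 + 0 ^ 2) with 0 by ring; rewrite Rminus_0_r, sqrt_1, Rmult_1_r; reflexivity. }
  exists (fun _ => True), (fun w => fst w ^ 2 + snd w ^ 2 < c), X, (fun p => (co1 p, co2 p)).
  split; [apply open_true|split; [exact I|split; [|split; [|split; [|split]]]]].
  - intros [u v] h; apply (proj1 (locally_2d_locally (fun u v => u ^ 2 + v ^ 2 < c) u v)), disc_locally, h.
  - intros u v h; simpl fst in h; simpl snd in h; split.
    + split; [apply ex_diff_n_id1|split; [apply ex_diff_n_id2|split]].
      * apply (radial_C2_ex_diff c _ _ _ u v (hemisphere_radial_C2 c sg (proj2 hc)) h).
      * apply (radial_C2_ex_diff c _ _ _ u v hk h).
    + intros a b hab.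
      assert (h1 := f_equal co1 hab); assert (h2 := f_equal co2 hab).
      unfold lincomb, du, dv, Derive4, X, co1, co2 in h1, h2; simpl in h1, h2.
      rewrite Derive_id, Derive_const in h1, h2; lra.
  - intros u v h; split; [|split; [exact I|reflexivity]].
    apply hS; exists u, v; split; [exact h|reflexivity].
  - intros p hp _; apply hS in hp; destruct hp as (u & v & h & ->); split; [exact h|reflexivity].
  - intros p _ _; apply filterlim_locally; intros e; exists e.
    intros [[[a b] x] y] hq _; destruct p as [[[a' b'] x'] y'].
    destruct hq as [[[h1 h2] _] _]; split; assumption.
Qed.

(** * Regularity at the rotation axes *)

(** The inverse of z = sin^2 r, where r is the distance to the axis on the sphere
    and z = x_1^2 + x_2^2. *)
Definition asin_sqrt (z : R) : R := asin (sqrt z).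

Lemma sin_lt_iff (a b : R) : 0 <= a <= PI / 2 -> 0 <= b <= PI / 2 -> (sin a < sin b <-> a < b).
Proof.
  intros ha hb; assert (pi := PI_RGT_0); split; intros h.
  - apply Rnot_le_lt; intros h'; assert (sin b <= sin a) by (apply sin_incr_1; lra); lra.
  - apply sin_increasing_1; lra.
Qed.

Lemma asin_sqrt_sin (r : R) : 0 <= r <= PI / 2 -> asin_sqrt (sin r ^ 2) = r.
Proof.
  intros hr; assert (pi := PI_RGT_0); unfold asin_sqrt.
  rewrite sqrt_pow2 by (apply sin_ge_0; lra); apply asin_sin; lra.
Qed.

Lemma asin_sqrt_spec (z : R) : 0 < z < 1 ->
  0 < asin_sqrt z < PI / 2 /\ sin (asin_sqrt z) ^ 2 = z /\
  is_derive asin_sqrt z (/ (2 * sin (asin_sqrt z) * cos (asin_sqrt z))).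
Proof.
  intros hz; assert (pi := PI_RGT_0).
  assert (s0 := sqrt_lt_R0 z (proj1 hz)); assert (ss := sqrt_sqrt z ltac:(lra)).
  assert (s1 : sqrt z < 1) by nra.
  assert (hs := sin_asin (sqrt z) ltac:(lra)); assert (hc := cos_asin (sqrt z) ltac:(lra)).
  assert (hb := asin_bound_lt (sqrt z) ltac:(lra)).
  fold (asin_sqrt z) in hs, hc, hb.
  assert (h0 : 0 < asin_sqrt z).
  { apply Rnot_le_lt; intros h.
    assert (sin (asin_sqrt z) <= sin 0) by (apply sin_incr_1; lra).
    rewrite sin_0 in *; lra. }
  split; [lra|split; [rewrite hs; lra|]].
  assert (hd : is_derive asin (sqrt z) (1 / sqrt (1 - (sqrt z)²))).
  { apply is_derive_Reals.
    apply (derive_pt_eq_1 asin (sqrt z) _ (derivable_pt_asin (sqrt z) ltac:(lra))).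
    apply derive_pt_asin. }
  assert (c0 : 0 < cos (asin_sqrt z)) by (apply cos_gt_0; lra).
  rewrite hs; rewrite hc in *; unfold Rsqr in *.
  replace (/ (2 * sqrt z * sqrt (1 - sqrt z * sqrt z)))
    with (scal (/ (2 * sqrt z)) (1 / sqrt (1 - sqrt z * sqrt z))).
  2:{ unfold scal; simpl; unfold mult; simpl; field; split; lra. }
  apply (is_derive_comp asin sqrt z); [exact hd|].
  apply is_derive_Reals, derivable_pt_lim_sqrt; lra.
Qed.

Lemma asin_sqrt_lt (z b : R) : 0 < z < 1 -> 0 <= b <= PI / 2 ->
  (z < sin b ^ 2 <-> asin_sqrt z < b).
Proof.
  intros hz hb; destruct (asin_sqrt_spec z hz) as (h1 & h2 & _); assert (pi := PI_RGT_0).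
  assert (s1 := sin_gt_0 (asin_sqrt z) ltac:(lra) ltac:(lra)).
  assert (s2 := sin_ge_0 b ltac:(lra) ltac:(lra)).
  rewrite <- h2 at 1; rewrite <- (sin_lt_iff (asin_sqrt z) b) by lra; split; intros h; nra.
Qed.

Lemma asin_sqrt_at_right : filterlim asin_sqrt (at_right 0) (at_right 0).
Proof.
  intros P [e he]; assert (pi := PI_RGT_0).
  pose (b := Rmin e (PI / 4)).
  assert (hb : 0 < b) by (apply Rmin_pos; [apply cond_pos|lra]).
  assert (hb1 : b <= e) by apply Rmin_l; assert (hb2 : b <= PI / 4) by apply Rmin_r.
  destruct (near_axis_trig b (conj hb hb2)) as (sb & cb & _).
  assert (hd : 0 < sin b ^ 2) by nra.
  exists (mkposreal _ hd); intros z hz z0; change (Rabs (z - 0) < sin b ^ 2) in hz.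
  rewrite Rminus_0_r, Rabs_pos_eq in hz by lra.
  assert (sin b ^ 2 < 1) by (rewrite sin2_cos2_pow; nra).
  destruct (asin_sqrt_spec z ltac:(lra)) as (h1 & h2 & _).
  apply asin_sqrt_lt in hz; [|lra|lra].
  apply he; [|lra]; change (Rabs (asin_sqrt z - 0) < e); rewrite Rminus_0_r, Rabs_pos_eq; lra.
Qed.

Lemma at_right_bound (f : R -> R) (l C b : R) : 0 < b ->
  (forall r, 0 < r <= b -> Rabs (f r - l) <= C * r) ->
  filterlim f (at_right 0) (locally l).
Proof.
  intros hb h.
  assert (C0 : 0 <= C).
  { specialize (h b ltac:(lra)); pose proof (Rabs_pos (f b - l)); nra. }
  apply filterlim_locally; intros e.
  assert (hd : 0 < Rmin b (e / (C + 1))) by (apply Rmin_pos; [exact hb|apply Rdiv_lt_0_compat; [apply cond_pos|lra]]).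
  exists (mkposreal _ hd); intros r hr r0; change (Rabs (r - 0) < Rmin b (e / (C + 1))) in hr.
  rewrite Rminus_0_r, Rabs_pos_eq in hr by lra.
  assert (r < b) by (eapply Rlt_le_trans; [exact hr|apply Rmin_l]).
  assert (hr2 : r < e / (C + 1)) by (eapply Rlt_le_trans; [exact hr|apply Rmin_r]).
  apply Rlt_div_r in hr2; [|lra].
  change (Rabs (f r - l) < e); eapply Rle_lt_trans; [apply h; lra|nra].
Qed.

Lemma lim_comp_continuous {T : Type} (E : (T -> Prop) -> Prop) {FF : Filter E}
    (f : T -> R) (g : R -> R) (a : R) :
  continuous g a -> filterlim f E (locally a) -> filterlim (fun z => g (f z)) E (locally (g a)).
Proof. intros hg hf; eapply filterlim_comp; [exact hf|exact hg]. Qed.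

Lemma lim_inv {T : Type} (E : (T -> Prop) -> Prop) {FF : Filter E} (f : T -> R) (a : R) :
  a <> 0 -> filterlim f E (locally a) -> filterlim (fun z => / f z) E (locally (/ a)).
Proof.
  intros ha; apply (lim_comp_continuous E f Rinv).
  apply (ex_derive_continuous Rinv); auto_derive; exact ha.
Qed.

Lemma lim_opp {T : Type} (E : (T -> Prop) -> Prop) {FF : Filter E} (f : T -> R) (a : R) :
  filterlim f E (locally a) -> filterlim (fun z => - f z) E (locally (- a)).
Proof.
  apply (lim_comp_continuous E f Ropp).
  apply (ex_derive_continuous Ropp); auto_derive; exact I.
Qed.

Lemma lim_pow {T : Type} (E : (T -> Prop) -> Prop) {FF : Filter E} (f : T -> R) (a : R) (n : nat) :
  filterlim f E (locally a) -> filterlim (fun z => f z ^ n) E (locally (a ^ n)).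
Proof.
  apply (lim_comp_continuous E f (fun z => z ^ n)).
  apply (ex_derive_continuous (fun z => z ^ n)); auto_derive; exact I.
Qed.

Lemma continuous_sqrt_pos (a : R) : 0 < a -> continuous sqrt a.
Proof. intros ha; apply (ex_derive_continuous sqrt); auto_derive; exact ha. Qed.

Ltac lim_algebra FF :=
  unfold Rdiv, Rminus;
  repeat first
    [ assumption
    | apply filterlim_const
    | apply lim_plus; [exact FF| |]
    | apply lim_mult; [exact FF| |]
    | apply lim_inv; [exact FF| |]
    | apply lim_opp; [exact FF|]
    | apply lim_pow; [exact FF|] ].

(** Where |F| < 1 the profile is a graph over r with slope
    dt/dr = F / sqrt (1 - F^2) up to the sign sg.  In the variable z = sin^2 r the slope is
    M (r) = F / (2 sin r cos r sqrt (1 - F^2)), and z dM/dz = Q (r), up to the same sign.  When r tends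
    to 0, F tends to 0 and F cot r tends to u, so M tends to u / 2, while Q tends to
    (H u - u) / 4, which vanishes as u is the fixed point of H: this is the
    condition for regularity at the centre. *)
Lemma cap_profile (H F : R -> R) (u r0 sg t0 : R) :
  (forall k, continuous H k) -> H u = u -> profile_equation H F -> 0 < r0 <= PI / 4 ->
  (forall r, 0 < r <= PI / 4 -> Rabs (F r) <= 6 * Rabs u * r /\ Rabs (F r * cot r - u) <= Rabs u * r) ->
  (forall r, 0 < r <= r0 -> Rabs (F r) < 1) ->
  exists k m m2, radial_C2 (sin r0 ^ 2) k m m2 /\ k 0 = t0 /\
    forall r, 0 < r < r0 ->
      m (sin r ^ 2) * (2 * sin r * cos r) = sg * (F r / sqrt (1 - F r ^ 2)).
Proof.
  intros cH hu hF hr0 hbd hF1; assert (pi := PI_RGT_0).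
  pose (rt := fun r => sqrt (1 - F r ^ 2)).
  pose (M := fun r => sg * (F r * cot r / (2 * rt r * cos r ^ 2))).
  pose (Q := fun r => sg * ((H (F r * cot r) / (rt r * cos r)
       + F r ^ 2 * H (F r * cot r) / (rt r ^ 3 * cos r)
       - F r * cot r * (cos r ^ 2 - sin r ^ 2) / (rt r * cos r ^ 3)) / (4 * cos r))).
  assert (rtp : forall r, 0 < r <= r0 -> 0 < rt r /\ rt r ^ 2 = 1 - F r ^ 2 /\ F r ^ 2 < 1).
  { intros r hr; specialize (hF1 r hr); apply Rabs_lt_between in hF1.
    unfold rt; split; [apply sqrt_lt_R0; nra|split; [|nra]].
    apply pow2_sqrt; nra. }
  assert (trig : forall r, 0 < r <= r0 -> 0 < sin r /\ 0 < cos r).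
  { intros r hr; destruct (near_axis_trig r ltac:(lra)) as (s & co & _); lra. }
  assert (lims : forall (E : (R -> Prop) -> Prop) (FF : Filter E) (f k s co : R),
     filterlim F E (locally f) -> filterlim (fun r => F r * cot r) E (locally k) ->
     filterlim sin E (locally s) -> filterlim cos E (locally co) ->
     f ^ 2 < 1 -> 0 < co ->
     let R := sqrt (1 - f ^ 2) in
     filterlim M E (locally (sg * (k / (2 * R * co ^ 2)))) /\
     filterlim Q E (locally (sg * ((H k / (R * co) + f ^ 2 * H k / (R ^ 3 * co)
        - k * (co ^ 2 - s ^ 2) / (R * co ^ 3)) / (4 * co))))).
  { intros E FF f k s co hf hk hs hco f1 co0 R.
    assert (R0 : 0 < R) by (apply sqrt_lt_R0; lra).
    assert (p : forall n, 0 < R ^ n /\ 0 < co ^ n) by (intros; split; apply pow_lt; assumption).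
    assert (hR : filterlim rt E (locally R)).
    { unfold rt, R; apply (lim_comp_continuous E (fun r => 1 - F r ^ 2) sqrt).
      - apply continuous_sqrt_pos; lra.
      - lim_algebra FF. }
    assert (hHk : filterlim (fun r => H (F r * cot r)) E (locally (H k)))
      by (apply (lim_comp_continuous E (fun r => F r * cot r) H); [apply cH|exact hk]).
    destruct (p 2%nat), (p 3%nat).
    unfold M, Q; split; lim_algebra FF;
      apply Rgt_not_eq; repeat apply Rmult_lt_0_compat; (assumption || lra). }
  assert (dM : forall r, 0 < r <= r0 -> is_derive M r (Q r * (2 * cos r) / sin r)).
  { intros r hr; destruct (rtp r hr) as (p1 & p2 & p3), (trig r hr) as [s c].
    assert (hd := hF r ltac:(lra)).
    unfold M, rt, cot; auto_derive.
    - replace (1 + - (F r * (F r * 1))) with (1 - F r ^ 2) by ring.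
      change (sqrt (1 - F r ^ 2)) with (rt r).
      repeat split; try (eexists; exact hd); try lra.
      apply Rgt_not_eq; repeat apply Rmult_lt_0_compat; lra.
    - replace (1 + - (F r * (F r * 1))) with (1 - F r ^ 2) by ring.
      change (sqrt (1 - F r ^ 2)) with (rt r).
      replace (Derive (fun x => F x) r) with (H (F r * cot r))
        by (symmetry; apply is_derive_unique, hd).
      unfold Q; set (A := H (F r * cot r)); set (R := rt r) in *; unfold cot.
      field; repeat split; lra. }
  assert (small : forall z, 0 < z < sin r0 ^ 2 -> 0 < z < 1 /\ 0 < asin_sqrt z < r0).
  { intros z hz.
    assert (sin r0 ^ 2 < 1).
    { rewrite sin2_cos2_pow; destruct (trig r0 ltac:(lra)); nra. }
    split; [lra|]; destruct (asin_sqrt_spec z ltac:(lra)) as (h1 & _).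
    split; [lra|apply asin_sqrt_lt; lra]. }
  assert (s00 : 0 < sin r0 ^ 2) by (destruct (trig r0 ltac:(lra)); nra).
  (* at the axis F = 0 and F cot = u; the two terms of Q that remain cancel *)
  assert (right : filterlim M (at_right 0) (locally (sg * (u / 2))) /\
                  filterlim Q (at_right 0) (locally 0)).
  { assert (id0 : filterlim (fun r : R => r) (at_right 0) (locally 0))
      by (apply filter_le_within).
    destruct (lims (at_right 0) _ 0 u 0 1) as [h1 h2].
    - apply (at_right_bound F 0 (6 * Rabs u) (PI / 4)); [lra|].
      intros r hr; rewrite Rminus_0_r; apply hbd, hr.
    - apply (at_right_bound _ u (Rabs u) (PI / 4)); [lra|].
      intros r hr; apply hbd, hr.
    - rewrite <- sin_0 at 2; apply (lim_comp_continuous (at_right 0) (fun r => r) sin); [|exact id0].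
      apply (ex_derive_continuous sin); auto_derive; exact I.
    - rewrite <- cos_0; apply (lim_comp_continuous (at_right 0) (fun r => r) cos); [|exact id0].
      apply (ex_derive_continuous cos); auto_derive; exact I.
    - lra.
    - lra.
    - replace (1 - 0 ^ 2) with 1 in h1, h2 by ring; rewrite sqrt_1 in h1, h2; rewrite hu in h2.
      split.
      + replace (u / 2) with (u / (2 * 1 * 1 ^ 2)) by field; exact h1.
      + replace 0 with (sg * ((u / (1 * 1) + 0 ^ 2 * u / (1 ^ 3 * 1)
          - u * (1 ^ 2 - 0 ^ 2) / (1 * 1 ^ 3)) / (4 * 1))) at 2 by field; exact h2. }
  destruct right as [MR QR].
  pose (m := fun z => if Rlt_dec 0 z then M (asin_sqrt z) else sg * (u / 2)).
  pose (m2 := fun z => Q (asin_sqrt z) / z).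
  assert (mpos : forall z, 0 < z -> m z = M (asin_sqrt z)).
  { intros z hz; unfold m; destruct (Rlt_dec 0 z); [reflexivity|lra]. }
  assert (dm : forall z, 0 < z < sin r0 ^ 2 -> is_derive m z (m2 z)).
  { intros z hz; destruct (small z hz) as [z1 hr].
    destruct (asin_sqrt_spec z z1) as (_ & h2 & h3).
    destruct (trig (asin_sqrt z) ltac:(lra)) as [s c].
    apply (is_derive_ext_loc (fun z => M (asin_sqrt z))).
    - exists (mkposreal z (proj1 hz)); intros y hy; change (Rabs (y - z) < z) in hy.
      apply Rabs_lt_between in hy; symmetry; apply mpos; lra.
    - replace (m2 z) with (scal (/ (2 * sin (asin_sqrt z) * cos (asin_sqrt z)))
          (Q (asin_sqrt z) * (2 * cos (asin_sqrt z)) / sin (asin_sqrt z))).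
      + apply (is_derive_comp M asin_sqrt z); [apply dM; lra|exact h3].
      + transitivity (Q (asin_sqrt z) / sin (asin_sqrt z) ^ 2); [|unfold m2; rewrite h2; reflexivity].
        unfold scal; simpl; unfold mult; simpl; field; lra. }
  assert (cm : forall z, z < sin r0 ^ 2 -> continuous m z).
  { intros z hz; destruct (Rtotal_order z 0) as [h|[->|h]].
    - apply (continuous_ext_loc m (fun _ => sg * (u / 2))); [|apply continuous_const].
      assert (h' : 0 < - z) by lra.
      exists (mkposreal _ h'); intros y hy; change (Rabs (y - z) < - z) in hy.
      apply Rabs_lt_between in hy; unfold m; destruct (Rlt_dec 0 y); [lra|reflexivity].
    - assert (m0 : m 0 = sg * (u / 2)) by (unfold m; destruct (Rlt_dec 0 0); [lra|reflexivity]).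
      apply (proj2 (filterlim_locally m (m 0))); intros e; rewrite m0.
      assert (hc := filterlim_comp _ _ _ asin_sqrt M _ _ _ asin_sqrt_at_right MR).
      destruct (proj1 (filterlim_locally _ _) hc e) as [d hd].
      exists d; intros y hy; unfold m; destruct (Rlt_dec 0 y); [apply hd; assumption|apply ball_center].
    - apply (ex_derive_continuous m); eexists; apply dm; lra. }
  exists (fun z => t0 + RInt m 0 z), m, m2; split; [split; [|split; [|split; [|split]]]|split].
  - intros z hz.
    replace (m z) with (0 + m z) by ring.
    apply (is_derive_plus (fun _ => t0) (fun z => RInt m 0 z)); [apply (is_derive_const t0 z)|].
    apply (is_derive_RInt m (RInt m 0) 0 z); [|apply cm, hz].
    assert (he : 0 < sin r0 ^ 2 - z) by lra.
    exists (mkposreal _ he); intros y hy; change (Rabs (y - z) < sin r0 ^ 2 - z) in hy.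
    apply Rabs_lt_between in hy; apply (RInt_correct m 0 y), ex_RInt_continuous.
    intros w hw; apply cm; eapply Rle_lt_trans; [apply hw|apply Rmax_lub_lt; lra].
  - exact cm.
  - exact dm.
  - intros z hz; destruct (small z hz) as [z1 hr].
    destruct (asin_sqrt_spec z z1) as (_ & _ & h3).
    apply (continuous_mult (fun z => Q (asin_sqrt z)) (fun z => / z)).
    + apply (continuous_comp asin_sqrt Q).
      * apply (ex_derive_continuous asin_sqrt); eexists; exact h3.
      * destruct (profile_curvature_continuous H F (asin_sqrt z) hF ltac:(lra)) as [cF ck].
        destruct (trig (asin_sqrt z) ltac:(lra)) as [s c].
        destruct (rtp (asin_sqrt z) ltac:(lra)) as (_ & _ & p3).
        apply (lims (locally (asin_sqrt z)) _ _ _ _ _ cF ck); [| |exact p3|exact c].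
        -- apply (ex_derive_continuous sin); auto_derive; exact I.
        -- apply (ex_derive_continuous cos); auto_derive; exact I.
    + apply (ex_derive_continuous Rinv); auto_derive; lra.
  - assert (hc := filterlim_comp _ _ _ asin_sqrt Q _ _ _ asin_sqrt_at_right QR).
    eapply filterlim_ext_loc; [|exact hc].
    exists (mkposreal 1 Rlt_0_1); intros z _ hz; unfold m2; field; lra.
  - rewrite RInt_point; apply Rplus_0_r.
  - intros r hr; destruct (trig r ltac:(lra)) as [s c]; destruct (rtp r ltac:(lra)) as (p1 & _).
    rewrite mpos by nra; rewrite asin_sqrt_sin by lra.
    unfold M; change (sqrt (1 - F r ^ 2)) with (rt r); unfold cot; field; lra.
Qed.

Lemma polar (u v : R) :
  exists th, u = sqrt (u ^ 2 + v ^ 2) * cos th /\ v = sqrt (u ^ 2 + v ^ 2) * sin th.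
Proof.
  assert (hn : 0 <= u ^ 2 + v ^ 2) by nra.
  set (p := sqrt (u ^ 2 + v ^ 2)); assert (p0 : 0 <= p) by apply sqrt_pos.
  assert (pp : p ^ 2 = u ^ 2 + v ^ 2) by (apply pow2_sqrt, hn).
  clearbody p; destruct p0 as [p0|<-].
  2:{ exists 0; rewrite !Rmult_0_l; split; nra. }
  assert (b : -1 <= u / p <= 1).
  { split; [apply Rle_div_r|apply Rle_div_l]; nra. }
  assert (c : cos (acos (u / p)) = u / p) by (apply cos_acos, b).
  assert (s := sin_acos (u / p) b).
  assert (s' : p * sin (acos (u / p)) = Rabs v).
  { rewrite s, <- (sqrt_pow2 p) at 1 by lra; rewrite <- sqrt_mult_alt by nra.
    rewrite <- sqrt_Rsqr_abs; f_equal; unfold Rsqr.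
    transitivity (p ^ 2 - u ^ 2); [field; lra|lra]. }
  destruct (Rle_dec 0 v) as [h|h].
  - exists (acos (u / p)); rewrite c, s', Rabs_pos_eq by exact h; split; [field; lra|reflexivity].
  - exists (- acos (u / p)); rewrite cos_neg, sin_neg, c.
    replace (p * - sin (acos (u / p))) with (- (p * sin (acos (u / p)))) by ring.
    rewrite s', Rabs_left by lra; split; [field; lra|ring].
Qed.

Lemma interval_one_sided (J : R -> Prop) (s : R) :
  interval J -> J s -> ~ inside J s ->
  exists sg d, sg ^ 2 = 1 /\ 0 < d /\ (forall tau, 0 <= tau <= d -> J (s + sg * tau)) /\
    (forall r, J r -> 0 <= sg * (r - s)).
Proof.
  intros hJ hs hn.
  destruct (interval_dense_in_itself J s hJ hs 1 Rlt_0_1) as (q & hq & hqs & _).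
  destruct (Rle_dec s q) as [h|h].
  - exists 1, (q - s); split; [ring|split; [lra|split]].
    + intros tau ht; apply (proj1 hJ s q); [exact hs|exact hq|lra].
    + intros r hr; apply Rnot_lt_le; intros hlt; apply hn; exists r, q; repeat split; try assumption; lra.
  - exists (-1), (s - q); split; [ring|split; [lra|split]].
    + intros tau ht; apply (proj1 hJ q s); [exact hq|exact hs|lra].
    + intros r hr; apply Rnot_lt_le; intros hlt; apply hn; exists q, r; repeat split; try assumption; lra.
Qed.

(** A point of the axis x = 0 is an endpoint of J.  In terms of the distance tau
    to it, y = x (s + sd tau) is increasing with slope at least 1/2 near 0, so the
    parallels of the patch fill a disc exactly once; t and the function k of
    [cap_profile] have the same derivative and the same value at the axis, so
    the patch is the graph of k.  The sign sg in the third coordinate allows the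
    same statement to serve for the axis x = pi after reflection. *)
Lemma axis_cap (c L u : R) (H F : R -> R) (J : R -> Prop) (x t : R -> R) (sg s : R) :
  interval J -> Ck_on 2 J x -> Ck_on 2 J t ->
  (forall r, J r -> 0 <= x r <= PI) ->
  (forall r, J r -> Derive x r ^ 2 + Derive t r ^ 2 = 1) ->
  (forall r, inside J r -> off_axis x r) ->
  solves_profile c L u H F J x t ->
  J s -> x s = 0 ->
  exists d, 0 < d /\ forall S : R4 -> Prop,
    (forall p, S p <-> exists r th, J r /\ Rabs (r - s) < d /\
       p = (sin (x r) * cos th, sin (x r) * sin th, sg * cos (x r), t r)) ->
    regular_surface_at S (0, 0, sg, t s).
Proof.
  intros hJ hx ht hrange hu hin (hc & hH & hHu & hF & htF) hs hxs.
  assert (pi := PI_RGT_0).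
  assert (C2 : forall r, J r -> ex_derive x r /\ ex_derive (Derive x) r /\
                 ex_derive t r /\ ex_derive (Derive t) r).
  { intros r hr.
    destruct (locally_singleton _ _ (proj1 (Ck_on_2 J x) hx r hr)) as (d1 & d2 & _).
    destruct (locally_singleton _ _ (proj1 (Ck_on_2 J t) ht r hr)) as (d3 & d4 & _); auto. }
  destruct (interval_one_sided J s hJ hs) as (sd & d0 & hsd & hd0 & hJd & hside).
  { intros h; specialize (hin s h); destruct hin; lra. }
  assert (sd1 : Rabs sd = 1) by (unfold Rabs; destruct (Rcase_abs sd); nra).
  assert (dist : forall tau, 0 <= tau -> Rabs (s + sd * tau - s) = tau).
  { intros tau h; replace (s + sd * tau - s) with (sd * tau) by ring.
    rewrite Rabs_mult, sd1, Rabs_pos_eq by exact h; ring. }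
  assert (off : forall tau, 0 < tau < d0 -> off_axis x (s + sd * tau)).
  { intros tau h; apply hin; assert (hq := hJd d0 ltac:(lra)).
    destruct (Rle_dec 0 sd); [exists s, (s + sd * d0)|exists (s + sd * d0), s];
    repeat split; try assumption; nra. }
  assert (t0 : Derive t s = 0).
  { apply (axis_horizontal c L H F u x t s hc hH hHu hF).
    - apply (ex_derive_continuous x), C2, hs.
    - apply (ex_derive_continuous (Derive t)), C2, hs.
    - apply hrange, hs.
    - rewrite hxs; apply sin_0.
    - intros d hd; assert (m1 := Rmin_l d d0); assert (m2 := Rmin_r d d0).
      assert (m3 := Rmin_pos _ _ hd hd0).
      assert (hr := hJd (Rmin d d0 / 2) ltac:(lra)); assert (ho := off (Rmin d d0 / 2) ltac:(lra)).
      exists (s + sd * (Rmin d d0 / 2)); rewrite dist by lra.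
      split; [lra|split; [exact ho|split; [apply htF; assumption|]]].
      apply (unit_speed_bound (Derive x (s + sd * (Rmin d d0 / 2)))), hu, hr. }
  pose (y := fun tau => x (s + sd * tau)).
  assert (dy : forall tau, 0 <= tau <= d0 -> is_derive y tau (sd * Derive x (s + sd * tau))).
  { intros tau h; destruct (C2 _ (hJd tau h)) as (d1 & _).
    apply (is_derive_comp x (fun tau => s + sd * tau)); [apply Derive_correct, d1|].
    auto_derive; [exact I|ring]. }
  assert (y0 : y 0 = 0) by (unfold y; rewrite Rmult_0_r, Rplus_0_r; exact hxs).
  (* |x'| = 1 at the axis, and the sign is that of a function leaving its
     minimum 0; 1/2 could be any number below 1 *)
  assert (slope : exists d1, 0 < d1 <= d0 /\ forall tau, 0 <= tau <= d1 ->
            / 2 <= sd * Derive x (s + sd * tau)).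
  { destruct (C2 s hs) as (_ & hd2 & _).
    assert (he : 0 < / 2) by lra.
    destruct (proj1 (filterlim_locally _ _) (ex_derive_continuous (Derive x) s hd2) (mkposreal _ he)) as [d hd].
    assert (m3 : 0 < Rmin (d / 2) d0) by (apply Rmin_pos; [apply is_pos_div_2|exact hd0]).
    assert (m1 := Rmin_l (d / 2) d0); assert (m2 := Rmin_r (d / 2) d0); assert (dp := cond_pos d).
    assert (near : forall tau, 0 <= tau <= Rmin (d / 2) d0 ->
              Rabs (sd * Derive x (s + sd * tau) - sd * Derive x s) < / 2).
    { intros tau h; rewrite <- Rmult_minus_distr_l, Rabs_mult, sd1, Rmult_1_l.
      apply hd; change (Rabs (s + sd * tau - s) < d); rewrite dist; lra. }
    assert (sq : (sd * Derive x s) ^ 2 = 1).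
    { specialize (hu s hs); rewrite t0 in hu; rewrite Rpow_mult_distr, hsd; lra. }
    assert (one : sd * Derive x s = 1).
    { destruct (Rmult_integral (sd * Derive x s - 1) (sd * Derive x s + 1)) as [z|z]; [nra|lra|exfalso].
      assert (w : - y 0 - / 2 * 0 <= - y (Rmin (d / 2) d0) - / 2 * Rmin (d / 2) d0).
      { apply (derive_nonneg_incr (fun tau => - y tau - / 2 * tau)
           (fun tau => - (sd * Derive x (s + sd * tau)) - / 2)); [lra| |].
        - intros tau h; apply (is_derive_minus (fun tau => - y tau) (fun tau => / 2 * tau)).
          + apply (is_derive_opp y), dy; lra.
          + auto_derive; [exact I|ring].
        - intros tau h; specialize (near tau ltac:(lra)); apply Rabs_lt_between in near; lra. }
      rewrite y0 in w.
      assert (0 <= y (Rmin (d / 2) d0)) by (apply hrange, hJd; lra). lra. }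
    exists (Rmin (d / 2) d0); split; [lra|]; intros tau h.
    specialize (near tau h); rewrite one in near; apply Rabs_lt_between in near; lra. }
  destruct slope as (d1 & hd1 & slope).
  pose (d := Rmin (d1 / 2) (PI / 4)).
  assert (hd : 0 < d /\ d <= PI / 4 /\ d <= d1 / 2).
  { unfold d; split; [apply Rmin_pos; lra|split; [apply Rmin_r|apply Rmin_l]]. }
  assert (mono : forall a b, 0 <= a <= b -> b <= d -> / 2 * (b - a) <= y b - y a).
  { intros a b hab hbd.
    enough (y a - / 2 * a <= y b - / 2 * b) by lra.
    apply (derive_nonneg_incr (fun tau => y tau - / 2 * tau)
       (fun tau => sd * Derive x (s + sd * tau) - / 2)); [lra| |].
    - intros tau h; apply (is_derive_minus y (fun tau => / 2 * tau)); [apply dy; lra|].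
      auto_derive; [exact I|ring].
    - intros tau h; specialize (slope tau ltac:(lra)); lra. }
  pose (r0 := y d).
  assert (hr0 : 0 < r0 <= PI / 4).
  { split; [specialize (mono 0 d ltac:(lra) ltac:(lra)); unfold r0; lra|].
    enough (0 - y 0 <= d - y d) by (unfold r0; lra).
    apply (derive_nonneg_incr (fun tau => tau - y tau)
       (fun tau => 1 - sd * Derive x (s + sd * tau))); [lra| |].
    - intros tau h; apply (is_derive_minus (fun tau : R => tau) y); [apply (is_derive_id tau)|apply dy; lra].
    - intros tau h; specialize (hu _ (hJd tau ltac:(lra))).
      assert (p := slope tau ltac:(lra)); nra. }
  assert (onto : forall r, 0 <= r <= r0 -> exists tau, 0 <= tau <= d /\ y tau = r).
  { intros r [[hr|<-] hr']; [|exists 0; split; [lra|exact y0]].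
    destruct (first_zero (fun tau => r - y tau) 0 d) as (z & hz & ez & _); [lra| |lra|unfold r0 in *; lra|].
    - intros tau h; apply (continuous_minus (fun _ => r) y); [apply continuous_const|].
      apply (ex_derive_continuous y); eexists; apply dy; lra.
    - exists z; split; lra. }
  assert (tF : forall tau, 0 < tau <= d -> Derive t (s + sd * tau) = F (y tau) /\
            0 < sqrt (1 - F (y tau) ^ 2) /\ F (y tau) ^ 2 < 1 /\
            sd * Derive x (s + sd * tau) = sqrt (1 - F (y tau) ^ 2)).
  { intros tau h; assert (hj := hJd tau ltac:(lra)).
    assert (e := htF _ hj (off tau ltac:(lra))); fold (y tau) in e.
    specialize (hu _ hj); assert (p := slope tau ltac:(lra)).
    assert (e2 : (sd * Derive x (s + sd * tau)) ^ 2 = 1 - F (y tau) ^ 2)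
      by (rewrite Rpow_mult_distr, hsd, <- e; lra).
    assert (e3 : F (y tau) ^ 2 < 1) by nra.
    split; [exact e|split; [apply sqrt_lt_R0; lra|split; [exact e3|]]].
    rewrite <- e2; symmetry; apply sqrt_pow2; lra. }
  assert (F1 : forall r, 0 < r <= r0 -> Rabs (F r) < 1).
  { intros r hr; destruct (onto r ltac:(lra)) as (tau & h & <-).
    assert (tau <> 0) by (intros ->; lra).
    destruct (tF tau ltac:(lra)) as (_ & _ & h2 & _); apply Rabs_lt_between; nra. }
  assert (hbd : forall r, 0 < r <= PI / 4 ->
            Rabs (F r) <= 6 * Rabs u * r /\ Rabs (F r * cot r - u) <= Rabs u * r).
  { apply axis_curvature.
    destruct (axis_alternative c L H F u hc hH hHu hF) as [h|(e & he & h)]; [exact h|exfalso].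
    assert (m1 := Rmin_l e r0); assert (m2 := Rmin_r e r0); assert (m3 := Rmin_pos e r0 he (proj1 hr0)).
    specialize (h (Rmin e r0 / 2) ltac:(lra)); specialize (F1 (Rmin e r0 / 2) ltac:(lra)); lra. }
  destruct (cap_profile H F u r0 sd (t s) (decreasing_continuous c L H hc hH) hHu hF hr0 hbd F1)
    as (k & m & m2 & hk & k0 & hm).
  assert (ybd : forall tau, 0 <= tau < d -> 0 <= y tau < r0 /\ sin (y tau) ^ 2 < sin r0 ^ 2).
  { intros tau h; assert (h1 := mono 0 tau ltac:(lra) ltac:(lra)).
    assert (h2 := mono tau d ltac:(lra) ltac:(lra)); fold r0 in h2.
    assert (h3 : 0 <= y tau < r0) by lra.
    split; [exact h3|].
    assert (s1 := sin_ge_0 (y tau) ltac:(lra) ltac:(lra)).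
    assert (s2 := proj2 (sin_lt_iff (y tau) r0 ltac:(lra) ltac:(lra)) (proj2 h3)); nra. }
  assert (hkt : forall tau, 0 <= tau < d -> t (s + sd * tau) = k (sin (y tau) ^ 2)).
  { intros tau1 h1; apply Rminus_diag_uniq.
    apply (gronwall_zero (fun tau => t (s + sd * tau) - k (sin (y tau) ^ 2)) (fun _ => 0) 0 0 tau1).
    - intros tau h; rewrite Rmin_left, Rmax_right in h by lra.
      split; [|rewrite Rabs_R0; lra].
      assert (hj := hJd tau ltac:(lra)); destruct (C2 _ hj) as (_ & _ & dt & _).
      destruct (ybd tau ltac:(lra)) as [hy1 hy2].
      assert (e : m (sin (y tau) ^ 2) * (2 * sin (y tau) * cos (y tau)) * (sd * Derive x (s + sd * tau))
                  = sd * Derive t (s + sd * tau)).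
      { destruct (proj1 h) as [hp|<-].
        - destruct (tF tau ltac:(lra)) as (e1 & e2 & _ & e3).
          assert (mono0 := mono 0 tau ltac:(lra) ltac:(lra)).
          rewrite hm by lra; rewrite e3, e1; field; lra.
        - rewrite Rmult_0_r, Rplus_0_r, t0, y0, sin_0; ring. }
      replace 0 with (sd * Derive t (s + sd * tau) -
        (m (sin (y tau) ^ 2) * (2 * sin (y tau) * cos (y tau)) * (sd * Derive x (s + sd * tau))))
        by (rewrite e; ring).
      apply (is_derive_minus (fun tau => t (s + sd * tau)) (fun tau => k (sin (y tau) ^ 2))).
      + apply (is_derive_comp t (fun tau => s + sd * tau)); [apply Derive_correct, dt|].
        auto_derive; [exact I|ring].
      + replace (m _ * _ * _) with
          (scal (2 * sin (y tau) * cos (y tau) * (sd * Derive x (s + sd * tau))) (m (sin (y tau) ^ 2)))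
          by (unfold scal; simpl; unfold mult; simpl; ring).
        apply (is_derive_comp k (fun tau => sin (y tau) ^ 2)); [apply hk, hy2|].
        assert (hdy := dy tau ltac:(lra)).
        auto_derive; [eexists; exact hdy|].
        replace (Derive (fun x0 => y x0) tau) with (sd * Derive x (s + sd * tau))
          by (symmetry; apply is_derive_unique, hdy); ring.
    - rewrite Rmult_0_r, Rplus_0_r, y0, sin_0; replace (0 ^ 2) with 0 by ring; rewrite k0; ring. }
  exists d; split; [lra|]; intros S hS; rewrite <- k0.
  assert (s0 := near_axis_trig r0 hr0).
  apply (cap_regular (sin r0 ^ 2) sg k m m2 S); [|exact hk|].
  { split; [nra|rewrite sin2_cos2_pow; nra]. }
  assert (cosp : forall r, 0 <= r < r0 -> cos r = sqrt (1 - sin r ^ 2)).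
  { intros r hr; rewrite sin2_cos2_pow; replace (1 - (1 - cos r ^ 2)) with (cos r ^ 2) by ring.
    symmetry; apply sqrt_pow2, cos_ge_0; lra. }
  intros p; rewrite hS; split.
  - intros (r & th & hr & hrs & ->).
    pose (tau := sd * (r - s)).
    assert (er : r = s + sd * tau).
    { unfold tau; transitivity (s + sd ^ 2 * (r - s)); [rewrite hsd|]; ring. }
    assert (htau : 0 <= tau < d).
    { split; [apply hside, hr|]; rewrite er, dist in hrs; [exact hrs|apply hside, hr]. }
    destruct (ybd tau htau) as [hy1 hy2].
    assert (ey : x r = y tau) by (unfold y; rewrite <- er; reflexivity).
    assert (et := hkt tau htau); rewrite <- er in et.
    exists (sin (x r) * cos th), (sin (x r) * sin th).
    replace ((sin (x r) * cos th) ^ 2 + (sin (x r) * sin th) ^ 2) with (sin (x r) ^ 2).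
    2:{ transitivity (sin (x r) ^ 2 * (sin th ^ 2 + cos th ^ 2)); [rewrite (sin2_cos2_pow th)|]; ring. }
    rewrite et, ey, (cosp _ hy1); split; [exact hy2|reflexivity].
  - intros (a & b & hab & ->).
    destruct (polar a b) as (th & ea & eb); set (q := sqrt (a ^ 2 + b ^ 2)) in *.
    assert (q0 : 0 <= q) by apply sqrt_pos.
    assert (qq : q ^ 2 = a ^ 2 + b ^ 2) by (apply pow2_sqrt; nra).
    rewrite <- qq in *; clearbody q.
    assert (qs : q < sin r0) by nra.
    assert (sr1 := SIN_bound r0).
    assert (as_ := sin_asin q ltac:(lra)); assert (ab := asin_bound q).
    assert (a0 : 0 <= asin q).
    { apply Rnot_lt_le; intros h.
      assert (sin (asin q) < sin 0) by (apply sin_increasing_1; lra).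
      rewrite sin_0 in *; lra. }
    assert (ar : asin q < r0) by (apply sin_lt_iff; lra).
    destruct (onto (asin q) ltac:(lra)) as (tau & htau & ey).
    assert (tau <> d) by (intros ->; unfold r0 in ar; lra).
    exists (s + sd * tau), th; split; [apply hJd; lra|split; [rewrite dist; lra|]].
    fold (y tau); rewrite hkt by lra; rewrite ey, (cosp (asin q)), as_ by lra.
    rewrite <- ea, <- eb; reflexivity.
Qed.

Lemma Ck_on_2_mirror (J : R -> Prop) (x : R -> R) :
  Ck_on 2 J x -> Ck_on 2 J (fun r => PI - x r).
Proof.
  rewrite !Ck_on_2; intros h s hs.
  apply (C2_near _ (fun r => - Derive x r) (fun r => - Derive (Derive x) r)).
  generalize (h s hs); apply filter_imp; intros r (h1 & h2 & h3).
  split; [|split; [apply (is_derive_opp (Derive x)), Derive_correct, h2|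
                   apply (continuous_opp (Derive (Derive x))), h3]].
  auto_derive; [exact h1|]; change (fun x0 => x x0) with x; ring.
Qed.

Lemma immersed_off_axis (x t : R -> R) (s th : R) :
  ex_derive x s -> Derive x s ^ 2 + Derive t s ^ 2 = 1 -> off_axis x s ->
  immersed_at (rot x t) s th.
Proof.
  intros dx hu ho a b; rewrite du_rot, dv_rot by exact dx.
  unfold lincomb, co1, co2, co3, co4; simpl fst; simpl snd; intros e.
  injection e; intros e4 e3 e2 e1; clear e.
  assert (sp := off_axis_sin x s ho).
  assert (ax : a * Derive x s = 0).
  { apply Rmult_eq_reg_r with (sin (x s)); lra. }
  assert (a0 : a = 0).
  { assert (a ^ 2 = 0); [|nra].
    transitivity (a ^ 2 * (Derive x s ^ 2 + Derive t s ^ 2)); [rewrite hu; ring|].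
    transitivity ((a * Derive x s) ^ 2 + (a * Derive t s) ^ 2); [ring|].
    rewrite ax; replace (a * Derive t s) with 0 by lra; ring. }
  split; [exact a0|]; rewrite a0 in e1, e2.
  assert (b1 : b * sin th = 0) by (apply Rmult_eq_reg_r with (sin (x s)); lra).
  assert (b2 : b * cos th = 0) by (apply Rmult_eq_reg_r with (sin (x s)); lra).
  assert (b ^ 2 = 0); [|nra].
  transitivity ((b * sin th) ^ 2 + (b * cos th) ^ 2); [|rewrite b1, b2; ring].
  transitivity (b ^ 2 * (sin th ^ 2 + cos th ^ 2)); [rewrite sin2_cos2_pow|]; ring.
Qed.

(** Off the axes the rotation parametrization is an immersion; on an axis
    [axis_cap] applies, to pi - x and the reflected equation if x = pi. *)
Lemma solves_profile_regular (c L u : R) (H F : R -> R) (J : R -> Prop) (x t : R -> R) :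
  interval J -> Ck_on 2 J x -> Ck_on 2 J t ->
  (forall r, J r -> 0 <= x r <= PI) ->
  (forall r, J r -> Derive x r ^ 2 + Derive t r ^ 2 = 1) ->
  (forall r, inside J r -> off_axis x r) ->
  solves_profile c L u H F J x t ->
  regular_rotational J x t.
Proof.
  intros hJ hx ht hrange hu hin hsol.
  split; [exact hx|split; [exact ht|split; [exact hrange|split; [exact hu|]]]].
  intros s hs.
  assert (dx : forall r, J r -> ex_derive x r).
  { intros r hr; apply (locally_singleton _ _ (proj1 (Ck_on_2 J x) hx r hr)). }
  destruct (Req_dec (x s) 0) as [z|z]; [right|destruct (Req_dec (x s) PI) as [z'|z']; [right|left]].
  - destruct (axis_cap c L u H F J x t 1 s hJ hx ht hrange hu hin hsol hs z) as (d & hd & hS).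
    exists d; split; [exact hd|].
    replace (rot x t s 0) with (0, 0, 1, t s)
      by (unfold rot; rewrite z, sin_0, cos_0; apply R4_eq; ring).
    apply hS; intros p; split; intros (r & th & hr & hrs & ->); exists r, th;
      (split; [exact hr|split; [exact hrs|apply R4_eq; ring]]).
  - assert (moff : forall r, off_axis x r <-> off_axis (fun r => PI - x r) r)
      by (intros r; unfold off_axis; split; intros; lra).
    assert (mD : forall r, J r -> Derive (fun r => PI - x r) r = - Derive x r).
    { intros r hr; apply is_derive_unique; auto_derive; [apply dx, hr|].
      change (fun x0 => x x0) with x; ring. }
    destruct (axis_cap c L (- u) (opp_conj H) (fun r => F (PI - r)) J (fun r => PI - x r) t (-1) s)
      as (d & hd & hS); try assumption.
    + apply Ck_on_2_mirror, hx.
    + intros r hr; specialize (hrange r hr); lra.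
    + intros r hr; rewrite mD by exact hr; rewrite <- (hu r hr); ring.
    + intros r hr; apply (proj1 (moff r)), hin, hr.
    + destruct hsol as (hc & hH & hHu & hF & htF).
      split; [exact hc|split; [apply opp_conj_decreasing, hH|split; [|split]]].
      * unfold opp_conj; rewrite Ropp_involutive, hHu; reflexivity.
      * apply profile_equation_mirror, hF.
      * intros r hr ho; replace (PI - (PI - x r)) with (x r) by ring.
        apply htF, moff; assumption.
    + lra.
    + exists d; split; [exact hd|].
      replace (rot x t s 0) with (0, 0, -1, t s)
        by (unfold rot; rewrite z', sin_PI, cos_PI; apply R4_eq; ring).
      apply hS; intros p; split; intros (r & th & hr & hrs & ->); exists r, th;
        (split; [exact hr|split; [exact hrs|]]);
        unfold rot; rewrite sin_PI_x, Rtrigo_facts.cos_pi_minus; apply R4_eq; ring.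
  - intros th; apply immersed_off_axis; [apply dx, hs|apply hu, hs|].
    specialize (hrange s hs); split; lra.
Qed.

(** * Extension to an endpoint *)

(** With sg = 1 the points to the left of a, with sg = -1 those to its right; both
    kinds of endpoints are treated at once. *)
Definition before (sg a r : R) : Prop := 0 < sg * (a - r).

Definition side (sg a : R) : (R -> Prop) -> Prop := within (before sg a) (locally a).

Lemma before_locally (sg a r : R) : sg ^ 2 = 1 -> before sg a r -> locally r (before sg a).
Proof.
  intros hs hr; exists (mkposreal _ hr); intros q hq; change (Rabs (q - r) < sg * (a - r)) in hq.
  apply Rabs_lt_between in hq; unfold before in *.
  destruct (sqr_eq_1 sg hs) as [-> | ->]; lra.
Qed.

Lemma side_proper (sg a : R) : sg ^ 2 = 1 -> ProperFilter (side sg a).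
Proof.
  intros hs; constructor; [|apply within_filter, locally_filter].
  intros P [e he]; exists (a - sg * (e / 2)); assert (p := cond_pos e).
  apply he; [|unfold before; nra].
  change (Rabs (a - sg * (e / 2) - a) < e).
  replace (a - sg * (e / 2) - a) with (- sg * (e / 2)) by ring.
  destruct (sqr_eq_1 sg hs) as [-> | ->].
  - rewrite Rabs_left; lra.
  - rewrite Rabs_pos_eq; lra.
Qed.

(** Beyond some parameter p of J all points up to a are interior to J. *)
Lemma endpoint_side (J : R -> Prop) (a : R) :
  interval J -> endpoint J a -> ~ J a ->
  exists sg p, sg ^ 2 = 1 /\ J p /\ (forall r, J r -> before sg a r) /\
    (forall r, before sg a r -> sg * (a - r) < sg * (a - p) -> inside J r).
Proof.
  intros [_ (p & q & hp & hq & hpq)] [[hub hlub]|[hlb hglb]] ha.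
  - exists 1, p; split; [ring|split; [exact hp|split]].
    + intros r hr; assert (h := hub r hr); simpl in h; unfold before.
      assert (r <> a) by (intros ->; apply ha, hr); lra.
    + unfold before; intros r h1 h2.
      assert (exists r', J r' /\ r < r') as (r' & hr' & hlt).
      { apply NNPP; intros hn.
        assert (h : Rbar_le a r); [|simpl in h; lra].
        apply hlub; intros r' hr'; simpl; apply Rnot_lt_le; intros hlt; apply hn; exists r'; auto. }
      exists p, r'; repeat split; try assumption; lra.
  - exists (-1), q; split; [ring|split; [exact hq|split]].
    + intros r hr; assert (h := hlb r hr); simpl in h; unfold before.
      assert (r <> a) by (intros ->; apply ha, hr); lra.
    + unfold before; intros r h1 h2.
      assert (exists r', J r' /\ r' < r) as (r' & hr' & hlt).
      { apply NNPP; intros hn.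
        assert (h : Rbar_le r a); [|simpl in h; lra].
        apply hglb; intros r' hr'; simpl; apply Rnot_lt_le; intros hlt; apply hn; exists r'; auto. }
      exists r', q; repeat split; try assumption; lra.
Qed.

(** Extending the second derivative by its limit l beyond a gives a continuous
    function, whose second primitive with the initial data of f at a point s of
    J coincides with f before a. *)
Lemma Ck_on_2_extension (J : R -> Prop) (f : R -> R) (sg a p l : R) :
  sg ^ 2 = 1 -> Ck_on 2 J f -> (forall r, J r -> before sg a r) -> J p ->
  (forall r, before sg a r -> sg * (a - r) < sg * (a - p) -> J r) ->
  filterlim (Derive (Derive f)) (side sg a) (locally l) ->
  exists f', (forall r, before sg a r -> f' r = f r) /\ Ck_on 2 (adjoin J a) f'.
Proof.
  intros hsg hf hJ hp hreg hl.
  assert (sgc := sqr_eq_1 sg hsg).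
  assert (dec : forall r, { before sg a r } + { ~ before sg a r }).
  { intros r; unfold before; destruct (Rlt_dec 0 (sg * (a - r))); [left|right]; assumption. }
  pose (D := fun r => sg * (a - r) < sg * (a - p)).
  assert (Dloc : forall r, D r -> locally r D).
  { intros r hr; assert (he : 0 < sg * (a - p) - sg * (a - r)) by (unfold D in hr; lra).
    exists (mkposreal _ he); intros q hq; change (Rabs (q - r) < sg * (a - p) - sg * (a - r)) in hq.
    apply Rabs_lt_between in hq; unfold D; destruct sgc as [-> | ->]; lra. }
  assert (Dconv : forall q r w, D q -> D r -> Rmin q r <= w <= Rmax q r -> D w).
  { unfold D, Rmin, Rmax; intros q r w; destruct (Rle_dec q r), sgc as [-> | ->]; lra. }
  assert (bconv : forall q r w, before sg a q -> before sg a r ->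
            Rmin q r <= w <= Rmax q r -> before sg a w).
  { unfold before, Rmin, Rmax; intros q r w; destruct (Rle_dec q r), sgc as [-> | ->]; lra. }
  assert (hf2 := proj1 (Ck_on_2 J f) hf).
  pose (h := fun r => if dec r then Derive (Derive f) r else l).
  assert (hh : forall r, before sg a r -> h r = Derive (Derive f) r).
  { intros r hr; unfold h; destruct (dec r); [reflexivity|contradiction]. }
  assert (hc : forall r, D r -> continuous h r).
  { intros r hr; destruct (dec r) as [hb|hb].
    - apply (continuous_ext_loc h (Derive (Derive f))).
      + apply (filter_imp (before sg a)); [intros; symmetry; apply hh; assumption|].
        apply before_locally; assumption.
      + apply (locally_singleton _ _ (hf2 r (hreg r hb hr))).
    - assert (hr' : sg * (a - r) <= 0) by (unfold before in hb; lra).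
      destruct (Req_dec r a) as [->|hne].
      + assert (ha : h a = l) by (unfold h; destruct (dec a); [contradiction|reflexivity]).
        apply (proj2 (filterlim_locally h (h a))); intros e; rewrite ha.
        destruct (proj1 (filterlim_locally _ _) hl e) as [d hd].
        exists d; intros y hy; unfold h; destruct (dec y); [apply hd; assumption|apply ball_center].
      + assert (he : 0 < - (sg * (a - r))).
        { destruct sgc as [-> | ->]; destruct (Rtotal_order r a) as [|[|]]; lra. }
        apply (continuous_ext_loc h (fun _ => l)); [|apply continuous_const].
        exists (mkposreal _ he); intros q hq; change (Rabs (q - r) < - (sg * (a - r))) in hq.
        apply Rabs_lt_between in hq; unfold h; destruct (dec q) as [hq'|]; [|reflexivity].
        exfalso; unfold before in hq'; destruct sgc as [-> | ->]; lra. }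
  assert (prim : forall (k : R -> R) (s y0 : R), D s -> (forall r, D r -> continuous k r) ->
     forall r, D r -> is_derive (fun r => y0 + RInt k s r) r (k r)).
  { intros k s y0 hs hk r hr.
    replace (k r) with (0 + k r) by ring.
    apply (is_derive_plus (fun _ => y0) (fun r => RInt k s r)); [apply (is_derive_const y0 r)|].
    apply (is_derive_RInt k (RInt k s) s r); [|apply hk, hr].
    apply (filter_imp D); [|apply Dloc, hr]; intros q hq.
    apply (RInt_correct k s q), ex_RInt_continuous; intros w hw.
    apply hk, (Dconv s q w hs hq hw). }
  pose (s := (p + a) / 2).
  assert (hpb := hJ p hp).
  assert (hs : D s /\ before sg a s) by (unfold D, before, s in *; destruct sgc as [-> | ->]; lra).
  destruct hs as [Ds bs].
  pose (f1 := fun r => Derive f s + RInt h s r).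
  pose (f0 := fun r => f s + RInt f1 s r).
  assert (d1 : forall r, D r -> is_derive f1 r (h r)) by (intros r hr; apply prim; assumption).
  assert (d0 : forall r, D r -> is_derive f0 r (f1 r)).
  { intros r hr; apply prim; try assumption; intros q hq.
    apply (ex_derive_continuous f1); eexists; apply d1, hq. }
  assert (e1 : forall r, D r -> before sg a r -> f1 r = Derive f r).
  { intros r hr hb; apply Rminus_diag_uniq.
    apply (gronwall_zero (fun r => f1 r - Derive f r) (fun r => h r - Derive (Derive f) r) 0 s r).
    - intros q hq; assert (Dq := Dconv _ _ _ Ds hr hq); assert (bq := bconv _ _ _ bs hb hq); split.
      + apply (is_derive_minus f1 (Derive f)); [apply d1, Dq|].
        apply Derive_correct, (locally_singleton _ _ (hf2 q (hreg q bq Dq))).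
      + rewrite (hh q bq), Rminus_diag, Rabs_R0; lra.
    - unfold f1; rewrite RInt_point; unfold zero; simpl; ring. }
  assert (e0 : forall r, D r -> before sg a r -> f0 r = f r).
  { intros r hr hb; apply Rminus_diag_uniq.
    apply (gronwall_zero (fun r => f0 r - f r) (fun r => f1 r - Derive f r) 0 s r).
    - intros q hq; assert (Dq := Dconv _ _ _ Ds hr hq); assert (bq := bconv _ _ _ bs hb hq); split.
      + apply (is_derive_minus f0 f); [apply d0, Dq|].
        apply Derive_correct, (locally_singleton _ _ (hf2 q (hreg q bq Dq))).
      + rewrite (e1 q Dq bq), Rminus_diag, Rabs_R0; lra.
    - unfold f0; rewrite RInt_point; unfold zero; simpl; ring. }
  pose (f' := fun r => if dec r then f r else f0 r).
  assert (hf' : forall r, before sg a r -> f' r = f r).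
  { intros r hr; unfold f'; destruct (dec r); [reflexivity|contradiction]. }
  assert (hf0 : forall r, D r -> f0 r = f' r).
  { intros r hr; unfold f'; destruct (dec r) as [hb|hb]; [apply e0; assumption|reflexivity]. }
  exists f'; split; [exact hf'|].
  apply Ck_on_2; intros r [hr| ->].
  - apply (C2_near f' (Derive f) (Derive (Derive f))).
    assert (hb := before_locally sg a r hsg (hJ r hr)); apply locally_locally in hb.
    generalize (filter_and _ _ (hf2 r hr) hb); apply filter_imp.
    intros q ((h1 & h2 & h3) & hq); split; [|split; [apply Derive_correct, h2|exact h3]].
    apply (is_derive_ext_loc f); [|apply Derive_correct, h1].
    revert hq; apply filter_imp; intros w hw; symmetry; apply hf', hw.
  - apply (C2_near f' f1 h).
    assert (Da : D a) by (unfold D, before in *; rewrite Rminus_diag, Rmult_0_r; exact hpb).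
    assert (hb := Dloc a Da); revert hb; apply filter_imp; intros q hq.
    split; [|split; [apply d1, hq|apply hc, hq]].
    apply (is_derive_ext_loc f0); [|apply d0, hq].
    apply (filter_imp D); [exact hf0|apply Dloc, hq].
Qed.

Lemma lim_between {T : Type} (E : (T -> Prop) -> Prop) {PF : ProperFilter E} (f : T -> R) (l A B : R) :
  filterlim f E (locally l) -> E (fun r => A <= f r <= B) -> A <= l <= B.
Proof.
  intros hf hE; split; apply le_epsilon; intros e he;
  destruct (filter_ex _ (filter_and _ _ (proj1 (filterlim_locally f l) hf (mkposreal e he)) hE))
    as (r & hr & hAB); change (Rabs (f r - l) < e) in hr; apply Rabs_lt_between in hr; lra.
Qed.

(** A Lipschitz function satisfies the Cauchy criterion. *)
Lemma lipschitz_limit (f : R -> R) (sg a p : R) :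
  sg ^ 2 = 1 -> before sg a p ->
  (forall r, before sg a r -> sg * (a - r) < sg * (a - p) ->
     ex_derive f r /\ Rabs (Derive f r) <= 1) ->
  exists l, filterlim f (side sg a) (locally l).
Proof.
  intros hsg hp hf; assert (PF := side_proper sg a hsg).
  assert (sgc := sqr_eq_1 sg hsg).
  apply (proj1 (@filterlim_locally_cauchy R R_CompleteSpace (side sg a) _ f)); intros e.
  assert (he : 0 < Rmin (e / 2) (sg * (a - p))) by (apply Rmin_pos; [apply is_pos_div_2|exact hp]).
  assert (m1 := Rmin_l (e / 2) (sg * (a - p))); assert (m2 := Rmin_r (e / 2) (sg * (a - p))).
  set (d := Rmin (e / 2) (sg * (a - p))) in *.
  exists (fun r => before sg a r /\ sg * (a - r) < d); split.
  - exists (mkposreal _ he); intros r hr hb; split; [exact hb|].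
    change (Rabs (r - a) < d) in hr; apply Rabs_lt_between in hr; destruct sgc as [-> | ->]; lra.
  - unfold before; intros q r [hq hq'] [hr hr'].
    destruct (MVT_abs f (Derive f) q r) as (w & ew & hw).
    + intros w hw; apply is_derive_Reals, Derive_correct, hf; unfold before in *;
      revert hw; unfold Rmin, Rmax; destruct (Rle_dec q r), sgc as [-> | ->]; lra.
    + change (Rabs (f r - f q) < e); rewrite ew.
      assert (hw1 : Rabs (Derive f w) <= 1).
      { apply hf; unfold before in *; revert hw; unfold Rmin, Rmax;
        destruct (Rle_dec q r), sgc as [-> | ->]; lra. }
      assert (hqr : Rabs (r - q) < e) by (apply Rabs_lt_between; destruct sgc as [-> | ->]; lra).
      pose proof (Rabs_pos (r - q)); pose proof (Rabs_pos (Derive f w)); nra.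
Qed.

Lemma inside_adjoin (J : R -> Prop) (sg a p r : R) :
  sg ^ 2 = 1 -> J p -> (forall r, J r -> before sg a r) ->
  (forall r, before sg a r -> sg * (a - r) < sg * (a - p) -> inside J r) ->
  interval J -> inside (adjoin J a) r -> inside J r.
Proof.
  intros hsg hp hb hreg hJ (q & q' & hq & hq' & hr).
  assert (sgc := sqr_eq_1 sg hsg).
  assert (hpb := hb p hp).
  destruct hq as [hq|eq], hq' as [hq'|eq'].
  - exists q, q'; auto.
  - subst q'; assert (hbq := hb q hq); unfold before in *.
    assert (sg = 1) by (destruct sgc as [-> | ->]; lra); subst sg.
    assert (m1 := Rmax_l p r); assert (m2 := Rmax_r p r).
    assert (m3 : Rmax p r < a) by (apply Rmax_lub_lt; lra).
    destruct (hreg ((Rmax p r + a) / 2)) as (w & w' & hw & hw' & hww); [lra|lra|].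
    exists q, w'; repeat split; try assumption; lra.
  - subst q; assert (hbq := hb q' hq'); unfold before in *.
    assert (sg = -1) by (destruct sgc as [-> | ->]; lra); subst sg.
    assert (m1 := Rmin_l p r); assert (m2 := Rmin_r p r).
    assert (m3 : a < Rmin p r) by (apply Rmin_glb_lt; lra).
    destruct (hreg ((Rmin p r + a) / 2)) as (w & w' & hw & hw' & hww); [lra|lra|].
    exists w, q'; repeat split; try assumption; lra.
  - lra.
Qed.

Lemma interval_adjoin (J : R -> Prop) (sg a p : R) :
  sg ^ 2 = 1 -> J p -> (forall r, J r -> before sg a r) ->
  (forall r, before sg a r -> sg * (a - r) < sg * (a - p) -> inside J r) ->
  interval J -> interval (adjoin J a).
Proof.
  intros hsg hp hb hreg hJ; assert (hJ' := hJ); destruct hJ' as [hconv (q & q' & hq & hq' & hqq)].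
  split; [|exists q, q'; split; [left; exact hq|split; [left; exact hq'|exact hqq]]].
  intros u v w hu hv hw.
  destruct (Req_dec w u) as [->|n1]; [exact hu|].
  destruct (Req_dec w v) as [->|n2]; [exact hv|].
  left; apply (inside_locally J w hJ), (inside_adjoin J sg a p w hsg hp hb hreg hJ).
  exists u, v; repeat split; try assumption; lra.
Qed.

(** By unit speed x has a limit at a.  The second derivatives are
    x'' = - F (x) H (F cot x) and t'' = x' H (F cot x), so the first has a limit by
    [profile_limits]; once x is extended, x' has a limit and so does t''.  Every
    clause needed for regularity at a then follows by continuity. *)
Lemma profile_extends (c L u : R) (H F : R -> R) (J : R -> Prop) (x t : R -> R) (a : R) :
  interval J -> regular_rotational J x t -> solves_profile c L u H F J x t ->
  (forall s, inside J s -> off_axis x s) ->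
  (forall s, J s -> off_axis x s -> profile_curvature x t s = H (F (x s) * cot (x s))) ->
  endpoint J a -> ~ J a ->
  exists x' t', (forall s, J s -> x' s = x s /\ t' s = t s) /\
    regular_rotational (adjoin J a) x' t'.
Proof.
  intros hJ (hx & ht & hrange & hu & _) hsol hin hk hend ha.
  assert (hsol' := hsol); destruct hsol' as (hc & hH & hHu & hF & htF).
  destruct (endpoint_side J a hJ hend ha) as (sg & p & hsg & hp & hb & hreg).
  assert (hregJ : forall r, before sg a r -> sg * (a - r) < sg * (a - p) -> J r)
    by (intros r h1 h2; apply (inside_locally J r hJ), hreg; assumption).
  assert (PF := side_proper sg a hsg).
  assert (FF : Filter (side sg a)) by apply PF.
  assert (near : forall P : R -> Prop,
     (forall r, before sg a r -> sg * (a - r) < sg * (a - p) -> P r) -> side sg a P).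
  { intros P hP; assert (hpb := hb p hp); unfold before in hpb.
    exists (mkposreal _ hpb); intros r hr hbr; apply hP; [exact hbr|].
    change (Rabs (r - a) < sg * (a - p)) in hr; apply Rabs_lt_between in hr.
    destruct (sqr_eq_1 sg hsg) as [-> | ->]; lra. }
  assert (C2 : forall r, J r -> ex_derive x r /\ ex_derive t r).
  { intros r hr; split; [apply (locally_singleton _ _ (proj1 (Ck_on_2 J x) hx r hr))|
      apply (locally_singleton _ _ (proj1 (Ck_on_2 J t) ht r hr))]. }
  assert (pt : forall r, before sg a r -> sg * (a - r) < sg * (a - p) ->
     J r /\ off_axis x r /\ Derive t r = F (x r) /\
     Derive (Derive x) r = - (F (x r) * H (F (x r) * cot (x r))) /\
     Derive (Derive t) r = Derive x r * H (F (x r) * cot (x r))).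
  { intros r h1 h2; assert (hr := hregJ r h1 h2); assert (ho := hin r (hreg r h1 h2)).
    split; [exact hr|split; [exact ho|split; [apply htF; assumption|]]].
    destruct (unit_speed_derivatives J x t r hJ hx ht hu hr) as [e1 e2].
    rewrite e1, e2, (hk r hr ho), (htF r hr ho); split; reflexivity. }
  destruct (lipschitz_limit x sg a p hsg (hb p hp)) as [lx hlx].
  { intros r h1 h2; assert (hr := hregJ r h1 h2).
    split; [apply C2, hr|apply (unit_speed_bound _ _ (hu r hr))]. }
  assert (hlx' : filterlim x (side sg a) (within on_strip (locally lx))).
  { intros P hP.
    assert (k1 : side sg a (fun r => on_strip (x r) -> P (x r))) by exact (hlx _ hP).
    assert (k2 : side sg a (off_axis x)) by (apply near; intros r h1 h2; apply pt; assumption).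
    change (side sg a (fun r => P (x r))).
    generalize (filter_and _ _ k1 k2); apply filter_imp; intros r [q1 q2]; exact (q1 q2). }
  assert (hlxb : 0 <= lx <= PI).
  { apply (lim_between (side sg a) x); [exact hlx|].
    apply near; intros r h1 h2; apply hrange, hregJ; assumption. }
  destruct (profile_limits c L H F u lx hc hH hHu hF hlxb) as (lF & lk & hlF & hlk & _).
  { intros d hd.
    assert (k1 : side sg a (fun r => Rabs (x r - lx) < d))
      by exact (proj1 (filterlim_locally x lx) hlx (mkposreal d hd)).
    assert (k2 : side sg a (fun r => J r /\ off_axis x r /\ Derive t r = F (x r)))
      by (apply near; intros r h1 h2; destruct (pt r h1 h2) as (q1 & q2 & q3 & _); auto).
    destruct (filter_ex _ (filter_and _ _ k1 k2)) as (r & hr & hJr & ho & e).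
    exists (x r); split; [exact ho|split; [exact hr|]].
    rewrite <- e; apply (unit_speed_bound (Derive x r)), hu, hJr. }
  assert (lF' := filterlim_comp _ _ _ x F _ _ _ hlx' hlF).
  assert (lH' : filterlim (fun r => H (F (x r) * cot (x r))) (side sg a) (locally (H lk))).
  { apply (lim_comp_continuous (side sg a) (fun r => F (x r) * cot (x r)) H).
    - apply (decreasing_continuous c L H hc hH).
    - exact (filterlim_comp _ _ _ x (fun r => F r * cot r) _ _ _ hlx' hlk). }
  destruct (Ck_on_2_extension J x sg a p (- (lF * H lk))) as (x' & ex' & Cx'); try assumption.
  { apply (filterlim_ext_loc (fun r => - (F (x r) * H (F (x r) * cot (x r))))).
    - apply near; intros r h1 h2; symmetry; apply pt; assumption.
    - apply lim_opp; [exact FF|]; apply lim_mult; [exact FF|exact lF'|exact lH']. }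
  assert (ext_D : forall f f', (forall r, before sg a r -> f' r = f r) ->
            forall r, before sg a r -> Derive f' r = Derive f r).
  { intros f f' e r hr; apply Derive_ext_loc; apply (filter_imp (before sg a)); [exact e|].
    apply before_locally; assumption. }
  assert (at_a : forall f : R -> R, continuous f a -> filterlim f (side sg a) (locally (f a))).
  { intros f hf; apply continuous_within, hf. }
  assert (hxa := locally_singleton _ _ (proj1 (Ck_on_2 _ x') Cx' a (or_intror eq_refl))).
  destruct hxa as (dx1 & dx2 & _).
  destruct (Ck_on_2_extension J t sg a p (Derive x' a * H lk)) as (t' & et' & Ct'); try assumption.
  { apply (filterlim_ext_loc (fun r => Derive x' r * H (F (x r) * cot (x r)))).
    - apply near; intros r h1 h2; rewrite (ext_D x x' ex' r h1); symmetry; apply pt; assumption.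
    - apply lim_mult; [exact FF| |exact lH'].
      apply at_a, (ex_derive_continuous (Derive x')), dx2. }
  assert (hta := locally_singleton _ _ (proj1 (Ck_on_2 _ t') Ct' a (or_intror eq_refl))).
  destruct hta as (dt1 & dt2 & _).
  assert (cx' := ex_derive_continuous x' a dx1).
  assert (cdx' := ex_derive_continuous (Derive x') a dx2).
  assert (cdt' := ex_derive_continuous (Derive t') a dt2).
  exists x', t'; split; [intros s hs; split; [apply ex'|apply et']; apply hb, hs|].
  apply (solves_profile_regular c L u H F); [|exact Cx'|exact Ct'| | | |].
  - apply (interval_adjoin J sg a p); assumption.
  - intros r [hr| ->]; [rewrite ex' by (apply hb, hr); apply hrange, hr|].
    apply (lim_between (side sg a) x'); [apply at_a, cx'|].
    apply near; intros r h1 h2; rewrite ex' by exact h1; apply hrange, hregJ; assumption.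
  - intros r [hr| ->].
    { rewrite (ext_D x x' ex'), (ext_D t t' et') by (apply hb, hr); apply hu, hr. }
    apply Rle_antisym;
    apply (lim_between (side sg a) (fun r => Derive x' r ^ 2 + Derive t' r ^ 2) _ 1 1);
    try (apply lim_plus; [exact FF| |]; (apply lim_pow; [exact FF|]); apply at_a; assumption);
    apply near; intros r h1 h2; rewrite (ext_D x x' ex'), (ext_D t t' et') by exact h1;
    rewrite hu by (apply hregJ; assumption); lra.
  - intros r hr; assert (hr' := inside_adjoin J sg a p r hsg hp hb hreg hJ hr).
    unfold off_axis; rewrite ex' by (apply hb, (inside_locally J r hJ hr')); apply hin, hr'.
  - split; [exact hc|split; [exact hH|split; [exact hHu|split; [exact hF|]]]].
    intros r [hr| ->] ho.
    { rewrite (ext_D t t' et') by (apply hb, hr); rewrite ex' by (apply hb, hr).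
      apply htF; [exact hr|]; unfold off_axis in *; rewrite <- ex' by (apply hb, hr); exact ho. }
    destruct (profile_curvature_continuous H F (x' a) hF ho) as [cF _].
    assert (z : 0 <= Derive t' a - F (x' a) <= 0); [|lra].
    apply (lim_between (side sg a) (fun r => Derive t' r + - F (x' r))).
    + apply lim_plus; [exact FF|apply at_a, cdt'|]; apply lim_opp; [exact FF|].
      apply (lim_comp_continuous (side sg a) x' F); [exact cF|apply at_a, cx'].
    + apply near; intros r h1 h2; rewrite (ext_D t t' et' r h1), (ex' r h1).
      destruct (pt r h1 h2) as (_ & _ & -> & _); lra.
Qed.

Theorem theorem4p1
  (g : R -> R) (al : R) (b : Rbar)
  (hg : elliptic_datum g al b)
  (hunif : uniformly_elliptic g al)
  (J : R -> Prop) (x t : R -> R) (N : R -> R -> R4)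
  (hJ : interval J)
  (hreg : regular_rotational J x t)
  (hN : orientation J x t N)
  (hW : weingarten g al J x t N) :
  bounded_second_form J x t N /\
  forall a : R, ~ has_singularity_at J x t a.
Proof.
  destruct (profile_structure g al b J x t N hg hunif hJ hreg hN hW)
    as (c & L & u & H & F & hsol & hin & hk).
  split.
  - assert (hsol' := hsol); destruct hsol' as (hc & hH & hHu & hF & htF).
    destruct (curvature_bounded c L H F u hc hH hHu hF) as [C hC].
    destruct (decreasing_lipschitz c L H hc hH) as [hL hl].
    apply (second_form_bound J x t N (Rmax C (Rabs (H 0) + L * C)) hreg hN).
    intros s hs ho.
    assert (hb : Rabs (F (x s) * cot (x s)) <= C).
    { apply hC; [exact ho|]; rewrite <- (htF s hs ho).
      apply (unit_speed_bound (Derive x s)), hreg, hs. }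
    rewrite (hk s hs ho), (htF s hs ho); split; [|eapply Rle_trans; [exact hb|apply Rmax_l]].
    eapply Rle_trans; [|apply Rmax_r].
    set (k := F (x s) * cot (x s)) in *.
    replace (H k) with (H 0 + (H k - H 0)) by ring.
    eapply Rle_trans; [apply Rabs_triang|].
    specialize (hl k 0); rewrite Rminus_0_r in hl; nra.
  - intros a [hend hno]; destruct (classic (J a)) as [ha|ha]; apply hno.
    + exists x, t; split; [auto|].
      replace (adjoin J a) with J; [exact hreg|].
      apply functional_extensionality; intros s; apply propositional_extensionality.
      unfold adjoin; split; [auto|intros [h| ->]; assumption].
    + apply (profile_extends c L u H F J x t a); assumption.
Qed.
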